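(* There exist constants $D>0$ and $C>0$ depending only on the loss function $\ell$ and on $\gamma$ such that the following two statements hold. (1) For all $J\subset\{1,\dots,N\}$ with $d=\mathrm{card}(J)$, all $A\ge1$ and all $\varepsilon\ge D\sqrt{\frac{d+A\log N}{n}}$, with probability at least $1-N^{-A}$, $$|P(\ell\bullet f_{\hat\lambda^\varepsilon})-P(\ell\bullet f_{\lambda^\varepsilon})|\le C\,B_1\ \vee\ C^{1/2}\|g_\varepsilon\|_{L_2(\Pi)}\,B_1^{1/2},$$ where $$B_1:=\frac{d+A\log N}{n}\vee\Bigl(\sum_{j\notin J}\lambda_j^\varepsilon\Bigr)\sqrt{\frac{d+A\log N}{n}}.$$ (2) For all $A\ge1$, all $\varepsilon\ge D\sqrt{\frac{A\log N}{n}}$, all $J\subset\{1,\dots,N\}$ and all subspaces $L$ of $L_2(\Pi)$ with $d=\dim(L)$, with probability at least $1-N^{-A}$, $$|P(\ell\bullet f_{\hat\lambda^\varepsilon})-P(\ell\bullet f_{\lambda^\varepsilon})|\le C\,B_2\ \vee\ C^{1/2}\|g_\varepsilon\|_{L_2(\Pi)}\,B_2^{1/2},$$ where $$B_2:=\frac{d+A\log N}{n}\vee\Bigl(\sum_{j\notin J}\lambda_j^\varepsilon\vee\max_{j\in J}\|P_{L^\perp}h_j\|_{L_2(\Pi)}\Bigr)\sqrt{\frac{A\log N}{n}}\vee\frac{U(L)\log N}{n}.$$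
   Context: Setting. $S,T$ are measurable spaces, $(X,Y)$ is a random couple in $S\times T$ with distribution $P$, $\Pi$ is the distribution of $X$, and $(X_1,Y_1),\dots,(X_n,Y_n)$ are i.i.d. copies of $(X,Y)$ with empirical distribution $P_n$. For a function $g$ on $S\times T$ (or on $S$, viewed as a function on $S\times T$), $Pg=\mathbb E g(X,Y)$ and $P_ng=n^{-1}\sum_{i=1}^n g(X_i,Y_i)$; in expressions like $P(\ell\bullet f_{\hat\lambda^\varepsilon})$ the integration is over $(x,y)$ only, with $\hat\lambda^\varepsilon$ held fixed. $h_1,\dots,h_N:S\to[-1,1]$ are given measurable functions (the dictionary). $\Lambda=\{(\lambda_1,\dots,\lambda_N):\lambda_j\ge0,\ \sum_{j=1}^N\lambda_j=1\}$, and $f_\lambda=\sum_{j=1}^N\lambda_jh_j$ for $\lambda\in\mathbb R^N$. Loss. $\ell:T\times\mathbb R\to\mathbb R_+$ is a (measurable) loss function such that for every $y\in T$ the function $\ell(y,\cdot)$ is convex and twice differentiable (derivatives $\ell'_u,\ell''_u$ in the second variable), $\ell''_u$ is uniformly bounded on $T\times\mathbb R$, $\sup_{y\in T}\ell(y;0)<\infty$ and $\sup_{y\in T}|\ell'_u(y;0)|<\infty$. For $f:S\to\mathbb R$, $(\ell\bullet f)(x,y):=\ell(y,f(x))$ and $(\ell'\bullet f)(x,y):=\ell'_u(y,f(x))$. It is assumed that the infimum of $P(\ell\bullet g)$ over all measurable $g:S\to\mathbb R$ is attained at some $f_*\in L_2(\Pi)$ with $\|f_*\|_\infty\le M$ for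 a constant $M$, and that $\tau(M\vee1)>0$, where $\tau(R):=\frac12\inf_{y\in T}\inf_{|u|\le R}\ell''_u(y,u)$. Estimators. For a regularization parameter $\varepsilon$ (with the convention $0\log0=0$), $$\hat\lambda^\varepsilon:=\operatorname*{argmin}_{\lambda\in\Lambda}\Bigl[P_n(\ell\bullet f_\lambda)+\varepsilon\sum_{j=1}^N\lambda_j\log\lambda_j\Bigr],\qquad \lambda^\varepsilon:=\operatorname*{argmin}_{\lambda\in\Lambda}\Bigl[P(\ell\bullet f_\lambda)+\varepsilon\sum_{j=1}^N\lambda_j\log\lambda_j\Bigr].$$ $a\vee b=\max(a,b)$. The function $g_\varepsilon$. $\mathcal L$ is the linear span of $\{h_1,\dots,h_N\}$, viewed as a subspace of $L_2(P)$, $P_{\mathcal L}$ is the orthogonal projector onto $\mathcal L$ in $L_2(P)$, and $g_\varepsilon:=P_{\mathcal L}(\ell'\bullet f_{\lambda^\varepsilon})$ (a function of $x$ only). Subspaces. For a subspace $L\subset L_2(\Pi)$, $U(L):=\sup_{f\in L,\ \|f\|_{L_2(\Pi)}=1}\|f\|_\infty+1$; $L^\perp$ is its orthogonal complement in $L_2(\Pi)$ and $P_{L^\perp}$ is the orthogonal projector onto $L^\perp$. (A maximum, or a supremum of norms, over an empty set is $0$.) Standing assumption: $N\ge(\log n)^\gamma$ for some fixed $\gamma>0$. *)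

(* Defs.v *)
From HB Require Import structures.
From mathcomp Require Import all_boot all_order all_algebra.
From mathcomp Require Import all_classical all_reals all_analysis.

Set Implicit Arguments.
Unset Strict Implicit.
Unset Printing Implicit Defensive.

Import Order.TTheory GRing.Theory Num.Theory.
Import numFieldNormedType.Exports.

Local Open Scope classical_set_scope.
Local Open Scope ring_scope.

HB.instance Definition _ (dS dT : measure_display)
    (S : measurableType dS) (T : measurableType dT) :=
  @isMeasurableFun.Build _ _ (S * T)%type S fst measurable_fst.

(* Law of the first component of a couple with law P. *)
Definition marginal1 (dS dT : measure_display) (S : measurableType dS)
    (T : measurableType dT) (R : realType) (P : probability (S * T)%type R)
    : probability S R :=
  distribution P (@fst S T).

Definition mutually_independent (dO dE : measure_display)
    (Omega : measurableType dO) (E : measurableType dE) (R : realType)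
    (Pr : probability Omega R) (n : nat) (Z : 'I_n -> {RV Pr >-> E}) : Prop :=
  forall (I : {set 'I_n}) (B : 'I_n -> set E), (forall i, measurable (B i)) ->
    Pr (\bigcap_(i in [set` I]) (Z i @^-1` B i)) =
    (\prod_(i in I) Pr (Z i @^-1` B i))%E.

Definition iid_sample (dO dE : measure_display)
    (Omega : measurableType dO) (E : measurableType dE) (R : realType)
    (Pr : probability Omega R) (P : probability E R)
    (n : nat) (Z : 'I_n -> {RV Pr >-> E}) : Prop :=
  (forall i B, measurable B -> distribution Pr (Z i) B = P B) /\
  mutually_independent Z.

(* Stated through a measurable subevent, so that it is meaningful even before
   E is known to be measurable; for measurable E it says p <= Pr E. *)
Definition with_prob_ge (dO : measure_display) (Omega : measurableType dO)
    (R : realType) (Pr : probability Omega R) (p : R) (E : set Omega) : Prop :=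
  exists F : set Omega, [/\ measurable F, F `<=` E & (p%:E <= Pr F)%E].

Definition is_argmin (X : Type) (R : realType) (D : set X) (F : X -> \bar R)
    (x : X) : Prop :=
  D x /\ forall y, D y -> (F x <= F y)%E.

Definition inner (d : measure_display) (E : measurableType d) (R : realType)
    (Q : probability E R) (f g : E -> R) : R :=
  \int[Q]_x (f x * g x).

Definition L2norm (d : measure_display) (E : measurableType d) (R : realType)
    (Q : probability E R) (f : E -> R) : \bar R :=
  'N[Q]_(2%:E)[EFin \o f]%E.

Definition Linfnorm (d : measure_display) (E : measurableType d)
    (R : realType) (Q : probability E R) (f : E -> R) : \bar R :=
  'N[Q]_(+oo%E)[EFin \o f]%E.

(* A subspace of the space L_2(Q) of classes of functions is encoded by the set
   of all representatives of its elements, hence the last condition. *)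
Record L2_subspace (d : measure_display) (E : measurableType d) (R : realType)
    (Q : probability E R) (L : set (E -> R)) : Prop := {
  subspace_Lfun : forall f, L f -> f \in Lfun Q 2%:E ;
  subspace0 : L (cst 0) ;
  subspace_lin : forall (a : R) f g, L f -> L g -> L (fun x => a * f x + g x) ;
  subspace_ae : forall f g, L f -> g \in Lfun Q 2%:E -> f = g %[ae Q] -> L g }.

Definition lin_comb (X : Type) (R : realType) (N : nat) (h : 'I_N -> X -> R)
    (lam : 'rV[R]_N) : X -> R :=
  fun x => \sum_(j < N) lam ord0 j * h j x.

Definition has_L2_dim (d : measure_display) (E : measurableType d)
    (R : realType) (Q : probability E R) (L : set (E -> R)) (k : nat) : Prop :=
  exists e : 'I_k -> E -> R,
    [/\ forall i, L (e i),
        forall c : 'rV[R]_k, lin_comb e c = cst 0 %[ae Q] -> c = 0 &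
        forall f, L f -> exists c : 'rV[R]_k, f = lin_comb e c %[ae Q]].

Definition orth_compl (d : measure_display) (E : measurableType d)
    (R : realType) (Q : probability E R) (L : set (E -> R)) : set (E -> R) :=
  [set f | f \in Lfun Q 2%:E /\ forall g, L g -> inner Q f g = 0].

Definition is_orth_proj (d : measure_display) (E : measurableType d)
    (R : realType) (Q : probability E R) (V : set (E -> R)) (f p : E -> R)
    : Prop :=
  V p /\ forall g, V g -> inner Q (fun x => f x - p x) g = 0.

(* A representative of the orthogonal projection of f onto V. *)
Definition orth_proj (d : measure_display) (E : measurableType d)
    (R : realType) (Q : probability E R) (V : set (E -> R)) (f : E -> R)
    : E -> R :=
  xget (cst 0) [set p | is_orth_proj Q V f p].

(* The maximum with 0 only matters when the supremum is over the empty set. *)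
Definition U_of (d : measure_display) (E : measurableType d) (R : realType)
    (Q : probability E R) (L : set (E -> R)) : \bar R :=
  (maxe 0 (ereal_sup [set Linfnorm Q f | f in
                        [set f | L f /\ L2norm Q f = 1]]) + 1)%E.

Record is_loss (dT : measure_display) (T : measurableType dT) (R : realType)
    (ell : T -> R -> R) : Prop := {
  loss_measurable :
    measurable_fun setT (fun p : T * measurableTypeR R => ell p.1 p.2) ;
  loss_ge0 : forall y u, 0 <= ell y u ;
  loss_convex : forall y, convex_function (setT : set R^o) (ell y) ;
  loss_derivable : forall y u, derivable (ell y) u 1 ;
  loss_derivable2 : forall y u, derivable (derive1 (ell y)) u 1 ;
  loss_d2_bounded : exists K : R, forall y u, `|derive1n 2 (ell y) u| <= K ;
  loss_at0_bounded : exists K : R, forall y, ell y 0 <= K ;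
  loss_d1_at0_bounded : exists K : R, forall y, `|derive1 (ell y) 0| <= K }.

Definition tau (T : Type) (R : realType) (ell : T -> R -> R) (r : R) : R :=
  2^-1 * inf [set inf [set derive1n 2 (ell y) u | u in [set u : R | `|u| <= r]]
             | y in setT].

(* Extended real, since it is also used for unbounded f. *)
Definition risk (dS dT : measure_display) (S : measurableType dS)
    (T : measurableType dT) (R : realType) (P : probability (S * T)%type R)
    (ell : T -> R -> R) (f : S -> R) : \bar R :=
  (\int[P]_z (ell z.2 (f z.1))%:E)%E.

Definition emp_risk (S T : Type) (R : realType) (n : nat) (z : 'I_n -> S * T)
    (ell : T -> R -> R) (f : S -> R) : R :=
  n%:R^-1 * \sum_(i < n) ell (z i).2 (f (z i).1).

Definition is_target (dS dT : measure_display) (S : measurableType dS)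
    (T : measurableType dT) (R : realType) (P : probability (S * T)%type R)
    (ell : T -> R -> R) (M : R) (f : S -> R) : Prop :=
  [/\ is_argmin [set g : S -> R | measurable_fun setT g] (risk P ell) f,
      f \in Lfun (marginal1 P) 2%:E &
      (Linfnorm (marginal1 P) f <= M%:E)%E].

Definition simplex (R : realType) (N : nat) : set 'rV[R]_N :=
  [set lam | (forall j, 0 <= lam ord0 j) /\ \sum_(j < N) lam ord0 j = 1].

Definition neg_entropy (R : realType) (N : nat) (lam : 'rV[R]_N) : R :=
  \sum_(j < N) lam ord0 j * ln (lam ord0 j).

Definition pen_risk (dS dT : measure_display) (S : measurableType dS)
    (T : measurableType dT) (R : realType) (P : probability (S * T)%type R)
    (ell : T -> R -> R) (N : nat) (h : 'I_N -> S -> R) (eps : R)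
    (lam : 'rV[R]_N) : \bar R :=
  (risk P ell (lin_comb h lam) + (eps * neg_entropy lam)%:E)%E.

Definition pen_emp_risk (S T : Type) (R : realType) (n : nat)
    (z : 'I_n -> S * T) (ell : T -> R -> R) (N : nat) (h : 'I_N -> S -> R)
    (eps : R) (lam : 'rV[R]_N) : \bar R :=
  (emp_risk z ell (lin_comb h lam) + eps * neg_entropy lam)%:E.

Definition dict_span (S T : Type) (R : realType) (N : nat)
    (h : 'I_N -> S -> R) : set (S * T -> R) :=
  [set lin_comb h c \o fst | c in [set: 'rV[R]_N]].

(* The projection of (x, y) |-> ell'(y, f_lam(x)) onto the span of the
   dictionary in L_2(P), as a function of x. *)
Definition g_fun (dS dT : measure_display) (S : measurableType dS)
    (T : measurableType dT) (R : realType) (P : probability (S * T)%type R)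
    (ell : T -> R -> R) (N : nat) (h : 'I_N -> S -> R) (lam : 'rV[R]_N)
    : S -> R :=
  xget (cst 0) [set g : S -> R |
    is_orth_proj P (dict_span h)
      (fun z : S * T => derive1 (ell z.2) (lin_comb h lam z.1)) (g \o fst)].

Definition B1 (R : realType) (n N : nat) (J : {set 'I_N}) (A : R)
    (lam : 'rV[R]_N) : R :=
  let r := (#|J|%:R + A * ln N%:R) / n%:R in
  Num.max r ((\sum_(j < N | j \notin J) lam ord0 j) * Num.sqrt r).

Definition B2 (dS : measure_display) (S : measurableType dS) (R : realType)
    (Q : probability S R) (n N : nat) (h : 'I_N -> S -> R) (J : {set 'I_N})
    (L : set (S -> R)) (d : nat) (A : R) (lam : 'rV[R]_N) : \bar R :=
  (maxe ((d%:R + A * ln N%:R) / n%:R)%:E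
    (maxe
      (maxe (\sum_(j < N | j \notin J) lam ord0 j)%:E
         (\big[maxe/0]_(j in J) L2norm Q (orth_proj Q (orth_compl Q L) (h j)))
       * (Num.sqrt (A * ln N%:R / n%:R))%:E)
      (U_of Q L * (ln N%:R / n%:R)%:E)))%E.

Definition risk_bound (R : realType) (C : R) (gnorm B : \bar R) : \bar R :=
  maxe (C%:E * B)%E ((Num.sqrt C)%:E * gnorm * sqrte B)%E.

(* Main.v *)
(* Let D be the excess of the penalized risk over its minimum, attained at lam.
   Comparing lam with midpoints shows that D(lam') dominates G(lam'), a multiple of
   the squared distance |f_lam' - f_lam|^2 plus eps times the mass that lam' puts
   outside J far above lam.  The entropy enters through the Jensen-Shannon
   divergence, so neither positivity of lam nor differentiability of the entropy is
   needed.  By convexity of the empirical objective on the segment from lam to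
   lamhat, G(lamhat) <= r as soon as the empirical process indexed by the loss
   differences stays below r on the single set {G <= r}: no peeling is necessary.

   That supremum is bounded by a Talagrand-type inequality (entropy method),
   symmetrization and contraction, which reduce it to the Rademacher average of
   f_lam' - f_lam.  The latter is linear in lam': its component in an orthonormal
   system of k functions costs sqrt(k / n) times the radius, and the residuals of
   the h_j a maximal inequality over N functions.  Up to arbitrarily small errors
   only finitely many bounded functions matter, so all of this can be done on a
   finite sample space.

   Finally the risk difference is <g_eps, f_lamhat - f_lam> up to a multiple of
   |f_lamhat - f_lam|^2, by a first-order Taylor expansion of the loss. *)

(* Both statements are instances of one bound, for an orthonormal system of at most [d] functions
   and three parameters. [U] bounds all residuals of the [h_j] uniformly, [m] bounds those with j in
   J in L2, and [kappa] is the price, in L2 radius, of dictionary functions left unprojected. In (1)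
   the system spans the [h_j] with j in J and the others are left alone: [U = 1], [m = 0],
   [kappa = 1]. In (2) the whole dictionary is projected onto [L]: [kappa = 0] and [U] is U(L). The
   obstacle is circularity. On {G <= r} the l1 distance to [lam] outside J is only known to be at
   most [101 * sJ + 4 * r / eps], with [sJ] the mass of [lam] there, so the deviation bound at level
   [r] contains [r / eps] times sqrt(A ln N / n) and times [kappa] sqrt(d / n). The lower bounds on
   [eps] make these a small fraction of [r], so that the level [r], a constant times the rate,
   closes; the term in [kappa] is why (1) needs d in its condition on [eps]. A large multiple of
   [lam] is subtracted in G because a coordinate of the Jensen-Shannon divergence grows linearly in
   [lam'] only when [lam'] is far above [lam]; close to [lam] it is quadratic. *)
Require Import Defs.
From HB Require Import structures.
From mathcomp Require Import all_boot all_order all_algebra.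
From mathcomp Require Import all_classical all_reals all_analysis.
From mathcomp Require Import measurable_realfun ess_sup_inf ring lra.

Set Implicit Arguments.
Unset Strict Implicit.
Unset Printing Implicit Defensive.

Import Order.TTheory GRing.Theory Num.Theory.
Import numFieldNormedType.Exports.

Local Open Scope classical_set_scope.
Local Open Scope ring_scope.

(** * The entropy method on finite product spaces *)

Section FiniteExpectation.
Variable R : realType.

Definition is_pmf (V : finType) (p : V -> R) :=
  (forall v, 0 <= p v) /\ \sum_v p v = 1.

Definition fexp (V : finType) (p G : V -> R) : R := \sum_v p v * G v.

Definition prod_pmf (V : finType) (p : V -> R) n (v : {ffun 'I_n -> V}) : R :=
  \prod_i p (v i).

Definition upd (V : finType) n (v : {ffun 'I_n -> V}) (i : 'I_n) (w : V) :
    {ffun 'I_n -> V} :=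
  [ffun j => if j == i then w else v j].

Lemma prod_pmfP (V : finType) (p : V -> R) n :
  is_pmf p -> is_pmf (@prod_pmf V p n).
Proof.
move=> [p0 p1]; split=> [v|]; first by apply: prodr_ge0.
rewrite /prod_pmf -(bigA_distr_bigA (fun _ => p)) /=.
by rewrite big1 // => i _.
Qed.

Section OneSpace.
Variables (V : finType) (p : V -> R).
Hypothesis Hp : is_pmf p.
Implicit Types G H : V -> R.

Lemma fexp_ext G H : G =1 H -> fexp p G = fexp p H.
Proof. by move=> GH; apply: eq_bigr => v _; rewrite GH. Qed.

Lemma fexpD G H : fexp p (fun v => G v + H v) = fexp p G + fexp p H.
Proof. by rewrite -big_split /=; apply: eq_bigr => v _; rewrite mulrDr. Qed.

Lemma fexpZ a G : fexp p (fun v => a * G v) = a * fexp p G.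
Proof. by rewrite mulr_sumr; apply: eq_bigr => v _; rewrite mulrCA. Qed.

Lemma fexpN G : fexp p (fun v => - G v) = - fexp p G.
Proof. by rewrite /fexp -sumrN; apply: eq_bigr => v _; rewrite mulrN. Qed.

Lemma fexpB G H : fexp p (fun v => G v - H v) = fexp p G - fexp p H.
Proof. by rewrite fexpD fexpN. Qed.

Lemma fexp_cst a : fexp p (fun=> a) = a.
Proof. by rewrite /fexp -mulr_suml Hp.2 mul1r. Qed.

Lemma fexp_le G H : (forall v, G v <= H v) -> fexp p G <= fexp p H.
Proof. by move=> GH; apply: ler_sum => v _; apply: ler_wpM2l => //; case: Hp. Qed.

Lemma fexp_le_cst G a : (forall v, G v <= a) -> fexp p G <= a.
Proof. by move=> Ga; rewrite -[leRHS]fexp_cst; apply: fexp_le. Qed.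

Lemma fexp_ge_cst G a : (forall v, a <= G v) -> a <= fexp p G.
Proof. by move=> Ga; rewrite -[leLHS]fexp_cst; apply: fexp_le. Qed.

Lemma fexp_sum (I : finType) (F : I -> V -> R) :
  fexp p (fun v => \sum_i F i v) = \sum_i fexp p (F i).
Proof.
rewrite /fexp exchange_big /=; apply: eq_bigr => v _.
by rewrite mulr_sumr.
Qed.

Lemma fexp_exchange (W : finType) (q : W -> R) (F : V -> W -> R) :
  fexp p (fun v => fexp q (F v)) = fexp q (fun w => fexp p (F^~ w)).
Proof.
rewrite /fexp.
under eq_bigr => v _ do rewrite mulr_sumr.
rewrite exchange_big /=; apply: eq_bigr => w _.
by rewrite mulr_sumr; apply: eq_bigr => v _; rewrite mulrCA.
Qed.

Lemma fexp_gt0 G : (forall v, 0 < G v) -> 0 < fexp p G.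
Proof.
move=> G0; rewrite lt_def; apply/andP; split; last first.
  by apply: fexp_ge_cst => v; apply: ltW.
apply/negP => /eqP/psumr_eq0P H.
have p0 v : p v = 0.
  have /eqP : p v * G v = 0.
    by apply: H => // w _; rewrite mulr_ge0 ?(ltW (G0 w))//; case: Hp.
  by rewrite mulf_eq0 (gt_eqF (G0 v)) orbF => /eqP.
have := Hp.2; rewrite big1 => [/eqP|v _]; last exact: p0.
by rewrite eq_sym oner_eq0.
Qed.

Lemma fexp_ln_le G : (forall v, 0 < G v) ->
  fexp p (fun v => ln (G v)) <= ln (fexp p G).
Proof.
move=> G0; have M0 := fexp_gt0 G0; set M := fexp p G in M0 *.
have : fexp p (fun v => ln (G v) - ln M) <= fexp p (fun v => M^-1 * G v - 1).
  apply: fexp_le => v.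
  rewrite -ln_div ?posrE // mulrC -[X in ln X](addrNK 1) addrC.
  by apply: le_ln1Dx; rewrite ltrBrDr addNr mulr_gt0 ?invr_gt0.
rewrite fexpB fexp_cst fexpB fexp_cst fexpZ -/M mulVf ?gt_eqF // subrr.
by rewrite subr_le0.
Qed.

Definition ent G : R :=
  fexp p (fun v => G v * ln (G v)) - fexp p G * ln (fexp p G).

(** Variational (Donsker-Varadhan) inequality. Pointwise it is [1 + x <= expR x] at
    [x = H v - ln (G v) + c]; the shift [c] is chosen so that the averaged right-hand side
    vanishes. *)
Lemma ent_dual G H : (forall v, 0 < G v) ->
  fexp p (fun v => G v * H v) <=
  ent G + fexp p G * ln (fexp p (fun v => expR (H v))).
Proof.
move=> G0; have M0 := fexp_gt0 G0.
have E0 : 0 < fexp p (fun v => expR (H v)).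
  by apply: fexp_gt0 => v; apply: expR_gt0.
rewrite /ent; set M := fexp p G in M0 *.
set E := fexp p (fun v => expR (H v)) in E0 *.
set c := ln M - ln E.
have : fexp p (fun v => G v * H v - G v * ln (G v) + c * G v) <=
       fexp p (fun v => expR c * expR (H v) - G v).
  apply: fexp_le => v.
  have -> : G v * H v - G v * ln (G v) + c * G v =
            G v * (H v - ln (G v) + c) by ring.
  have -> : expR c * expR (H v) = G v * expR (H v - ln (G v) + c).
    rewrite [expR (_ + c)]expRD [expR (H v - _)]expRD expRN lnK ?posrE //.
    by field; rewrite gt_eqF.
  have := ler_wpM2l (ltW (G0 v)) (expR_ge1Dx (H v - ln (G v) + c)).
  by rewrite mulrDr mulr1 lerBrDl.
rewrite fexpD !fexpB !fexpZ -/M -/E.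
have -> : expR c * E = M.
  by rewrite /c expRD expRN !lnK ?posrE // mulfVK ?gt_eqF.
rewrite subrr /c; lra.
Qed.

End OneSpace.

Section Tensorization.
Variables (V : finType) (p : V -> R) (n : nat).
Hypothesis Hp : is_pmf p.
Local Notation P := (@prod_pmf V p n).
Implicit Types v : {ffun 'I_n -> V}.

Lemma upd_upd v i u w : upd (upd v i u) i w = upd v i w.
Proof. by apply/ffunP => j; rewrite !ffunE; case: eqP. Qed.

Lemma upd_id v i : upd v i (v i) = v.
Proof. by apply/ffunP => j; rewrite !ffunE; case: eqP => // ->. Qed.

Lemma upd_same v i w : upd v i w i = w.
Proof. by rewrite ffunE eqxx. Qed.

(** Exchanging coordinate [i] with an independent copy is an involution that preserves the product
    weight. *)
Lemma fexp_swap i (G : {ffun 'I_n -> V} -> V -> R) :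
  fexp P (fun v => fexp p (G v)) =
  fexp P (fun v => fexp p (fun w => G (upd v i w) (v i))).
Proof.
rewrite /fexp.
under eq_bigr => v _ do rewrite mulr_sumr.
under [RHS]eq_bigr => v _ do rewrite mulr_sumr.
rewrite (pair_big xpredT xpredT (fun v w => P v * (p w * G v w))) /=.
rewrite (pair_big xpredT xpredT
  (fun v w => P v * (p w * G (upd v i w) (v i)))) /=.
pose f (x : {ffun 'I_n -> V} * V) := (upd x.1 i x.2, x.1 i).
have fK : involutive f.
  by move=> [v w]; rewrite /f /= upd_upd upd_same upd_id.
rewrite (reindex f) /=; last exact/onW_bij/inv_bij.
apply: eq_bigr => -[v w] _ /=; rewrite !mulrA; congr (_ * _).
rewrite /prod_pmf (bigD1 i) //= [in RHS](bigD1 i) //= upd_same.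
rewrite mulrAC [in RHS]mulrAC [p w * _]mulrC; congr (_ * _).
by apply: eq_bigr => j /negPf ji; rewrite ffunE ji.
Qed.

Lemma fexp_resample i (G : {ffun 'I_n -> V} -> R) :
  fexp P G = fexp P (fun v => fexp p (fun w => G (upd v i w))).
Proof.
rewrite -(fexp_swap i (fun v _ => G v)).
by apply: fexp_ext => v; rewrite fexp_cst.
Qed.

(** Through [mix], the function [avg L k] below is the conditional expectation of [expR L] given the
    coordinates from [k] on: it is [expR L] itself for [k = 0] and constant for [k = n]. *)
Let mix (k : nat) (w v : {ffun 'I_n -> V}) : {ffun 'I_n -> V} :=
  [ffun i : 'I_n => if (i < k)%N then w i else v i].

Let avg (L : {ffun 'I_n -> V} -> R) (j : nat) v :=
  fexp P (fun w => expR (L (mix j w v))).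

(** Averaging [avg L k] over coordinate [k] gives [avg L k.+1], so the log-ratio has exponential
    mean 1 in that coordinate and [ent_dual] bounds the left side by the entropy in coordinate [k]
    alone. Jensen's inequality for [ln] then bounds that entropy by a covariance of [expR L] and
    [L]. *)
Lemma ent_step (L : {ffun 'I_n -> V} -> R) (k : 'I_n) :
  fexp P (fun v => expR (L v) * (ln (avg L k v) - ln (avg L k.+1 v))) <=
  fexp P (fun v => fexp p (fun w => expR (L v) * (L v - L (upd v k w)))).
Proof.
pose g v := expR (L v); pose gk := avg L.
rewrite -/gk.
have HP : is_pmf P by exact: prod_pmfP.
have gk0 j v : 0 < gk j v.
  by apply: fexp_gt0 => // w; apply: expR_gt0.
rewrite (fexp_resample k) [leRHS](fexp_resample k).
apply: fexp_le => // v.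
have gS u : gk k.+1 (upd v k u) = gk k.+1 v.
  apply: fexp_ext => w; congr g; apply/ffunP => i; rewrite !ffunE ltnS.
  case: leqP => // ki; case: eqP => // ik.
  by move: ki; rewrite ik ltnn.
have gE : fexp p (fun u => gk k (upd v k u)) = gk k.+1 v.
  rewrite /gk fexp_exchange [RHS](fexp_resample k).
  apply: fexp_ext => w; apply: fexp_ext => u; congr g.
  apply/ffunP => i; rewrite !ffunE ltnS.
  case: (ltngtP i k) => [ik|ik|/ord_inj ->]; rewrite ?eqxx //.
    by rewrite -val_eqE /= ltn_eqF.
  by rewrite -val_eqE /= gtn_eqF.
set phi := fun u => g (upd v k u).
have phi0 u : 0 < phi u by exact: expR_gt0.
have Ephi : 0 < fexp p phi by exact: fexp_gt0.
apply: le_trans (ent_dual Hp _ phi0) _.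
rewrite (_ : fexp p (fun u => expR _) = 1); last first.
  rewrite (@fexp_ext _ _ _ (fun u => (gk k.+1 v)^-1 * gk k (upd v k u))).
    by rewrite fexpZ gE mulVf // gt_eqF.
  by move=> u; rewrite gS expRD expRN !lnK ?posrE // mulrC.
rewrite ln1 mulr0 addr0 /ent.
have -> : fexp p (fun u => fexp p (fun w => phi u *
    (L (upd v k u) - L (upd (upd v k u) k w)))) =
    fexp p (fun u => phi u * ln (phi u)) -
    fexp p phi * fexp p (fun u => ln (phi u)).
  rewrite -[X in _ - X]fexpZ -fexpB.
  have -> : fexp p (fun u => phi u * ln (phi u) - fexp p phi * ln (phi u)) =
    fexp p (fun u => phi u * ln (phi u)) -
      fexp p phi * fexp p (fun u => ln (phi u)).
    by rewrite fexpB fexpZ.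
  rewrite [X in _ - X]mulrC -fexpZ -fexpB; apply: fexp_ext => u.
  rewrite fexpZ fexpB fexp_cst // mulrBr; congr (_ * _ - _).
    by rewrite /phi /g expRK.
  rewrite mulrC; congr (_ * _); apply: fexp_ext => w.
  by rewrite upd_upd /phi /g expRK.
by rewrite lerD2l lerN2 ler_pM2l //; apply: fexp_ln_le.
Qed.

(* Telescope the logarithms of the averages over the first [k] coordinates,
   apply [ent_dual] in coordinate [k], then symmetrize with [fexp_swap]. *)
Lemma ent_expR_le (L : {ffun 'I_n -> V} -> R) :
  ent P (fun v => expR (L v)) <=
  fexp P (fun v => expR (L v) * \sum_i
     fexp p (fun w => Num.max 0 (L v - L (upd v i w)) ^+ 2)).
Proof.
have HP : is_pmf P by exact: prod_pmfP.
set g := fun v => expR (L v).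
pose gk (j : nat) v := fexp P (fun w => g (mix j w v)).
have step1 : ent P g <=
    \sum_(k < n) fexp P (fun v => fexp p (fun w => g v * (L v - L (upd v k w)))).
  apply: (@le_trans _ _ (\sum_(k < n)
      fexp P (fun v => g v * (ln (gk k v) - ln (gk k.+1 v))))); last first.
    by apply: ler_sum => k _; apply: ent_step.
  rewrite -fexp_sum /ent [X in _ - X]mulrC -fexpZ -fexpB.
  apply: fexp_le => // v.
  rewrite -mulr_sumr -(big_mkord xpredT
    (fun k => ln (gk k v) - ln (gk k.+1 v))) /=.
  rewrite (eq_bigr (fun k => - (ln (gk k.+1 v) - ln (gk k v)))); last first.
    by move=> k _; rewrite opprB.
  rewrite sumrN telescope_sumr // opprB mulrBr [X in _ <= _ - X]mulrC.
  have -> : gk 0 v = g v.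
    rewrite /gk -[RHS](fexp_cst HP); apply: fexp_ext => w; congr g.
    by apply/ffunP => i; rewrite ffunE.
  have -> // : gk n v = fexp P g.
  apply: fexp_ext => w; congr g.
  by apply/ffunP => i; rewrite ffunE ltn_ord.
apply: le_trans step1 _.
rewrite [leRHS](@fexp_ext _ _ _ (fun v => \sum_i fexp p (fun w =>
   g v * Num.max 0 (L v - L (upd v i w)) ^+ 2))); last first.
  by move=> v; rewrite mulr_sumr; apply: eq_bigr => i _; rewrite fexpZ.
rewrite fexp_sum; apply: ler_sum => i _.
(* With [x = a - b >= 0] the left side is e^a (1 - e^-x) x, at most e^a x^2. *)
have key (a b : R) : expR a * (a - b) + expR b * (b - a) <=
    expR a * Num.max 0 (a - b) ^+ 2 + expR b * Num.max 0 (b - a) ^+ 2.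
  wlog ab : a b / b <= a.
    move=> H; case: (leP b a) => [|/ltW] /H //.
    by rewrite addrC [leRHS]addrC.
  rewrite (max_r (_ : 0 <= a - b)) ?subr_ge0 //.
  rewrite (max_l (_ : b - a <= 0)) ?subr_le0 // expr0n /= mulr0 addr0.
  have -> : expR b = expR a * expR (b - a) by rewrite -expRD addrC subrK.
  have := expR_ge1Dx (b - a); have := expR_gt0 a.
  have ab' : 0 <= a - b by rewrite subr_ge0.
  set ea := expR a; set eb := expR (b - a) => ea0 Heb.
  rewrite -mulrA -mulrDr; apply: ler_wpM2l; first exact: ltW.
  have : (1 + (b - a)) * (b - a) >= eb * (b - a).
    by apply: ler_wnM2r => //; rewrite subr_le0.
  by nra.
(* Both sides are doubled so that [fexp_swap] can be applied to one of the two copies; [key] then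
   holds pointwise. *)
rewrite -(ler_pMn2r (isT : (0 < 2)%N)) !mulr2n.
rewrite {2}(fexp_swap i) [X in _ <= _ + X](fexp_swap i) -!fexpD.
apply: fexp_le => // v; rewrite -!fexpD.
apply: fexp_le => // w; rewrite upd_upd upd_id.
exact: key.
Qed.

End Tensorization.
End FiniteExpectation.

(** * Herbst's argument along halvings of the exponent *)

Section Herbst.
Variable R : realType.

Lemma expR_le_quad (x : R) : `|x| <= 2^-1 -> expR x <= 1 + x + 2 * x ^+ 2.
Proof.
rewrite ler_norml => /andP[x1 x2].
have x3 : 0 < 1 - x by lra.
have H : expR x <= (1 - x)^-1.
  rewrite -[x]opprK expRN opprK lef_pV2 ?posrE ?expR_gt0 //.
  exact: expR_ge1Dx.
apply: le_trans H _; rewrite -[leLHS]mul1r ler_pdivrMr //.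
have : 0 <= x ^+ 2 * (1 - 2 * x) by rewrite mulr_ge0 ?sqr_ge0 //; lra.
nra.
Qed.

Lemma le_of_pow2 (x y c : R) (k0 : nat) :
  (forall k, (k0 <= k)%N -> x <= y + c / 2 ^+ k) -> x <= y.
Proof.
move=> H; apply/ler_addgt0Pr => e e0.
pose k := maxn k0 (Num.truncn (c / e)).+1.
apply: le_trans (H k (leq_maxl _ _)) _; rewrite lerD2l.
have k2 : 0 < 2 ^+ k :> R by rewrite exprn_gt0.
rewrite ler_pdivrMr // mulrC -ler_pdivrMr //.
apply: (@le_trans _ _ k%:R).
  apply: ltW; apply: (lt_le_trans (truncnS_gt _)).
  by rewrite ler_nat leq_maxr.
by rewrite -natrX ler_nat ltnW // ltn_expl.
Qed.

Variables (U : finType) (P : U -> R).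
Hypothesis HP : is_pmf P.
Variable Z : U -> R.

Definition mgf (s : R) := fexp P (fun v => expR (s * Z v)).
Definition lmgf (s : R) := ln (mgf s).

Lemma mgf_gt0 s : 0 < mgf s.
Proof. by apply: fexp_gt0 => // v; apply: expR_gt0. Qed.

Lemma ent_mgf s : ent P (fun v => expR (s * Z v)) =
  s * fexp P (fun v => expR (s * Z v) * Z v) - mgf s * lmgf s.
Proof.
rewrite /ent -/(mgf s) -/(lmgf s); congr (_ - _).
by rewrite -fexpZ; apply: fexp_ext => v; rewrite expRK mulrCA.
Qed.

(* By convexity of [lmgf]; iterating along [b / 2 ^+ k] replaces the
   differential inequality in Herbst's argument. *)
Lemma lmgf_half (b : R) :
  lmgf b <= 2 * lmgf (b / 2) + ent P (fun v => expR (b * Z v)) / mgf b.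
Proof.
have Mb := mgf_gt0 b; have Mh := mgf_gt0 (b / 2).
set m := fexp P (fun v => expR (b * Z v) * Z v) / mgf b.
have -> : ent P (fun v => expR (b * Z v)) / mgf b = b * m - lmgf b.
  by rewrite ent_mgf /m; field; rewrite gt_eqF.
suff : lmgf b - b * m / 2 <= lmgf (b / 2) by lra.
rewrite -[leLHS]expRK /lmgf ler_ln ?posrE ?expR_gt0 //.
rewrite expRD lnK ?posrE //.
have -> : mgf b * expR (- (b * m / 2)) = fexp P (fun v =>
    expR (- (b * m / 2)) * (1 + b * m / 2) * expR (b * Z v) -
    (expR (- (b * m / 2)) * (b / 2)) * (expR (b * Z v) * Z v)).
  rewrite fexpB !fexpZ -/(mgf b).
  have -> : fexp P (fun v => expR (b * Z v) * Z v) = m * mgf b.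
    by rewrite /m mulfVK // gt_eqF.
  by field.
apply: fexp_le => // v.
have -> : expR (b / 2 * Z v) = expR (- (b * m / 2)) * expR (b * Z v) *
    expR (- (b / 2 * Z v) + b * m / 2).
  by rewrite -!expRD; congr expR; field.
have -> : expR (- (b * m / 2)) * (1 + b * m / 2) * expR (b * Z v) -
    (expR (- (b * m / 2)) * (b / 2)) * (expR (b * Z v) * Z v) =
  expR (- (b * m / 2)) * expR (b * Z v) * (1 + (- (b / 2 * Z v) + b * m / 2)).
  by ring.
by apply: ler_wpM2l; rewrite ?mulr_ge0 ?expR_ge0 // expR_ge1Dx.
Qed.

Lemma lmgf_small (B a : R) : (forall v, `|Z v| <= B) -> 0 <= a -> a * B <= 2^-1 ->
  lmgf a <= a * fexp P Z + 2 * a ^+ 2 * B ^+ 2.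
Proof.
move=> ZB a0 aB.
have M0 := mgf_gt0 a.
apply: (@le_trans _ _ (mgf a - 1)).
  rewrite /lmgf -{1}(subrK 1 (mgf a)) addrC; apply: le_ln1Dx.
  by rewrite ltrBrDr addNr.
rewrite lerBlDr /mgf.
apply: (@le_trans _ _ (fexp P (fun v => a * Z v + (2 * a ^+ 2 * B ^+ 2 + 1)))).
  apply: fexp_le => // v.
  have HB : `|a * Z v| <= a * B by rewrite normrM ger0_norm // ler_wpM2l.
  apply: (le_trans (expR_le_quad (le_trans HB aB))).
  have : (a * Z v) ^+ 2 <= (a * B) ^+ 2.
    by rewrite -[X in X <= _]real_normK ?num_real // ler_sqr ?nnegrE // (le_trans _ HB).
  by rewrite exprMn [(a * B) ^+ 2]exprMn; lra.
by rewrite fexpD fexpZ fexp_cst //; lra.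
Qed.

Let Zbound : exists2 B : R, 0 <= B & forall v, `|Z v| <= B.
Proof.
exists (\sum_v `|Z v|) => [|v]; first exact: sumr_ge0.
by rewrite (bigD1 v) //= lerDl sumr_ge0.
Qed.

(** [lmgf] vanishes at 0 with slope [fexp P Z]; by [lmgf_small], [2 ^+ k * lmgf (b / 2 ^+ k)]
    exceeds [b * fexp P Z] by at most a constant over [2 ^+ k], once [k] is so large that
    [b / 2 ^+ k] times the bound on [Z] is at most 1/2. *)
Lemma lmgf_lim (b x : R) : 0 <= b -> (forall k, x <= 2 ^+ k * lmgf (b / 2 ^+ k)) ->
  x <= b * fexp P Z.
Proof.
move=> b0 Hx; have [B B0 ZB] := Zbound.
apply: (@le_of_pow2 _ _ (2 * b ^+ 2 * B ^+ 2) (Num.truncn (2 * b * B)).+1).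
move=> k Hk.
have k2 : 0 < 2 ^+ k :> R by rewrite exprn_gt0.
apply: le_trans (Hx k) _.
apply: le_trans (ler_wpM2l (ltW k2) (@lmgf_small B _ ZB _ _)) _.
- by rewrite divr_ge0 // ltW.
- rewrite mulrAC ler_pdivrMr // ler_pdivlMl // mulrA.
  apply: (@le_trans _ _ k%:R).
    by apply: ltW; apply: (lt_le_trans (truncnS_gt _)); rewrite ler_nat.
  by rewrite -natrX ler_nat ltnW // ltn_expl.
- rewrite le_eqVlt; apply/orP; left; apply/eqP; field.
  by rewrite gt_eqF.
Qed.

(** The k-th halving costs [s ^+ 2 * v / 2 ^+ k]; the geometric series sums to [2 * s ^+ 2 * v]. *)
Lemma herbst (s0 v : R) : (forall s : R, 0 < s -> s <= s0 ->
    ent P (fun x => expR (s * Z x)) <= s ^+ 2 * v * mgf s) ->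
  0 <= v ->
  forall s : R, 0 < s -> s <= s0 -> lmgf s <= s * fexp P Z + 2 * s ^+ 2 * v.
Proof.
move=> Hent v0 s s1 s2.
have step (b : R) : 0 < b -> b <= s0 -> lmgf b <= 2 * lmgf (b / 2) + b ^+ 2 * v.
  move=> b0 bs; apply: le_trans (lmgf_half b) _; rewrite lerD2l.
  by rewrite ler_pdivrMr ?mgf_gt0 // Hent.
have iter k : lmgf s <=
    2 ^+ k * lmgf (s / 2 ^+ k) + 2 * s ^+ 2 * v * (1 - (2 ^+ k)^-1).
  elim: k => [|k IH].
    by rewrite expr0 invr1 subrr mulr0 addr0 mul1r mulr1.
  have k2 : 0 < 2 ^+ k :> R by rewrite exprn_gt0.
  have k1 : 1 <= 2 ^+ k :> R by rewrite exprn_ege1 // ler1n.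
  apply: le_trans IH _.
  have sk0 : 0 < s / 2 ^+ k by rewrite divr_gt0.
  have sk1 : s / 2 ^+ k <= s0.
    by apply: le_trans s2; rewrite ler_pdivrMr // ler_peMr // ltW.
  have H := step _ sk0 sk1.
  have H2 := ler_wpM2l (ltW k2) H.
  rewrite (exprS _ k).
  have e1 : s / 2 ^+ k / 2 = s / (2 * 2 ^+ k).
    by rewrite -mulrA -invfM [_ ^+ _ * _]mulrC.
  rewrite e1 in H2.
  set X := lmgf (s / (2 * _)) in H2 *.
  set Y := lmgf (s / 2 ^+ k) in H2 *.
  have e2 : 2 ^+ k * (2 * X + (s / 2 ^+ k) ^+ 2 * v) =
     2 * 2 ^+ k * X + s ^+ 2 * v * (2 ^+ k)^-1.
    by field; rewrite gt_eqF.
  rewrite e2 in H2.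
  have -> : (2 * 2 ^+ k)^-1 = 2^-1 * (2 ^+ k)^-1 :> R by rewrite invfM.
  lra.
suff : lmgf s - 2 * s ^+ 2 * v <= s * fexp P Z by lra.
apply: lmgf_lim => [|k]; first exact: ltW.
apply: le_trans (_ : _ <= 2 ^+ k * lmgf (s / 2 ^+ k) +
  2 * s ^+ 2 * v * (1 - (2 ^+ k)^-1) - 2 * s ^+ 2 * v) _.
  by rewrite lerD2r.
have : 0 <= 2 * s ^+ 2 * v * (2 ^+ k)^-1.
  by rewrite mulr_ge0 ?invr_ge0 ?exprn_ge0 // mulr_ge0 // mulr_ge0 ?sqr_ge0.
lra.
Qed.

(** Here [Z] is its own variance proxy. A halving at [b] now loses the factor [1 - 2 * b], and along
    [b = 8^-1 / 2 ^+ k] the product of these factors stays above 1/2. *)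
Lemma lmgf_self_bounding :
  (forall x, 0 <= Z x) ->
  (forall s : R, 0 < s -> ent P (fun x => expR (s * Z x)) <=
     s ^+ 2 * fexp P (fun x => expR (s * Z x) * Z x)) ->
  lmgf (8^-1) <= fexp P Z / 4.
Proof.
move=> Z0 Hent.
have H0 (s : R) : 0 < s -> 0 <= lmgf s.
  move=> s0; apply: ln_ge0; apply: fexp_ge_cst => // x.
  by rewrite -expR0 ler_expR mulr_ge0 // ltW.
have step (b : R) : 0 < b -> b <= 8^-1 -> (1 - 2 * b) * lmgf b <= 2 * lmgf (b / 2).
  move=> b0 b8.
  have h1 := lmgf_half b; have h2 := Hent _ b0.
  rewrite ent_mgf in h2; have M0 := mgf_gt0 b; have L0 := H0 _ b0.
  set E := fexp P _ in h2.
  (* The entropy is [b * E - mgf b * lmgf b]; since it is at most [b ^+ 2 * E], the unknown [E] is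
     itself bounded through [mgf b * lmgf b]. *)
  have h3 : (1 - b) * (b * E) <= mgf b * lmgf b by nra.
  have ML : 0 <= mgf b * lmgf b by rewrite mulr_ge0 // ltW.
  have h4 : b * E <= 2 * (mgf b * lmgf b) by nra.
  have h5 : ent P (fun v => expR (b * Z v)) / mgf b <= 2 * b * lmgf b.
    rewrite ler_pdivrMr //; apply: le_trans (Hent _ b0) _; rewrite -/E.
    have := ler_wpM2l (ltW b0) h4; lra.
  lra.
have iter k : lmgf (8^-1) * (2^-1 + 2^-1 * (2 ^+ k)^-1) <=
    2 ^+ k * lmgf (8^-1 / 2 ^+ k).
  elim: k => [|k IH].
    rewrite expr0 invr1 !mulr1 mul1r; lra.
  have k2 : 0 < 2 ^+ k :> R by rewrite exprn_gt0.
  have k1 : 1 <= 2 ^+ k :> R by rewrite exprn_ege1 // ler1n.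
  have y0 : 0 < (2 ^+ k)^-1 :> R by rewrite invr_gt0.
  have y1 : (2 ^+ k)^-1 <= 1 :> R by rewrite invf_le1.
  have sk0 : 0 < 8^-1 / 2 ^+ k :> R by rewrite divr_gt0 ?invr_gt0.
  have sk1 : 8^-1 / 2 ^+ k <= 8^-1 :> R.
    by rewrite ler_pdivrMr // ler_peMr // invr_ge0.
  have H := step _ sk0 sk1.
  have -> : 2 ^+ k.+1 * lmgf (8^-1 / 2 ^+ k.+1) =
      2 ^+ k * (2 * lmgf (8^-1 / 2 ^+ k / 2)).
    by rewrite !exprSr invfM !mulrA.
  have H2 := ler_wpM2l (ltW k2) H.
  apply: le_trans H2.
  rewrite (exprS _ k) invfM; set y := (2 ^+ k)^-1 in y0 y1 IH *.
  set X := lmgf _ in IH *; set Y := lmgf _ in IH *.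
  have HX : 0 <= X by apply: H0; rewrite invr_gt0.
  have -> : 2 ^+ k * ((1 - 2 * (8^-1 * y)) * Y) =
     (1 - 2 * (8^-1 * y)) * (2 ^+ k * Y) by ring.
  have c0 : 0 <= 1 - 2 * (8^-1 * y) by lra.
  apply: le_trans (ler_wpM2l c0 IH).
  have -> : (1 - 2 * (8^-1 * y)) * (X * (2^-1 + 2^-1 * y)) =
    X * ((1 - 2 * (8^-1 * y)) * (2^-1 + 2^-1 * y)) by ring.
  apply: ler_wpM2l => //; nra.
suff : lmgf (8^-1) / 2 <= 8^-1 * fexp P Z by lra.
apply: lmgf_lim => [|k]; first by rewrite invr_ge0.
apply: le_trans (iter k).
have L0 : 0 <= lmgf (8^-1) by apply: H0; rewrite invr_gt0.
have : 0 <= lmgf (8^-1) * (2^-1 * (2 ^+ k)^-1).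
  by rewrite mulr_ge0 // mulr_ge0 ?invr_ge0 ?exprn_ge0.
lra.
Qed.

End Herbst.

(** * Rademacher averages and Talagrand's inequality *)

Section FiniteMax.
Variables (R : realType) (T : finType) (t0 : T).
Implicit Types F G : T -> R.

Definition fmax F : R := F [arg max_(t > t0) F t]%O.

Lemma fmax_ge F t : F t <= fmax F.
Proof. by rewrite /fmax; case: arg_maxP => // i _; apply. Qed.

Lemma fmax_le F a : (forall t, F t <= a) -> fmax F <= a.
Proof. by move=> Fa; apply: Fa. Qed.

Lemma fmax_attained F : exists t, fmax F = F t.
Proof. by eexists. Qed.

Lemma fmax_mono F G : (forall t, F t <= G t) -> fmax F <= fmax G.
Proof. by move=> FG; apply: fmax_le => t; apply: le_trans (fmax_ge G t). Qed.

Lemma fmax_ext F G : F =1 G -> fmax F = fmax G.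
Proof.
by move=> FG; apply/eqP; rewrite eq_le; apply/andP; split;
  apply: fmax_mono => t; rewrite FG.
Qed.

Lemma fmaxD F G : fmax (fun t => F t + G t) <= fmax F + fmax G.
Proof. by apply: fmax_le => t; apply: lerD; apply: fmax_ge. Qed.

Lemma fmaxZ F c : 0 <= c -> fmax (fun t => c * F t) <= c * fmax F.
Proof. by move=> c0; apply: fmax_le => t; apply: ler_wpM2l => //; apply: fmax_ge. Qed.

Lemma fmax_fexp (V : finType) (p : V -> R) (F : T -> V -> R) : is_pmf p ->
  fmax (fun t => fexp p (F t)) <= fexp p (fun v => fmax (F^~ v)).
Proof.
move=> Hp; apply: fmax_le => t; apply: fexp_le => // v.
exact: (fmax_ge (F^~ v)).
Qed.

(** Averaging over a single sign. With [t1], [t2] maximizers on the left, [a t1 - a t2] is at most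
    [b t1 - b t2] or its opposite; the sign decides which of [t1], [t2] is tried in which maximum on
    the right. *)
Lemma fmax_contr (A a b : T -> R) :
  (forall t t', `|a t - a t'| <= `|b t - b t'|) ->
  fmax (fun t => A t + a t) + fmax (fun t => A t - a t) <=
  fmax (fun t => A t + b t) + fmax (fun t => A t - b t).
Proof.
move=> ab.
have [t1 ->] := fmax_attained (fun t => A t + a t).
have [t2 ->] := fmax_attained (fun t => A t - a t).
have h0 : a t1 - a t2 <= `|b t1 - b t2| by apply: le_trans (ab _ _); apply: ler_norm.
have h1 := fmax_ge (fun t => A t + b t) t1.
have h2 := fmax_ge (fun t => A t + b t) t2.
have h3 := fmax_ge (fun t => A t - b t) t1.
have h4 := fmax_ge (fun t => A t - b t) t2.
move: h0; have [h|h] := ger0P (b t1 - b t2); lra.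
Qed.

End FiniteMax.

Section Rademacher.
Variables (R : realType) (T : finType) (t0 : T) (n : nat).

Definition sgn (b : bool) : R := if b then 1 else -1.

Definition coin (b : bool) : R := 2^-1.

Lemma coinP : is_pmf coin.
Proof. by split=> [b|]; rewrite ?invr_ge0 // big_bool /coin /=; lra. Qed.

Lemma fexp_coin (G : bool -> R) : fexp coin G = 2^-1 * (G true + G false).
Proof. by rewrite /fexp big_bool /coin mulrDr. Qed.

Definition signs := @prod_pmf R bool coin n.

Lemma signsP : is_pmf signs.
Proof. exact/prod_pmfP/coinP. Qed.

Lemma signs_const e : signs e = 2^-1 ^+ n.
Proof. by rewrite /signs /prod_pmf prodr_const card_ord. Qed.

Lemma fexp_signs_flip (G : {ffun 'I_n -> bool} -> R) :
  fexp signs G = fexp signs (fun e => G [ffun i => ~~ e i]).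
Proof.
pose f (e : {ffun 'I_n -> bool}) : {ffun 'I_n -> bool} := [ffun i => ~~ e i].
have fK : involutive f by move=> e; apply/ffunP => i; rewrite !ffunE negbK.
rewrite /fexp (reindex f) /=; last exact/onW_bij/inv_bij.
by apply: eq_bigr => e _; rewrite !signs_const.
Qed.

(** The Ledoux-Talagrand comparison, replacing [a] by [b] one coordinate at a time. As the maximum
    carries no absolute value, no factor 2 is lost. *)
Lemma contraction (a b : T -> 'I_n -> R) :
  (forall i t t', `|a t i - a t' i| <= `|b t i - b t' i|) ->
  fexp signs (fun e => fmax t0 (fun t => \sum_i sgn (e i) * a t i)) <=
  fexp signs (fun e => fmax t0 (fun t => \sum_i sgn (e i) * b t i)).
Proof.
move=> ab.
pose c (k : nat) t (i : 'I_n) := if (i < k)%N then b t i else a t i.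
pose S k := fexp signs (fun e => fmax t0 (fun t => \sum_i sgn (e i) * c k t i)).
have step (k : 'I_n) : S k <= S k.+1.
  rewrite /S (fexp_resample coinP k) [leRHS](fexp_resample coinP k).
  apply: fexp_le => [|e]; first exact: signsP.
  pose A t := \sum_(i | i != k) sgn (e i) * c k t i.
  have E1 s : fmax t0 (fun t => \sum_i sgn (upd e k s i) * c k t i) =
      fmax t0 (fun t => A t + sgn s * a t k).
    apply: fmax_ext => t; rewrite (bigD1 k) //= upd_same {1}/c ltnn addrC.
    by congr (_ + _); apply: eq_bigr => i /negPf ik; rewrite ffunE ik.
  have E2 s : fmax t0 (fun t => \sum_i sgn (upd e k s i) * c k.+1 t i) =
      fmax t0 (fun t => A t + sgn s * b t k).
    apply: fmax_ext => t; rewrite (bigD1 k) //= upd_same {1}/c ltnSn addrC.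
    congr (_ + _); apply: eq_bigr => i ik; rewrite ffunE (negPf ik) /c ltnS.
    by rewrite [in RHS]ltn_neqAle ik.
  rewrite !fexp_coin !E1 !E2 /=; apply: ler_wpM2l; first by rewrite invr_ge0.
  have e1 (f : T -> R) : fmax t0 (fun t => A t + 1 * f t) = fmax t0 (fun t => A t + f t).
    by apply: fmax_ext => t; rewrite mul1r.
  have e2 (f : T -> R) : fmax t0 (fun t => A t + -1 * f t) = fmax t0 (fun t => A t - f t).
    by apply: fmax_ext => t; rewrite mulN1r.
  by rewrite !e1 !e2; apply: fmax_contr => t t'; apply: ab.
have mono (k : nat) : (k <= n)%N -> S 0%N <= S k.
  elim: k => // k IH kn; apply: le_trans (IH (ltnW kn)) _.
  exact: (step (Ordinal kn)).
have := mono n (leqnn n).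
rewrite /S; congr (_ <= _); apply: fexp_ext => e; apply: fmax_ext => t //.
by apply: eq_bigr => i _; rewrite /c ltn_ord.
Qed.

Variables (V : finType) (p : V -> R).
Hypothesis Hp : is_pmf p.
Local Notation P := (@prod_pmf R V p n).

Definition rad (F : T -> V -> R) : R :=
  fexp signs (fun e => fexp P (fun v =>
    fmax t0 (fun t => \sum_i sgn (e i) * F t (v i)))).

Lemma rad_contraction (F G : T -> V -> R) :
  (forall x t t', `|G t x - G t' x| <= `|F t x - F t' x|) -> rad G <= rad F.
Proof.
move=> GF; rewrite /rad fexp_exchange [leRHS]fexp_exchange.
apply: fexp_le => [|v]; first exact: prod_pmfP.
by apply: (@contraction (fun t i => G t (v i)) (fun t i => F t (v i))) => i t t'.
Qed.

Lemma radZ (F : T -> V -> R) c : 0 <= c ->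
  rad (fun t x => c * F t x) <= c * rad F.
Proof.
move=> c0; rewrite /rad -fexpZ; apply: fexp_le => [|e]; first exact: signsP.
rewrite -fexpZ; apply: fexp_le => [|v]; first exact: prod_pmfP.
apply: le_trans (fmaxZ _ _ c0); apply: fmax_mono => t.
by rewrite mulr_sumr; apply: ler_sum => i _; rewrite mulrCA.
Qed.

Lemma fexp_coord i (G : V -> R) : fexp P (fun v => G (v i)) = fexp p G.
Proof.
rewrite (fexp_resample Hp i) -[RHS](fexp_cst (prod_pmfP n Hp)).
by apply: fexp_ext => v; apply: fexp_ext => w; rewrite upd_same.
Qed.

Lemma fexp_swap_signs (e : {ffun 'I_n -> bool})
    (G : {ffun 'I_n -> V} -> {ffun 'I_n -> V} -> R) :
  fexp P (fun v => fexp P (G v)) =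
  fexp P (fun v => fexp P (fun v' =>
    G [ffun i => if e i then v i else v' i]
      [ffun i => if e i then v' i else v i])).
Proof.
pose f (x : {ffun 'I_n -> V} * {ffun 'I_n -> V}) :
    {ffun 'I_n -> V} * {ffun 'I_n -> V} :=
  ([ffun i => if e i then x.1 i else x.2 i],
   [ffun i => if e i then x.2 i else x.1 i]).
have fK : involutive f.
  by move=> [v w]; congr pair; apply/ffunP => i; rewrite !ffunE /=; case: (e i).
rewrite /fexp.
under eq_bigr => v _ do rewrite mulr_sumr.
under [RHS]eq_bigr => v _ do rewrite mulr_sumr.
rewrite (pair_big xpredT xpredT (fun v w => P v * (P w * G v w))) /=.
rewrite (pair_big xpredT xpredT (fun v w => P v * (P w *
    G [ffun i => if e i then v i else w i]
      [ffun i => if e i then w i else v i]))) /=.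
rewrite (reindex f) /=; last exact/onW_bij/inv_bij.
apply: eq_bigr => -[v w] _ /=; rewrite !mulrA; congr (_ * _).
rewrite /prod_pmf -!big_split /=; apply: eq_bigr => i _.
by rewrite !ffunE; case: (e i) => //; rewrite mulrC.
Qed.

(** The mean is written as an average over a ghost sample, and the two samples are exchanged at the
    coordinates chosen by a sign vector. Splitting the maximum leaves one term with the signs and
    one with the flipped signs, which have the same average. *)
Lemma symmetrization (F : T -> V -> R) :
  fexp P (fun v => fmax t0 (fun t => \sum_i (fexp p (F t) - F t (v i)))) <=
  2 * rad F.
Proof.
have HP := prod_pmfP n Hp.
pose D v v' t := \sum_(i < n) (F t (v' i) - F t (v i)).
have le1 : fexp P (fun v => fmax t0 (fun t => \sum_i (fexp p (F t) - F t (v i))))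
    <= fexp P (fun v => fexp P (fun v' => fmax t0 (D v v'))).
  apply: fexp_le => // v; apply: le_trans (fmax_fexp _ _ HP).
  apply: fmax_mono => t; rewrite /D fexp_sum; apply: ler_sum => i _.
  by rewrite fexpB fexp_coord fexp_cst.
apply: le_trans le1 _.
rewrite -[leLHS](fexp_cst signsP).
pose A (e : {ffun 'I_n -> bool}) := fexp P (fun v => fmax t0 (fun t => \sum_i sgn (e i) * F t (v i))).
have radN : fexp signs (fun e => A [ffun i => ~~ e i]) = rad F.
  by rewrite -fexp_signs_flip.
have -> : 2 * rad F = fexp signs (fun e => A e + A [ffun i => ~~ e i]).
  by rewrite fexpD radN /rad /A; ring.
apply: fexp_le => [|e]; first exact: signsP.
rewrite (fexp_swap_signs e).
apply: (@le_trans _ _ (fexp P (fun v => fexp P (fun v' =>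
   fmax t0 (fun t => \sum_i sgn (e i) * F t (v' i)) +
   fmax t0 (fun t => \sum_i sgn ([ffun i => ~~ e i] i) * F t (v i)))))).
  apply: fexp_le => // v; apply: fexp_le => // v'.
  apply: le_trans (fmaxD _ _ _); apply: fmax_mono => t.
  rewrite /D -big_split /=; apply: ler_sum => i _. rewrite !ffunE.
  by case: (e i) => /=; lra.
rewrite le_eqVlt; apply/orP; left; apply/eqP.
rewrite -[A e](fexp_cst HP) -fexpD; apply: fexp_ext => v.
by rewrite fexpD fexp_cst.
Qed.

(** Through [symmetrization]: the maximum is at least its value at [t0], which is centred. *)
Lemma rad_ge0 (F : T -> V -> R) : 0 <= rad F.
Proof.
suff : 0 <= 2 * rad F by lra.
apply: le_trans (symmetrization F).
apply: (@le_trans _ _ (fexp P (fun v => \sum_i (fexp p (F t0) - F t0 (v i))))).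
  rewrite fexp_sum big1 // => i _.
  by rewrite fexpB fexp_cst ?fexp_coord ?subrr //; apply: prod_pmfP.
apply: fexp_le => [|v]; first exact: prod_pmfP.
exact: (fmax_ge t0 (fun t => \sum_i (fexp p (F t) - F t (v i)))).
Qed.

End Rademacher.

(** * Upper tail of the supremum of an empirical process *)

Section Concentration.
Variables (R : realType) (T : finType) (t0 : T) (n : nat).
Variables (V : finType) (p : V -> R).
Hypothesis Hp : is_pmf p.
Local Notation P := (@prod_pmf R V p n).
Let HP : is_pmf P := prod_pmfP n Hp.

(** The maximizer at [v] remains a competitor after coordinate [i] is changed, so one [t] serves for
    all [i] and [w]. *)
Lemma fmax_upd (F : T -> V -> R) (v : {ffun 'I_n -> V}) :
  let Z v := fmax t0 (fun t => \sum_(i < n) F t ((v : {ffun 'I_n -> V}) i)) in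
  exists t, Z v = \sum_(i < n) F t (v i) /\
    forall i w, Z v - Z (upd v i w) <= F t (v i) - F t w.
Proof.
move=> Z; have [t Ht] := fmax_attained t0 (fun t => \sum_i F t (v i)).
exists t; split=> // i w.
rewrite lerBlDr -lerBlDl.
apply: le_trans (fmax_ge t0 _ t).
rewrite /Z Ht (bigD1 i) //= [leRHS](bigD1 i) //= upd_same.
have -> : \sum_(j | j != i) F t (upd v i w j) = \sum_(j | j != i) F t (v j).
  by apply: eq_bigr => j /negPf ji; rewrite ffunE ji.
lra.
Qed.

Variables (g F : T -> V -> R) (sig2 : R).
Hypothesis g1 : forall t x, `|g t x| <= 1.
Hypothesis gF : forall x t t', `|g t x - g t' x| <= `|F t x - F t' x|.
Hypothesis gsig : forall t, fexp p (fun x => g t x ^+ 2) <= sig2.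

Let W (v : {ffun 'I_n -> V}) := fmax t0 (fun t => \sum_i g t (v i) ^+ 2).
Let Z (v : {ffun 'I_n -> V}) :=
  fmax t0 (fun t => \sum_i (fexp p (g t) - g t (v i))).

Let W_ge0 v : 0 <= W v.
Proof.
apply: le_trans (fmax_ge t0 _ t0).
by apply: sumr_ge0 => i _; apply: sqr_ge0.
Qed.

Let gsqr1 t x : g t x ^+ 2 <= 1.
Proof.
rewrite -real_normK ?num_real // -[leRHS](expr1n _ 2) ler_sqr ?nnegrE //.
Qed.

(** Since the summands lie in [0, 1], the squared increments of [W] sum to at most the maximizing
    sum, which is [W] itself. *)
Lemma lmgf_W : lmgf P W (8^-1) <= fexp P W / 4.
Proof.
apply: lmgf_self_bounding => // s s0.
apply: le_trans (ent_expR_le Hp _) _; rewrite -fexpZ.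
apply: fexp_le => // v; rewrite [leRHS]mulrCA.
apply: ler_wpM2l; first exact: expR_ge0.
have [t [Wt Wi]] := fmax_upd (fun t x => g t x ^+ 2) v.
have -> : s ^+ 2 * W v = \sum_i s ^+ 2 * g t (v i) ^+ 2.
  by rewrite -mulr_sumr -Wt.
apply: ler_sum => i _; apply: fexp_le_cst => // w.
have h : W v - W (upd v i w) <= g t (v i) ^+ 2 - g t w ^+ 2 := Wi i w.
have := sqr_ge0 (g t w); have := sqr_ge0 (g t (v i)); have := gsqr1 t (v i).
set x := g t (v i) ^+ 2 in h *; set y := g t w ^+ 2 in h *.
move=> x1 x0 y0; rewrite -mulrBr.
apply: (@le_trans _ _ ((s * x) ^+ 2)).
  have sx0 : 0 <= s * x := mulr_ge0 (ltW s0) x0.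
  rewrite ler_sqr ?nnegrE ?le_max ?lexx //.
  by rewrite ge_max sx0 /=; apply: ler_wpM2l; [exact: ltW|lra].
rewrite exprMn ler_wpM2l ?sqr_ge0 // expr2 ler_piMl //.
Qed.

(** The increments of [Z] leave the mean of [expR (s * Z) * W]. The random [W] is decoupled by
    [ent_dual] with [H = W / 8] and [lmgf_W], at the price of the entropy itself with coefficient
    [16 * s ^+ 2]; this is below 1/2 for [s <= 6^-1] and is absorbed on the left. *)
Lemma ent_Z (s : R) : 0 < s -> s <= 6^-1 ->
  ent P (fun v => expR (s * Z v)) <=
  s ^+ 2 * (4 * n%:R * sig2 + 8 * fexp P W) * mgf P Z s.
Proof.
move=> s0 s6.
have step : ent P (fun v => expR (s * Z v)) <=
  s ^+ 2 * (2 * n%:R * sig2 * mgf P Z s +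
            2 * fexp P (fun v => expR (s * Z v) * W v)).
  apply: le_trans (ent_expR_le Hp _) _.
  rewrite mulrDr /mgf !mulrA -!fexpZ -fexpD.
  apply: fexp_le => // v.
  have [t [_ Zi]] := fmax_upd (fun t x => fexp p (g t) - g t x) v.
  apply: (@le_trans _ _ (expR (s * Z v) *
     (s ^+ 2 * (2 * n%:R * sig2 + 2 * W v)))); last by lra.
  apply: ler_wpM2l; first exact: expR_ge0.
  apply: (@le_trans _ _ (\sum_i (s ^+ 2 * (2 * sig2 + 2 * g t (v i) ^+ 2)))).
    apply: ler_sum => i _.
    apply: (@le_trans _ _ (fexp p (fun w =>
       s ^+ 2 * 2 * g t w ^+ 2 + s ^+ 2 * 2 * g t (v i) ^+ 2))).
      apply: fexp_le => // w.
      have h : Z v - Z (upd v i w) <= g t w - g t (v i).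
        by apply: le_trans (Zi i w) _; lra.
      rewrite -mulrBr.
      apply: (@le_trans _ _ ((s * (g t w - g t (v i))) ^+ 2)).
        rewrite -[leRHS]real_normK ?num_real // ler_sqr ?nnegrE //;
          last by rewrite le_max lexx.
        rewrite ge_max normr_ge0 /=.
        apply: le_trans (ler_norm _); rewrite ler_wpM2l ?(ltW s0) //; lra.
      have q : (g t w - g t (v i)) ^+ 2 <= 2 * g t w ^+ 2 + 2 * g t (v i) ^+ 2.
        by have := sqr_ge0 (g t w + g t (v i)); nra.
      have := ler_wpM2l (sqr_ge0 s) q; rewrite exprMn; lra.
    rewrite fexpD fexpZ fexp_cst //.
    have := ler_wpM2l (sqr_ge0 s) (gsig t); lra.
  rewrite -mulr_sumr ler_wpM2l ?sqr_ge0 // big_split /= sumr_const card_ord.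
  rewrite -mulr_sumr; apply: lerD.
    by rewrite -(mulr_natr (2 * sig2)) mulrAC lexx.
  by apply: ler_wpM2l => //; apply: (fmax_ge t0 (fun t => \sum_i g t (v i) ^+ 2)).
have dual := ent_dual HP (fun v => 8^-1 * W v)
  (fun v => expR_gt0 (s * Z v)).
rewrite -/(mgf P Z s) -/(mgf P W _) -/(lmgf P W _) in dual.
have hW := lmgf_W; have M0 : 0 < mgf P Z s by exact: mgf_gt0.
have eq8 : fexp P (fun v => expR (s * Z v) * (8^-1 * W v)) =
    8^-1 * fexp P (fun v => expR (s * Z v) * W v).
  by rewrite -fexpZ; apply: fexp_ext => v; rewrite mulrCA.
rewrite eq8 in dual.
set E := ent _ _ in step dual *; set X := fexp P (fun v => _ * _) in step dual.
set M := mgf _ _ _ in step dual M0 *; set l := lmgf _ _ _ in dual hW.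
set w := fexp P W in hW *.
have Ml : M * l <= M * (w / 4) by rewrite ler_wpM2l // ltW.
have s2 : s ^+ 2 <= 36^-1.
  have : s * s <= 6^-1 * 6^-1 by apply: ler_pM => //; apply: ltW.
  by rewrite expr2; lra.
have s2p : 0 <= s ^+ 2 by exact: sqr_ge0.
have HX : X <= 8 * E + 2 * (M * w) by lra.
have step2 : E <= s ^+ 2 * (2 * n%:R * sig2 * M + 16 * E + 4 * (M * w)).
  by apply: le_trans step _; apply: ler_wpM2l => //; lra.
have [E0|E0] := leP 0 E.
  have : s ^+ 2 * E <= 36^-1 * E by apply: ler_wpM2r.
  lra.
apply: le_trans (ltW E0) _.
apply: mulr_ge0; last exact: ltW.
have sig0 : 0 <= sig2.
  by apply: le_trans (gsig t0); apply: fexp_ge_cst => // x; apply: sqr_ge0.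
have w0 : 0 <= w by apply: fexp_ge_cst.
by rewrite mulr_ge0 // addr_ge0 // mulr_ge0 // mulr_ge0.
Qed.

(** Squaring is 2-Lipschitz on [-1, 1]: contraction gives one factor 2, symmetrization the other. *)
Lemma fexp_W_le : fexp P W <= n%:R * sig2 + 4 * rad t0 n p F.
Proof.
have h : rad t0 n p (fun t x => - g t x ^+ 2) <= 2 * rad t0 n p F.
  apply: le_trans (radZ t0 n Hp F (ler0n R 2)).
  apply: rad_contraction => // x t t'.
  rewrite -mulrBr normrM (ger0_norm (_ : 0 <= 2)) // -opprD normrN subr_sqr normrM.
  rewrite mulrC ler_pM //.
  by apply: le_trans (ler_normD _ _) _; have := g1 t x; have := g1 t' x; lra.
have := symmetrization t0 n Hp (fun t x => - g t x ^+ 2).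
set X := fexp P _ => hX.
have : fexp P W <= n%:R * sig2 + X.
  rewrite -[n%:R * sig2](fexp_cst HP) -fexpD; apply: fexp_le => // v.
  apply: fmax_le => t.
  apply: le_trans (lerD (lexx _) (fmax_ge t0 _ t)) => /=.
  rewrite [X in _ + X](eq_bigr
    (fun i => g t (v i) ^+ 2 - fexp p (fun x => g t x ^+ 2))); last first.
    by move=> i _; rewrite fexpN opprK addrC.
  rewrite sumrB sumr_const card_ord -[X in _ - X]mulr_natl.
  have := ler_wpM2l (ler0n R n) (gsig t); lra.
lra.
Qed.

(* A form of Talagrand's inequality, with [rad] in place of the mean of the
   supremum. *)
Lemma concentration (s u : R) : 0 < s -> s <= 6^-1 ->
  \sum_(v | 13 * rad t0 n p F + 24 * s * n%:R * sig2 + u / s < Z v) P v <=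
  expR (- u).
Proof.
move=> s0 s6.
have sig0 : 0 <= sig2.
  by apply: le_trans (gsig t0); apply: fexp_ge_cst => // x; apply: sqr_ge0.
have W0 : 0 <= fexp P W by apply: fexp_ge_cst.
have R0 : 0 <= rad t0 n p F by exact: rad_ge0.
pose vv := 4 * n%:R * sig2 + 8 * fexp P W.
have vv0 : 0 <= vv by rewrite addr_ge0 // mulr_ge0 // mulr_ge0.
have HZ := herbst HP ent_Z vv0 s0 s6.
have EZ : fexp P Z <= 2 * rad t0 n p F.
  apply: le_trans (symmetrization t0 n Hp g) _.
  by apply: ler_wpM2l => //; apply: rad_contraction.
have EW := fexp_W_le.
set r := rad t0 n p F in R0 EZ EW *.
pose thr := 13 * r + 24 * s * n%:R * sig2 + u / s.
(* The mean of [Z] costs [2 * r] and the variance proxy [64 * s * r], at most [64 / 6 * r]; 13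
   exceeds the sum of the two coefficients. *)
have Hthr : lmgf P Z s - s * thr <= - u.
  have -> : s * thr = s * (13 * r + 24 * s * n%:R * sig2) + u.
    by rewrite /thr; field; rewrite gt_eqF.
  suff : lmgf P Z s <= s * (13 * r + 24 * s * n%:R * sig2) by lra.
  apply: le_trans HZ _.
  have -> : s * fexp P Z + 2 * s ^+ 2 * vv = s * (fexp P Z + 2 * s * vv).
    by ring.
  apply: ler_wpM2l; first exact: ltW.
  have h : 2 * s * vv <= 2 * s * (12 * (n%:R * sig2) + 32 * r).
    by apply: ler_wpM2l; [lra|rewrite /vv; lra].
  have : s * r <= 6^-1 * r by apply: ler_wpM2r.
  lra.
apply: (@le_trans _ _ (fexp P (fun v => expR (s * Z v) * expR (- (s * thr))))).
  rewrite big_mkcond /=; apply: ler_sum => v _.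
  have P0 : 0 <= P v by case: HP.
  case: ifP => [h|_]; last by rewrite !mulr_ge0 // expR_ge0.
  rewrite -[leLHS]mulr1; apply: ler_wpM2l => //.
  rewrite -expRD -expR0 ler_expR -mulrBr mulr_ge0 ?(ltW s0) //.
  by rewrite subr_ge0 ltW.
rewrite (@fexp_ext _ _ _ _ (fun v => expR (- (s * thr)) * expR (s * Z v)));
  last by move=> v; rewrite mulrC.
rewrite fexpZ -/(mgf P Z s) -[mgf P Z s](@lnK _ _) ?posrE ?mgf_gt0 //.
by rewrite -expRD ler_expR -/(lmgf P Z s); lra.
Qed.

End Concentration.

(** * Rademacher averages of linear classes *)

Section RademacherBounds.
Variable R : realType.

Lemma sum_cauchy_schwarz (I : finType) (c S : I -> R) (a : R) :
  0 <= a -> \sum_i c i ^+ 2 <= a ^+ 2 ->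
  \sum_i c i * S i <= a * Num.sqrt (\sum_i S i ^+ 2).
Proof.
move=> a0 ca.
have S0 : 0 <= \sum_i S i ^+ 2 by apply: sumr_ge0 => i _; apply: sqr_ge0.
have lag : 0 <= \sum_i \sum_j (c i * S j - c j * S i) ^+ 2.
  by apply: sumr_ge0 => i _; apply: sumr_ge0 => j _; apply: sqr_ge0.
have E : \sum_i \sum_j (c i * S j - c j * S i) ^+ 2 =
    2 * ((\sum_i c i ^+ 2) * (\sum_i S i ^+ 2) - (\sum_i c i * S i) ^+ 2).
  under eq_bigr => i _.
    rewrite (eq_bigr (fun j => c i ^+ 2 * S j ^+ 2 + S i ^+ 2 * c j ^+ 2 -
      2 * (c i * S i) * (c j * S j))); last by move=> j _; ring.
    rewrite sumrB big_split /= -!mulr_sumr.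
    over.
  rewrite sumrB big_split /= -!mulr_suml -mulr_sumr; ring.
have h : (\sum_i c i * S i) ^+ 2 <= a ^+ 2 * (\sum_i S i ^+ 2).
  have : (\sum_i c i ^+ 2) * (\sum_i S i ^+ 2) <= a ^+ 2 * (\sum_i S i ^+ 2).
    by apply: ler_wpM2r.
  lra.
apply: le_trans (ler_norm _) _.
rewrite -(ler_pXn2r (isT : (0 < 2)%N)) ?nnegrE ?mulr_ge0 ?sqrtr_ge0 //.
by rewrite real_normK ?num_real // exprMn sqr_sqrtr.
Qed.

Variables (n : nat) (V : finType) (p : V -> R).
Hypothesis Hp : is_pmf p.
Local Notation P := (@prod_pmf R V p n).
Let HP : is_pmf P := prod_pmfP n Hp.

Lemma fexp_prod (G : 'I_n -> V -> R) :
  fexp P (fun v => \prod_i G i (v i)) = \prod_i fexp p (G i).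
Proof.
rewrite /fexp (bigA_distr_bigA (fun i x => p x * G i x)) /=.
by apply: eq_bigr => v _; rewrite big_split.
Qed.

(** The signs are averaged first, for a fixed sample; each gives a hyperbolic cosine, at most
    [1 + 2 * x ^+ 2] for [|x| <= 1/2]. Hence only the second moment enters the exponent, while [U]
    just restricts [c]. *)
Lemma mgf_signed_sum_le (q : V -> R) (U m2 c : R) :
  (forall x, `|q x| <= U) -> fexp p (fun x => q x ^+ 2) <= m2 ->
  `|c| * U <= 2^-1 ->
  fexp (@signs R n) (fun e => fexp P (fun v =>
    expR (c * \sum_i sgn R (e i) * q (v i)))) <= expR (2 * n%:R * c ^+ 2 * m2).
Proof.
move=> qU qm cU; rewrite fexp_exchange.
apply: (@le_trans _ _ (fexp P (fun v => \prod_(i < n) (1 + 2 * c ^+ 2 * q (v i) ^+ 2)))).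
  apply: fexp_le => // v.
  rewrite (@fexp_ext _ _ _ _ (fun e : {ffun 'I_n -> bool} =>
    \prod_i expR (c * (sgn R (e i) * q (v i))))); last first.
    by move=> e; rewrite mulr_sumr expR_sum.
  have -> : fexp (@signs R n) (fun e : {ffun 'I_n -> bool} =>
      \prod_i expR (c * (sgn R (e i) * q (v i)))) =
    \prod_i fexp (@coin R) (fun b => expR (c * (sgn R b * q (v i)))).
    rewrite /fexp (bigA_distr_bigA (fun i b => coin R b * _)) /=.
    by apply: eq_bigr => e _; rewrite big_split.
  apply: ler_prod => i _; rewrite fexp_coin.
  have h : `|c * q (v i)| <= 2^-1.
    by rewrite normrM; apply: le_trans cU; apply: ler_wpM2l.
  have h1 := expR_le_quad h.
  have h2 : expR (- (c * q (v i))) <= 1 - c * q (v i) + 2 * (c * q (v i)) ^+ 2.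
    by rewrite -sqrrN; apply: expR_le_quad; rewrite normrN.
  rewrite /= mul1r mulN1r mulrN mulr_ge0 ?invr_ge0 ?addr_ge0 ?expR_ge0 //=.
  by move: h1 h2; rewrite exprMn; lra.
rewrite (fexp_prod (fun _ x => 1 + 2 * c ^+ 2 * q x ^+ 2)).
rewrite fexpD fexp_cst // fexpZ.
have c0 := sqr_ge0 c.
have q0 : 0 <= fexp p (fun x => q x ^+ 2).
  by apply: fexp_ge_cst => // x; apply: sqr_ge0.
rewrite prodr_const card_ord.
have -> : 2 * n%:R * c ^+ 2 * m2 = n%:R * (2 * c ^+ 2 * m2) by ring.
rewrite expRM_natl; apply: lerXn2r; rewrite ?nnegrE ?expR_ge0 //.
  by rewrite addr_ge0 // mulr_ge0 // mulr_ge0.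
apply: le_trans (expR_ge1Dx _); rewrite lerD2l ler_wpM2l // mulr_ge0 //.
Qed.

(** Soft maximum: [s * |t| <= y - 1 + expR (s * |t| - y)], and the exponential of the maximum is
    bounded by the sum over all [j] and both signs, whence [ln (2 * N)]. The shift [y] is the
    logarithm of the resulting bound, so the exponential term has mean at most 1. The parameter [s]
    stays free for later tuning. *)
Lemma rad_max_le (N : nat) (j0 : 'I_N) (q : 'I_N -> V -> R) (U m2 s : R) :
  (forall j x, `|q j x| <= U) ->
  (forall j, fexp p (fun x => q j x ^+ 2) <= m2) ->
  0 < s -> s * U <= 2^-1 ->
  fexp (@signs R n) (fun e => fexp P (fun v =>
    fmax j0 (fun j => `|\sum_i sgn R (e i) * q j (v i)|))) <=
  ln (2 * N%:R) / s + 2 * n%:R * s * m2.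
Proof.
move=> qU qm s0 sU.
have N0 : 0 < 2 * N%:R :> R by rewrite mulr_gt0 // ltr0n; case: N j0 {q qU qm} => [[]|].
set y := ln (2 * N%:R) + 2 * n%:R * s ^+ 2 * m2.
pose T (e : {ffun 'I_n -> bool}) (v : {ffun 'I_n -> V}) j :=
  \sum_i sgn R (e i) * q j (v i).
have -> : ln (2 * N%:R) / s + 2 * n%:R * s * m2 = s^-1 * y.
  by rewrite /y; field; rewrite gt_eqF.
rewrite ler_pdivlMl // -fexpZ.
have HS := signsP R n.
apply: (@le_trans _ _ (fexp (@signs R n) (fun e => fexp P (fun v =>
   (y - 1) + expR (- y) * \sum_j (expR (s * T e v j) + expR (- s * T e v j)))))).
  apply: fexp_le => // e; rewrite -fexpZ; apply: fexp_le => // v.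
  have [j ->] := fmax_attained j0 (fun j => `|\sum_i sgn R (e i) * q j (v i)|).
  rewrite -/(T e v j); set t := T e v j.
  apply: (@le_trans _ _ (y - 1 + expR (s * `|t| - y))).
    have := expR_ge1Dx (s * `|t| - y); lra.
  rewrite lerD2l addrC expRD ler_wpM2l ?expR_ge0 //.
  rewrite (bigD1 j) //= -/t.
  apply: (@le_trans _ _ (expR (s * t) + expR (- s * t))).
    have := expR_ge0 (s * t); have := expR_ge0 (- s * t).
    by have [_|_] := ger0P t; rewrite ?mulrN ?mulNr; lra.
  by rewrite lerDl; apply: sumr_ge0 => k _; rewrite addr_ge0 // expR_ge0.
rewrite (@fexp_ext _ _ _ _ (fun e => (y - 1) + expR (- y) * (\sum_j
   (fexp P (fun v => expR (s * T e v j)) +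
    fexp P (fun v => expR (- s * T e v j)))))); last first.
  move=> e; rewrite fexpD fexp_cst // fexpZ fexp_sum; congr (_ + _ * _).
  by apply: eq_bigr => j _; rewrite fexpD.
rewrite fexpD fexp_cst // fexpZ fexp_sum.
apply: (@le_trans _ _ (y - 1 + expR (- y) *
    \sum_(j < N) (2 * expR (2 * n%:R * s ^+ 2 * m2)))).
  rewrite lerD2l ler_wpM2l ?expR_ge0 //; apply: ler_sum => j _.
  rewrite fexpD mulr_natl mulr2n; apply: lerD.
    by apply: mgf_signed_sum_le (qU j) (qm j) _; rewrite ger0_norm // ltW.
  rewrite -(sqrrN s); apply: mgf_signed_sum_le (qU j) (qm j) _.
  by rewrite normrN ger0_norm // ltW.
rewrite sumr_const card_ord /y opprD expRD [expR (- ln _)]expRN lnK ?posrE //.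
set E := expR (2 * _ * _ * _).
have EE : expR (- (2 * n%:R * s ^+ 2 * m2)) * E = 1.
  by rewrite -expRD addNr expR0.
have -> : (2 * N%:R)^-1 * expR (- (2 * n%:R * s ^+ 2 * m2)) * (2 * E *+ N) =
  (2 * N%:R)^-1 * (2 * N%:R) * (expR (- (2 * n%:R * s ^+ 2 * m2)) * E).
  rewrite -(mulr_natr (2 * E)); ring.
by rewrite EE mulVf ?gt_eqF // mulr1 subrK.
Qed.

Lemma fexp_signs_mul (i j : 'I_n) :
  fexp (@signs R n) (fun e => sgn R (e i) * sgn R (e j)) = (i == j)%:R.
Proof.
have HS := signsP R n.
case: eqVneq => [<-|ij].
  rewrite -[RHS](fexp_cst HS); apply: fexp_ext => e.
  by rewrite /sgn; case: (e i); rewrite ?mulr1 // mulrNN mulr1.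
rewrite (fexp_resample (coinP R) i) -[RHS](fexp_cst HS).
apply: fexp_ext => e; rewrite fexp_coin !ffunE eqxx eq_sym (negPf ij) /=.
by rewrite mul1r mulN1r subrr mulr0.
Qed.

Lemma fexp_signs_sqr (a : 'I_n -> R) :
  fexp (@signs R n) (fun e => (\sum_i sgn R (e i) * a i) ^+ 2) =
  \sum_i a i ^+ 2.
Proof.
rewrite (@fexp_ext _ _ _ _ (fun e : {ffun 'I_n -> bool} =>
    \sum_i \sum_j (a i * a j) * (sgn R (e i) * sgn R (e j)))); last first.
  move=> e; rewrite expr2 mulr_suml; apply: eq_bigr => i _.
  by rewrite mulr_sumr; apply: eq_bigr => j _; rewrite mulrACA mulrC.
rewrite fexp_sum; apply: eq_bigr => i _; rewrite fexp_sum.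
rewrite (bigD1 i) //= fexpZ fexp_signs_mul eqxx mulr1 big1 ?addr0 //.
by move=> j ji; rewrite fexpZ fexp_signs_mul eq_sym (negPf ji) mulr0.
Qed.

(** The mean of a square root is at most the square root of the mean, and orthogonality of distinct
    signs kills the cross terms. *)
Lemma rad_l2_le (d : nat) (e_ : 'I_d -> V -> R) :
  (forall k, fexp p (fun x => e_ k x ^+ 2) <= 1) ->
  fexp (@signs R n) (fun e => fexp P (fun v =>
    Num.sqrt (\sum_k (\sum_i sgn R (e i) * e_ k (v i)) ^+ 2))) <=
  Num.sqrt (n%:R * d%:R).
Proof.
move=> ed; have HS := signsP R n.
pose X (e : {ffun 'I_n -> bool}) (v : {ffun 'I_n -> V}) :=
  \sum_k (\sum_i sgn R (e i) * e_ k (v i)) ^+ 2.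
have X0 e v : 0 <= X e v by apply: sumr_ge0 => k _; apply: sqr_ge0.
set m := fexp _ _.
have m0 : 0 <= m.
  by apply: fexp_ge_cst => // e; apply: fexp_ge_cst => // v; apply: sqrtr_ge0.
have h1 : m ^+ 2 <= fexp (@signs R n) (fun e => fexp P (X e)).
  have : 0 <= fexp (@signs R n) (fun e => fexp P (fun v =>
      (Num.sqrt (X e v) - m) ^+ 2)).
    apply: fexp_ge_cst => // e; apply: fexp_ge_cst => // v.
    exact: sqr_ge0.
  rewrite (@fexp_ext _ _ _ _ (fun e => fexp P (X e) -
      2 * m * fexp P (fun v => Num.sqrt (X e v)) + m ^+ 2)); last first.
    move=> e; rewrite -fexpZ -fexpB -[m ^+ 2](fexp_cst HP) -fexpD.
    apply: fexp_ext => v.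
    rewrite -{2}(sqr_sqrtr (X0 e v)); ring.
  rewrite fexpD fexpB fexpZ fexp_cst // -/m; lra.
have h2 : fexp (@signs R n) (fun e => fexp P (X e)) <= n%:R * d%:R.
  rewrite fexp_exchange.
  rewrite (@fexp_ext _ _ _ _ (fun v : {ffun 'I_n -> V} => \sum_k \sum_i e_ k (v i) ^+ 2)); last first.
    by move=> v; rewrite fexp_sum; apply: eq_bigr => k _; rewrite fexp_signs_sqr.
  rewrite fexp_sum.
  apply: (@le_trans _ _ (\sum_(k < d) n%:R)); last first.
    by rewrite sumr_const card_ord mulr_natr.
  apply: ler_sum => k _; rewrite fexp_sum.
  apply: (@le_trans _ _ (\sum_(i < n) 1)).
    by apply: ler_sum => i _; rewrite (fexp_coord Hp i (fun x => e_ k x ^+ 2)).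
  by rewrite sumr_const card_ord.
rewrite -(ler_pXn2r (isT : (0 < 2)%N)) ?nnegrE ?sqrtr_ge0 //.
by rewrite sqr_sqrtr ?mulr_ge0 //; apply: le_trans h2.
Qed.

(** The residuals come in two families because those inside and outside J have different second
    moments and different l1 bounds on their coefficients; each has its own tuning parameter. *)
Lemma rad_linear_le (T : finType) (t0 : T) (N : nat) (j0 : 'I_N) (d : nat)
    (e_ : 'I_d -> V -> R) (q1 q2 : 'I_N -> V -> R)
    (c : T -> 'I_d -> R) (b1 b2 : T -> 'I_N -> R) (F : T -> V -> R)
    (a beta1 beta2 U m2 s1 s2 : R) :
  (forall t x, F t x = \sum_k c t k * e_ k x +
     (\sum_j b1 t j * q1 j x + \sum_j b2 t j * q2 j x)) ->
  0 <= a -> (forall t, \sum_k c t k ^+ 2 <= a ^+ 2) ->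
  (forall t, \sum_j `|b1 t j| <= beta1) ->
  (forall t, \sum_j `|b2 t j| <= beta2) ->
  (forall k, fexp p (fun x => e_ k x ^+ 2) <= 1) ->
  (forall j x, `|q1 j x| <= U) -> (forall j x, `|q2 j x| <= U) ->
  (forall j, fexp p (fun x => q1 j x ^+ 2) <= m2) ->
  (forall j, fexp p (fun x => q2 j x ^+ 2) <= 1) ->
  0 < s1 -> s1 * U <= 2^-1 -> 0 < s2 -> s2 * U <= 2^-1 ->
  rad t0 n p F <= a * Num.sqrt (n%:R * d%:R) +
    (beta1 * (ln (2 * N%:R) / s1 + 2 * n%:R * s1 * m2) +
     beta2 * (ln (2 * N%:R) / s2 + 2 * n%:R * s2)).
Proof.
move=> FE a0 ca hb1 hb2 he q1U q2U q1m q2m s10 s1U s20 s2U.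
have HS := signsP R n.
pose X (e : {ffun 'I_n -> bool}) (v : {ffun 'I_n -> V}) :=
  Num.sqrt (\sum_k (\sum_i sgn R (e i) * e_ k (v i)) ^+ 2).
pose Y (q : 'I_N -> V -> R) (e : {ffun 'I_n -> bool}) (v : {ffun 'I_n -> V}) :=
  fmax j0 (fun j => `|\sum_i sgn R (e i) * q j (v i)|).
have beta1_ge0 : 0 <= beta1 by apply: le_trans (hb1 t0); apply: sumr_ge0.
have beta2_ge0 : 0 <= beta2 by apply: le_trans (hb2 t0); apply: sumr_ge0.
have l1 (q : 'I_N -> V -> R) (b : 'I_N -> R) (beta : R) (e : {ffun 'I_n -> bool}) (v : {ffun 'I_n -> V}) : \sum_j `|b j| <= beta ->
    \sum_j b j * (\sum_i sgn R (e i) * q j (v i)) <= beta * Y q e v.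
  move=> hb; have Y0 : 0 <= Y q e v.
    by apply: le_trans (fmax_ge j0 _ j0).
  apply: le_trans (ler_wpM2r Y0 hb); rewrite mulr_suml; apply: ler_sum => j _.
  apply: le_trans (ler_norm _) _; rewrite normrM; apply: ler_wpM2l => //.
  exact: (fmax_ge j0 (fun j => `|\sum_i sgn R (e i) * q j (v i)|)).
apply: (@le_trans _ _ (fexp (@signs R n) (fun e => fexp P (fun v =>
    a * X e v + (beta1 * Y q1 e v + beta2 * Y q2 e v))))).
  apply: fexp_le => // e; apply: fexp_le => // v; apply: fmax_le => t.
  rewrite (eq_bigr (fun i =>
     (\sum_k sgn R (e i) * (c t k * e_ k (v i))) +
      (\sum_j sgn R (e i) * (b1 t j * q1 j (v i)) +
       \sum_j sgn R (e i) * (b2 t j * q2 j (v i))))); last first.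
    by move=> i _; rewrite FE !mulrDr !mulr_sumr.
  rewrite !big_split /=; apply: lerD; [|apply: lerD].
  - apply: le_trans (sum_cauchy_schwarz _ a0 (ca t)); rewrite exchange_big /=.
    apply: ler_sum => k _; rewrite mulr_sumr; apply: ler_sum => i _.
    by rewrite mulrCA.
  - apply: le_trans (l1 q1 (b1 t) beta1 e v (hb1 t)); rewrite exchange_big /=.
    apply: ler_sum => k _; rewrite mulr_sumr; apply: ler_sum => i _.
    by rewrite mulrCA.
  - apply: le_trans (l1 q2 (b2 t) beta2 e v (hb2 t)); rewrite exchange_big /=.
    apply: ler_sum => k _; rewrite mulr_sumr; apply: ler_sum => i _.
    by rewrite mulrCA.
rewrite (@fexp_ext _ _ _ _ (fun e => a * fexp P (X e) +
   (beta1 * fexp P (Y q1 e) + beta2 * fexp P (Y q2 e)))); last first.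
  by move=> e; rewrite !fexpD !fexpZ.
rewrite !fexpD !fexpZ; apply: lerD; [|apply: lerD]; apply: ler_wpM2l => //.
- exact: rad_l2_le.
- exact: rad_max_le.
- by rewrite -[X in _ <= _ + X]mulr1; apply: rad_max_le.
Qed.

End RademacherBounds.

(** * Reduction of the empirical process to finite spaces *)

Section BoundedMean.
Context (R : realType) (d : measure_display) (E : measurableType d).
Implicit Types f g : E -> R.

(** An algebra of functions on which [mean] is linear with no separate integrability argument. *)
Definition bdm f : Prop :=
  measurable_fun setT f /\ exists M : R, forall x, `|f x| <= M.

Lemma bdm_cst (c : R) : bdm (fun=> c).
Proof. by split; [exact: measurable_cst|exists `|c|]. Qed.

Lemma bdmD f g : bdm f -> bdm g -> bdm (fun x => f x + g x).
Proof.
move=> [mf [M fM]] [mg [M' gM]]; split; first exact: measurable_funD.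
by exists (M + M') => x; apply: le_trans (ler_normD _ _) _; apply: lerD.
Qed.

Lemma bdmM f g : bdm f -> bdm g -> bdm (fun x => f x * g x).
Proof.
move=> [mf [M fM]] [mg [M' gM]]; split; first exact: measurable_funM.
by exists (M * M') => x; rewrite normrM; apply: ler_pM.
Qed.

Lemma bdmZ c f : bdm f -> bdm (fun x => c * f x).
Proof. by move=> bf; apply: bdmM => //; apply: bdm_cst. Qed.

Lemma bdmN f : bdm f -> bdm (fun x => - f x).
Proof.
by move=> bf; rewrite (_ : (fun _ => _) = (fun x => -1 * f x));
  [exact: bdmZ|apply/funext => x; rewrite mulN1r].
Qed.

Lemma bdmB f g : bdm f -> bdm g -> bdm (fun x => f x - g x).
Proof. by move=> bf bg; apply: bdmD => //; apply: bdmN. Qed.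

Lemma bdm_sqr f : bdm f -> bdm (fun x => f x ^+ 2).
Proof. by move=> bf; under eq_fun do rewrite expr2; apply: bdmM. Qed.

Lemma bdm_sum (I : Type) (r : seq I) (P : pred I) (F : I -> E -> R) :
  (forall i, bdm (F i)) -> bdm (fun x => \sum_(i <- r | P i) F i x).
Proof.
move=> bF; elim: r => [|i r IH].
  by under eq_fun do rewrite big_nil; apply: bdm_cst.
under eq_fun do rewrite big_cons.
by case: (P i) => //; apply: bdmD.
Qed.

Lemma bdm_indic (A : set E) : measurable A -> bdm (\1_A : E -> R).
Proof.
move=> mA; split; first exact: measurable_indic.
by exists 1 => x; rewrite indicE; case: (_ \in _); rewrite ?normr1 ?normr0.
Qed.

Variable Q : probability E R.

Definition mean f : R := \int[Q]_x f x.

Lemma bdm_integrable f : bdm f -> Q.-integrable setT (EFin \o f).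
Proof.
move=> [mf [M fM]]; apply: measurable_bounded_integrable => //.
  by rewrite -ge0_fin_numE // fin_num_measure.
exists M; split; first exact: num_real.
by move=> M' MM' x _ /=; apply: le_trans (fM x) (ltW MM').
Qed.

Lemma mean_EFin f : bdm f -> (\int[Q]_x (f x)%:E)%E = (mean f)%:E.
Proof.
move=> bf; rewrite /mean /Rintegral fineK //.
exact: (integrable_fin_num _ (bdm_integrable bf)).
Qed.

Lemma mean_ext f g : f =1 g -> mean f = mean g.
Proof. by move=> fg; congr mean; apply/funext. Qed.

Lemma mean_cst c : mean (fun=> c) = c.
Proof.
rewrite /mean Rintegral_cst //.
have -> : fine (Q setT) = 1 by rewrite probability_setT.
exact: mulr1.
Qed.

Lemma meanD f g : bdm f -> bdm g -> mean (fun x => f x + g x) = mean f + mean g.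
Proof. by move=> bf bg; rewrite /mean RintegralD //; apply: bdm_integrable. Qed.

Lemma meanB f g : bdm f -> bdm g -> mean (fun x => f x - g x) = mean f - mean g.
Proof. by move=> bf bg; rewrite /mean RintegralB //; apply: bdm_integrable. Qed.

Lemma meanZ c f : bdm f -> mean (fun x => c * f x) = c * mean f.
Proof. by move=> bf; rewrite /mean RintegralZl //; apply: bdm_integrable. Qed.

Lemma mean_le f g : bdm f -> bdm g -> (forall x, f x <= g x) -> mean f <= mean g.
Proof.
by move=> bf bg fg; apply: le_Rintegral => //; apply: bdm_integrable.
Qed.

Lemma mean_ge0 f : (forall x, 0 <= f x) -> 0 <= mean f.
Proof. by move=> f0; apply: Rintegral_ge0. Qed.

Lemma mean_sum (I : Type) (r : seq I) (P : pred I) (F : I -> E -> R) :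
  (forall i, bdm (F i)) ->
  mean (fun x => \sum_(i <- r | P i) F i x) = \sum_(i <- r | P i) mean (F i).
Proof.
move=> bF; elim: r => [|i r IH].
  by under mean_ext do rewrite big_nil; rewrite mean_cst big_nil.
under mean_ext do rewrite big_cons.
by rewrite big_cons; case: (P i) => //; rewrite meanD ?IH //; apply: bdm_sum.
Qed.

Lemma mean_indic (A : set E) : measurable A -> mean (\1_A) = fine (Q A).
Proof. by move=> mA; rewrite /mean /Rintegral integral_indic // setIT. Qed.

Lemma mean_dist_le f g c : bdm f -> bdm g -> (forall x, `|f x - g x| <= c) ->
  `|mean f - mean g| <= c.
Proof.
move=> bf bg fg; rewrite -meanB // ler_norml; apply/andP; split.
  rewrite -[leLHS]mean_cst; apply: mean_le; [exact: bdm_cst|exact: bdmB|].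
  by move=> x; have := fg x; rewrite ler_norml => /andP[].
rewrite -[leRHS]mean_cst; apply: mean_le; [exact: bdmB|exact: bdm_cst|].
by move=> x; have := fg x; rewrite ler_norml => /andP[].
Qed.

Lemma probability_nonempty : exists x : E, True.
Proof.
apply: contrapT => noE.
have : Q setT = 0%E.
  rewrite (_ : setT = set0) ?measure0 //; apply/seteqP; split=> // x _.
  by apply: noE; exists x.
by rewrite probability_setT => /eqP; rewrite onee_eq0.
Qed.

End BoundedMean.

Section GridCells.
Variables (R : realType) (I : finType).

Lemma uniform_bound (X : Type) (G : I -> X -> R) :
  (forall a, exists M : R, forall x, `|G a x| <= M) ->
  exists2 b : R, 0 <= b & forall a x, `|G a x| <= b.
Proof.
move=> /choice[M GM]; exists (\sum_a `|M a|); first exact: sumr_ge0.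
move=> a x; apply: le_trans (GM a x) _; apply: le_trans (ler_norm _) _.
by rewrite (bigD1 a) //= lerDl sumr_ge0.
Qed.

(** Values are shifted by [b] to be nonnegative and rounded down to the grid of step [eta]. The
    default value of [inord] is never reached when [b] bounds the functions and [K] is
    [truncn (2 * b / eta)]. *)
Definition cell (X : Type) (b eta : R) K (G : I -> X -> R) (x : X) :
    {ffun I -> 'I_K.+1} :=
  [ffun a => inord (Num.truncn ((G a x + b) / eta))].

Lemma cell_osc (X : Type) (G : I -> X -> R) (b eta : R) : 0 < eta ->
  (forall a x, `|G a x| <= b) ->
  let K := Num.truncn (2 * b / eta) in
  forall x x', cell b eta K G x = cell b eta K G x' ->
  forall a, `|G a x - G a x'| <= eta.
Proof.
move=> eta0 Gb K x x' + a => /ffunP/(_ a)/(congr1 val); rewrite !ffunE /=.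
have nn y : 0 <= (G a y + b) / eta.
  apply: divr_ge0; last exact: ltW.
  by have := Gb a y; rewrite ler_norml => /andP[]; lra.
have lK y : (Num.truncn ((G a y + b) / eta) < K.+1)%N.
  rewrite ltnS; apply: le_truncn; rewrite ler_pM2r ?invr_gt0 //.
  by have := Gb a y; rewrite ler_norml => /andP[]; lra.
rewrite !inordK // => E.
have /andP[h1 h2] := truncn_itv (nn x).
have /andP[h3 h4] := truncn_itv (nn x'); rewrite -E in h3 h4.
set k := Num.truncn _ in h1 h2 h3 h4.
rewrite ler_pdivlMr // in h1; rewrite ltr_pdivrMr // in h2.
rewrite ler_pdivlMr // in h3; rewrite ltr_pdivrMr // in h4.
rewrite -natr1 in h2 h4; rewrite ler_norml; apply/andP; split; lra.
Qed.

Lemma measurable_cell (d : measure_display) (E : measurableType d)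
    (G : I -> E -> R) (b eta : R) K :
  0 < eta -> (forall a, measurable_fun setT (G a)) ->
  (forall a x, `|G a x| <= b) ->
  forall v, measurable (cell b eta K G @^-1` [set v]).
Proof.
move=> eta0 mG Gb v.
have -> : cell b eta K G @^-1` [set v] =
    \bigcap_(a in [set` [set: I]])
      (\bigcup_(k in [set k | inord k = v a :> 'I_K.+1])
        (G a @^-1` `[k%:R * eta - b, k.+1%:R * eta - b[%classic)).
  have nn a y : 0 <= (G a y + b) / eta.
    apply: divr_ge0; last exact: ltW.
    by have := Gb a y; rewrite ler_norml => /andP[]; lra.
  have Hk a y k : (`[k%:R * eta - b, k.+1%:R * eta - b[%classic (G a y)) <->
      Num.truncn ((G a y + b) / eta) = k.
    rewrite /= in_itv /=; split=> [/andP[h1 h2]|<-].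
      apply: truncn_def; rewrite ler_pdivlMr // ltr_pdivrMr //.
      by apply/andP; split; lra.
    have /andP[h1 h2] := truncn_itv (nn a y).
    rewrite ler_pdivlMr // in h1; rewrite ltr_pdivrMr // in h2.
    by apply/andP; split; lra.
  apply/seteqP; split=> x /=.
    move=> <- a _; exists (Num.truncn ((G a x + b) / eta)); rewrite /= ?ffunE //.
    exact/Hk.
  move=> H; apply/ffunP => a; rewrite ffunE.
  have [|k /= <- /Hk ->] // := H a.
  by rewrite /= in_setT.
apply: fin_bigcap_measurable => // a _.
apply: bigcup_measurable => k _.
by rewrite -[X in measurable X]setTI; apply: mG.
Qed.

End GridCells.

Section Transfer.
Context (R : realType) (dE dO : measure_display) (E : measurableType dE)
  (Omega : measurableType dO) (Pr : probability Omega R) (P : probability E R).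
Variables (n : nat) (Z : 'I_n -> {RV Pr >-> E}).
Hypothesis iidZ : iid_sample P Z.
Variables (V : finType) (cl : E -> V).
Hypothesis mcl : forall v, measurable (cl @^-1` [set v]).

Definition cell_pmf (v : V) : R := fine (P (cl @^-1` [set v])).

Lemma mean_cell (f : V -> R) : mean P (fun x => f (cl x)) = fexp cell_pmf f.
Proof.
rewrite (@mean_ext _ _ _ _ _ (fun x => \sum_v f v * \1_(cl @^-1` [set v]) x)).
  rewrite mean_sum; last by move=> v; apply/bdmZ/bdm_indic.
  apply: eq_bigr => v _; rewrite meanZ; last exact: bdm_indic.
  by rewrite mean_indic // mulrC.
move=> x; rewrite (bigD1 (cl x)) //= indicE mem_set // mulr1 big1 ?addr0 //.
move=> v /eqP vx; rewrite indicE memNset ?mulr0 //= => xv; exact: vx.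
Qed.

Lemma bdm_cell (f : V -> R) : bdm (fun x => f (cl x)).
Proof.
rewrite (_ : (fun _ => _) = (fun x => \sum_v f v * \1_(cl @^-1` [set v]) x)).
  by apply: bdm_sum => v; apply/bdmZ/bdm_indic.
apply/funext => x.
rewrite (bigD1 (cl x)) //= indicE mem_set // mulr1 big1 ?addr0 //.
move=> v /eqP vx; rewrite indicE memNset ?mulr0 //= => xv; exact: vx.
Qed.

Lemma cell_pmfP : is_pmf cell_pmf.
Proof.
split=> [v|]; first by rewrite /cell_pmf fine_ge0.
have := mean_cell (fun=> 1); rewrite mean_cst /fexp => /esym h.
by rewrite -[RHS]h; apply: eq_bigr => v _; rewrite mulr1.
Qed.

Lemma sample_cells_measurable (v : {ffun 'I_n -> V}) :
  measurable [set w | forall i, cl (Z i w) = v i].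
Proof.
have -> : [set w | forall i, cl (Z i w) = v i] =
    \bigcap_(i in [set` [set: 'I_n]]) (Z i @^-1` (cl @^-1` [set v i])).
  by apply/seteqP; split=> w /= H i; [move=> _|]; apply: H; rewrite /= ?in_setT.
apply: fin_bigcap_measurable => // i _.
by rewrite -[X in measurable X]setTI; apply: measurable_funP.
Qed.

Lemma sample_cells (v : {ffun 'I_n -> V}) :
  fine (Pr [set w | forall i, cl (Z i w) = v i]) = prod_pmf cell_pmf v.
Proof.
have -> : [set w | forall i, cl (Z i w) = v i] =
    \bigcap_(i in [set` [set: 'I_n]%SET]) (Z i @^-1` (cl @^-1` [set v i])).
  by apply/seteqP; split=> w /= H i; [move=> _|]; apply: H; rewrite /= ?inE.
have [idZ indZ] := iidZ.
rewrite (indZ _ (fun i => cl @^-1` [set v i])); last by move=> i; apply: mcl.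
rewrite (eq_bigr (fun i => (cell_pmf (v i))%:E)); last first.
  move=> i _; rewrite /cell_pmf fineK ?fin_num_measure //.
  exact: (idZ i _ (mcl (v i))).
rewrite prodEFin /= /prod_pmf; apply: eq_bigl => i; by rewrite inE.
Qed.

(** Such an event is a finite disjoint union of cylinders, and independence gives each cylinder its
    product weight; this carries tail bounds from the finite space to [Pr]. *)
Lemma sample_cells_prob (B : pred {ffun 'I_n -> V}) :
  measurable [set w | B [ffun i => cl (Z i w)]] /\
  fine (Pr [set w | B [ffun i => cl (Z i w)]]) =
    \sum_(v | B v) prod_pmf cell_pmf v.
Proof.
have E1 : (\1_[set w | B [ffun i => cl (Z i w)]] : Omega -> R) =
    (fun w => \sum_(v | B v) \1_[set w | forall i, cl (Z i w) = v i] w).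
  apply/funext => w; pose v0 : {ffun 'I_n -> V} := [ffun i => cl (Z i w)].
  have H (v : {ffun 'I_n -> V}) : (\1_[set w | forall i, cl (Z i w) = v i] w : R) = (v == v0)%:R.
    rewrite indicE; congr (nat_of_bool _)%:R; apply/idP/idP.
      rewrite inE /= => h; apply/eqP/ffunP => i; by rewrite ffunE h.
    by move=> /eqP ->; rewrite inE /= => i; rewrite ffunE.
  rewrite indicE; under eq_bigr => v _ do rewrite H.
  case: (boolP (B v0)) => Bv.
    rewrite mem_set // (bigD1 v0) //= eqxx big1 ?addr0 // => v.
    by move=> /andP[_ /negPf ->].
  rewrite memNset; last exact/negP.
  rewrite big1 // => v Bv'; case: eqP => // vv0.
  by rewrite -vv0 Bv' in Bv.
have b1 : bdm (\1_[set w | B [ffun i => cl (Z i w)]] : Omega -> R).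
  by rewrite E1; apply: bdm_sum => v; apply/bdm_indic/sample_cells_measurable.
have m1 : measurable [set w | B [ffun i => cl (Z i w)]].
  exact/(measurable_indicP R)/(proj1 b1).
split=> //; rewrite -mean_indic // E1 mean_sum; last first.
  by move=> v; apply/bdm_indic/sample_cells_measurable.
apply: eq_bigr => v _.
rewrite mean_indic ?sample_cells //; exact: sample_cells_measurable.
Qed.

End Transfer.

Section EmpiricalProcess.
Context (R : realType) (dE dO : measure_display) (E : measurableType dE)
  (Omega : measurableType dO) (Pr : probability Omega R) (P : probability E R).
Variables (n : nat) (Z : 'I_n -> {RV Pr >-> E}).
Hypothesis iidZ : iid_sample P Z.

(* The sample space is cut into finitely many cells on which all functions
   involved oscillate little; evaluating them at one representative per cell
   preserves every pointwise relation between them. *)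
Lemma discretize (I : finType) (G : I -> E -> R) (eta : R) : 0 < eta ->
  (forall a, bdm (G a)) ->
  exists (V : finType) (cl : E -> V) (rep : V -> E),
    (forall v, measurable (cl @^-1` [set v])) /\
    (forall a x, `|G a x - G a (rep (cl x))| <= eta).
Proof.
move=> eta0 bG.
have [b b0 Gb] := uniform_bound (fun a => (bG a).2).
pose K := Num.truncn (2 * b / eta).
pose cl := cell b eta K G.
have [x0 _] := probability_nonempty P.
(* Empty cells receive the arbitrary representative [x0]. *)
have /choice[rep Hrep] : forall v, exists x, (exists y, cl y = v) -> cl x = v.
  move=> v; have [[y yv]|no] := pselect (exists y, cl y = v).
    by exists y.
  by exists x0 => /no.
exists {ffun I -> 'I_K.+1}, cl, rep; split.
  by apply: measurable_cell => // a; case: (bG a).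
move=> a x; apply: (cell_osc eta0 Gb); apply/esym.
by apply: Hrep; exists x.
Qed.

(** Discretization raises second moments by [eta <= 1]. For [e_] and [q2] the bound 1 is restored by
    halving the functions and doubling their coefficients, which explains the extra factors 2; for
    [q1] the excess is kept next to [m2], which may be 0, and ends up in [kap]. *)
Lemma empirical_process_le (T : finType) (t0 : T) (N : nat) (j0 : 'I_N)
    (d : nat) (g F : T -> E -> R) (e_ : 'I_d -> E -> R)
    (q1 q2 : 'I_N -> E -> R) (c : T -> 'I_d -> R) (b1 b2 : T -> 'I_N -> R)
    (a beta1 beta2 U m2 sig2 s1 s2 s u kap : R) :
  (forall t, bdm (g t)) -> (forall k, bdm (e_ k)) ->
  (forall j, bdm (q1 j)) -> (forall j, bdm (q2 j)) ->
  (forall t x, `|g t x| <= 1) ->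
  (forall x t t', `|g t x - g t' x| <= `|F t x - F t' x|) ->
  (forall t, mean P (fun x => g t x ^+ 2) <= sig2) ->
  (forall t x, F t x = \sum_k c t k * e_ k x +
     (\sum_j b1 t j * q1 j x + \sum_j b2 t j * q2 j x)) ->
  0 <= a -> (forall t, \sum_k c t k ^+ 2 <= a ^+ 2) ->
  (forall t, \sum_j `|b1 t j| <= beta1) ->
  (forall t, \sum_j `|b2 t j| <= beta2) ->
  (forall k, mean P (fun x => e_ k x ^+ 2) <= 1) ->
  (forall j x, `|q1 j x| <= U) -> (forall j x, `|q2 j x| <= U) ->
  (forall j, mean P (fun x => q1 j x ^+ 2) <= m2) ->
  (forall j, mean P (fun x => q2 j x ^+ 2) <= 1) ->
  0 < s1 -> s1 * U <= 2^-1 -> 0 < s2 -> s2 * U <= 2^-1 ->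
  0 < s -> s <= 6^-1 -> 0 < kap ->
  exists A : set Omega, [/\ measurable A,
    ((1 - expR (- u))%:E <= Pr A)%E &
    forall w, A w -> forall t,
      \sum_i (mean P (g t) - g t (Z i w)) <=
      13 * (2 * a * Num.sqrt (n%:R * d%:R) +
        (beta1 * (ln (2 * N%:R) / s1 + 2 * n%:R * s1 * m2) +
         beta2 * (2 * ln (2 * N%:R) / s2 + 4 * n%:R * s2))) +
      24 * s * n%:R * sig2 + u / s + kap].
Proof.
move=> bg be bq1 bq2 g1 gF gsig FE a0 ca hb1 hb2 he q1U q2U q1m q2m
  s10 s1U s20 s2U s0 s6 kap0.
have beta1_ge0 : 0 <= beta1 by apply: le_trans (hb1 t0); apply: sumr_ge0.
have n0 : 0 <= n%:R :> R by [].
(* The total coefficient of [eta] in the final bound: from [m2 + eta], from [sig2 + eta], and from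
   replacing each [g t] and its mean by values at representatives. *)
pose K := 26 * beta1 * n%:R * s1 + 24 * s * n%:R + 2 * n%:R.
have K0 : 0 <= K.
  by rewrite !addr_ge0 // !mulr_ge0 // ?(ltW s10) ?(ltW s0).
pose eta := Num.min 1 (kap / (K + 1)).
have K1 : 0 < K + 1 by lra.
have eta0 : 0 < eta by rewrite lt_min ltr01 divr_gt0.
have eta1 : eta <= 1 by rewrite ge_min lexx.
have etaK : K * eta <= kap.
  apply: (@le_trans _ _ ((K + 1) * eta)); first by rewrite ler_pM2r //; lra.
  by rewrite mulrC -ler_pdivlMr // ge_min lexx orbT.
(* Only functions whose means or sample values are used need small oscillation; relations such as
   the expansion of [F] hold at each representative anyway. *)
pose G (i : T + (T + ('I_d + ('I_N + 'I_N)))) : E -> R := match i with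
  | inl t => g t
  | inr (inl t) => fun x => g t x ^+ 2
  | inr (inr (inl k)) => fun x => e_ k x ^+ 2
  | inr (inr (inr (inl j))) => fun x => q1 j x ^+ 2
  | inr (inr (inr (inr j))) => fun x => q2 j x ^+ 2 end.
have bG i : bdm (G i).
  by move: i => [t|[t|[k|[j|j]]]] //=; apply: bdm_sqr.
have [V [cl [rep [mcl osc]]]] := discretize eta0 bG.
pose p := cell_pmf P cl.
have Hp : is_pmf p by exact: cell_pmfP.
have close i : `|mean P (G i) - fexp p (fun v => G i (rep v))| <= eta.
  rewrite -(mean_cell P mcl (fun v => G i (rep v))).
  by apply: mean_dist_le => //; exact: (bdm_cell mcl (fun v => G i (rep v))).
have up i m : mean P (G i) <= m -> fexp p (fun v => G i (rep v)) <= m + eta.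
  by have := close i; rewrite ler_norml => /andP[]; lra.
pose g' t v := g t (rep v); pose F' t v := F t (rep v).
have conc := @concentration R T t0 n V p Hp g' F' (sig2 + eta)
  (fun t v => g1 t (rep v)) (fun v => gF (rep v))
  (fun t => up (inr (inl t)) _ (gsig t)) s u s0 s6.
have Hrad : rad t0 n p F' <= 2 * a * Num.sqrt (n%:R * d%:R) +
        (beta1 * (ln (2 * N%:R) / s1 + 2 * n%:R * s1 * (m2 + eta)) +
         2 * beta2 * (ln (2 * N%:R) / s2 + 2 * n%:R * s2)).
  apply: (@rad_linear_le R n V p Hp T t0 N j0 d
    (fun k v => 2^-1 * e_ k (rep v)) (fun j v => q1 j (rep v))
    (fun j v => 2^-1 * q2 j (rep v)) (fun t k => 2 * c t k)
    b1 (fun t j => 2 * b2 t j) F' (2 * a) beta1 (2 * beta2) U (m2 + eta) s1 s2)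
    => //.
  - move=> t v; rewrite /F' FE; congr (_ + (_ + _)).
      by apply: eq_bigr => k _; field.
    by apply: eq_bigr => k _; field.
  - by rewrite mulr_ge0.
  - move=> t; rewrite (eq_bigr (fun k => 2 ^+ 2 * c t k ^+ 2)).
      by rewrite -mulr_sumr exprMn ler_wpM2l.
    by move=> k _; rewrite exprMn.
  - move=> t; rewrite (eq_bigr (fun j => 2 * `|b2 t j|)).
      by rewrite -mulr_sumr ler_wpM2l.
    by move=> j _; rewrite normrM ger0_norm.
  - move=> k; have := up (inr (inr (inl k))) _ (he k).
    rewrite /= (@fexp_ext _ _ _ (fun v => (2^-1 * e_ k (rep v)) ^+ 2)
      (fun v => 2^-1 ^+ 2 * e_ k (rep v) ^+ 2)).
      by rewrite fexpZ; lra.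
    by move=> v; rewrite exprMn.
  - move=> j x; rewrite normrM ger0_norm ?invr_ge0 //.
    have := q2U j (rep x); have := normr_ge0 (q2 j (rep x)); lra.
  - by move=> j; exact: (up (inr (inr (inr (inl j)))) _ (q1m j)).
  - move=> k; have := up (inr (inr (inr (inr k)))) _ (q2m k).
    rewrite /= (@fexp_ext _ _ _ (fun v => (2^-1 * q2 k (rep v)) ^+ 2)
      (fun v => 2^-1 ^+ 2 * q2 k (rep v) ^+ 2)).
      by rewrite fexpZ; lra.
    by move=> v; rewrite exprMn.
pose bad (v : {ffun 'I_n -> V}) : bool :=
  13 * rad t0 n p F' + 24 * s * n%:R * (sig2 + eta) + u / s <
  fmax t0 (fun t => \sum_i (fexp p (g' t) - g' t (v i))).
have {}conc : \sum_(v | bad v) prod_pmf p v <= expR (- u) by exact: conc.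
have [mB PB] := sample_cells_prob iidZ mcl bad.
exists (~` [set w | bad [ffun i => cl (Z i w)]]); split.
- exact: measurableC.
- rewrite probability_setC // -(@fineK _ (Pr _)) ?fin_num_measure //.
  by rewrite PB -EFinB lee_fin lerD2l lerN2.
move=> w /negP; rewrite /bad -leNgt => Hw t.
have := le_trans (fmax_ge t0 _ t) Hw; rewrite /g' => Ht.
have H1 : \sum_i (mean P (g t) - g t (Z i w)) <=
    \sum_i (fexp p (fun v => g t (rep v)) -
      g t (rep ([ffun i => cl (Z i w)] i))) + 2 * n%:R * eta.
  have -> : 2 * n%:R * eta = \sum_(i < n) (2 * eta).
    by rewrite sumr_const card_ord -mulr_natr; ring.
  rewrite -big_split /=; apply: ler_sum => i _; rewrite ffunE.
  have := close (inl t); have := osc (inl t) (Z i w).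
  by rewrite /= !ler_norml => /andP[h1 h2] /andP[h3 h4]; lra.
apply: le_trans H1 _.
apply: le_trans (lerD Ht (lexx _)) _.
have e1 : K * eta = 13 * (beta1 * (2 * n%:R * s1 * eta)) +
    24 * s * n%:R * eta + 2 * n%:R * eta by rewrite /K; ring.
have e2 : 2 * beta2 * (ln (2 * N%:R) / s2 + 2 * n%:R * s2) =
   beta2 * (2 * ln (2 * N%:R) / s2 + 4 * n%:R * s2) by ring.
rewrite e2 in Hrad; rewrite e1 in etaK.
lra.
Qed.

End EmpiricalProcess.

(** * Loss function and entropy *)

Section RealLemmas.
Variable R : realType.

Lemma mvt_derivable (f : R -> R) (a b : R) : (forall x, derivable f x 1) ->
  a <= b -> exists c, [/\ a <= c, c <= b & f b - f a = derive1 f c * (b - a)].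
Proof.
move=> df ab.
have [||c] := @MVT_segment R f (derive1 f) a b ab.
- by move=> x _; rewrite derive1E; apply: derivableP; exact: df.
- by apply: derivable_within_continuous => x _; exact: df.
by rewrite in_itv /= => /andP[ac cb] ->; exists c.
Qed.

Section SmoothConvex.
Variables (l : R -> R) (K : R).
Hypothesis dl : forall u, derivable l u 1.
Hypothesis dl2 : forall u, derivable (derive1 l) u 1.
Hypothesis l2K : forall u, `|derive1n 2 l u| <= K.

Lemma derive1_lip u v : `|derive1 l v - derive1 l u| <= K * `|v - u|.
Proof.
wlog uv : u v / u <= v.
  move=> H; case: (leP u v) => [|/ltW] /H //.
  by rewrite distrC [in leRHS]distrC.
have [c [_ _ ->]] := mvt_derivable dl2 uv.
by rewrite normrM; apply: ler_wpM2r => //; exact: (l2K c).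
Qed.

Lemma taylor1 u v : `|l v - l u - derive1 l u * (v - u)| <= K * (v - u) ^+ 2.
Proof.
have K0 : 0 <= K by apply: le_trans (l2K 0).
have [c [cu ->]] : exists c, `|c - u| <= `|v - u| /\ l v - l u = derive1 l c * (v - u).
  case: (leP u v) => uv.
    have [c [c1 c2 e]] := mvt_derivable dl uv; exists c; split=> //.
    by rewrite !ger0_norm ?subr_ge0 //; lra.
  have [c [c1 c2 e]] := mvt_derivable dl (ltW uv); exists c; split.
    by rewrite ![`|_ - u|]distrC !ger0_norm ?subr_ge0 ?(ltW uv) //; lra.
  by rewrite -[LHS]opprB e; ring.
rewrite -mulrBl normrM -(real_normK (num_real (v - u))) expr2 mulrA.
apply: ler_wpM2r => //; apply: le_trans (derive1_lip _ _) _.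
exact: ler_wpM2l.
Qed.

Lemma lip_on_unit (B : R) u v : `|derive1 l 0| <= B ->
  `|u| <= 1 -> `|v| <= 1 -> `|l u - l v| <= (B + K) * `|u - v|.
Proof.
move=> lB u1 v1; wlog uv : u v u1 v1 / v <= u.
  move=> H; case: (leP v u) => [|/ltW] vu; first exact: H.
  by rewrite (distrC (l u)) (distrC u); apply: H.
have K0 : 0 <= K by apply: le_trans (l2K 0).
have [c [c1 c2 ->]] := mvt_derivable dl uv.
rewrite normrM; apply: ler_wpM2r => //.
have c3 : `|c| <= 1.
  by move: u1 v1; rewrite !ler_norml => /andP[? ?] /andP[? ?]; apply/andP; split; lra.
have := derive1_lip 0 c; rewrite subr0 => h.
have h2 : K * `|c| <= K by rewrite ler_piMr.
rewrite -(subrK (derive1 l 0) (derive1 l c)).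
by apply: le_trans (ler_normD _ _) _; lra.
Qed.

(** Midpoint convexity of [phi], that is [l] minus a parabola of curvature [c]: the mean value
    slopes on the two halves of the segment are ordered. *)
Lemma strong_midpoint (c : R) u v : (forall w, `|w| <= 1 -> c <= derive1n 2 l w) ->
  `|u| <= 1 -> `|v| <= 1 ->
  l ((u + v) / 2) + c / 8 * (u - v) ^+ 2 <= (l u + l v) / 2.
Proof.
move=> lc u1 v1; wlog uv : u v u1 v1 / u <= v.
  move=> H; case: (leP u v) => [|/ltW] vu; first exact: H.
  by rewrite addrC [u + v]addrC [l u + _]addrC -[u - v]opprB sqrrN addrC; apply: H.
pose phi (x : R) : R := l x - c / 2 * x ^+ 2.
have dphi (x : R) : is_derive x (1 : R) phi (derive1 l x - c * x).
  have D1 : is_derive x (1 : R) l (derive1 l x).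
    by rewrite derive1E; apply: derivableP.
  rewrite /phi; apply: is_derive_eq.
  by rewrite /GRing.scale /=; field.
have dphi1 (x : R) : derivable phi x (1 : R) by case: (dphi x).
have dphiE (x : R) : derive1 phi x = derive1 l x - c * x.
  by rewrite derive1E; have [_ ->] := dphi x.
set m := (u + v) / 2.
have um : u <= m by rewrite /m; lra.
have mv : m <= v by rewrite /m; lra.
have [x1 [ux1 x1m e1]] := mvt_derivable dphi1 um.
have [x2 [mx2 x2v e2]] := mvt_derivable dphi1 mv.
have x12 : x1 <= x2 by apply: le_trans mx2.
have [w [x1w wx2 e3]] := mvt_derivable dl2 x12.
have w1 : `|w| <= 1.
  by move: u1 v1; rewrite !ler_norml => /andP[? ?] /andP[? ?]; apply/andP; split; lra.
have h1 : derive1 phi x1 <= derive1 phi x2.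
  rewrite !dphiE.
  have : c * (x2 - x1) <= derive1 (derive1 l) w * (x2 - x1).
    by rewrite ler_wpM2r ?subr_ge0 //; exact: lc.
  rewrite -e3; lra.
have h2 : phi m - phi u <= phi v - phi m.
  have -> : phi m - phi u = derive1 phi x1 * (v - m) by rewrite e1 /m; congr (_ * _); field.
  by rewrite e2 ler_wpM2r ?subr_ge0.
have h3 : phi m <= (phi u + phi v) / 2 by lra.
move: h3; rewrite /phi.
have -> : c / 8 * (u - v) ^+ 2 =
   (c / 2 * u ^+ 2 + c / 2 * v ^+ 2) / 2 - c / 2 * m ^+ 2 by rewrite /m; field.
lra.
Qed.

(** A sequential limit, from which [bdm_dloss] obtains joint measurability of the derivative of the
    loss. *)
Lemma cvg_difference_quotient u :
  (fun k => k.+1%:R * (l (u + k.+1%:R^-1) - l u)) @ \oo --> derive1 l u.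
Proof.
have K0 : 0 <= K by apply: le_trans (l2K 0).
apply/cvgrPdist_le => e e0.
have : (fun k => K * harmonic k) @ \oo --> (0 : R).
  by rewrite -(mulr0 K); apply: cvgMr; exact: cvg_harmonic.
move=> /cvgrPdist_le/(_ e e0); apply: filterS => k.
rewrite sub0r normrN => h; rewrite distrC.
have k0 : 0 < k.+1%:R :> R by rewrite ltr0n.
have := taylor1 u (u + k.+1%:R^-1).
rewrite [u + _ - u]addrAC subrr add0r => h2.
have -> : k.+1%:R * (l (u + k.+1%:R^-1) - l u) - derive1 l u =
    k.+1%:R * (l (u + k.+1%:R^-1) - l u - derive1 l u * k.+1%:R^-1).
  by field; rewrite gt_eqF.
rewrite normrM ger0_norm ?(ltW k0) //.
apply: le_trans (ler_wpM2l (ltW k0) h2) _.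
apply: le_trans h; apply: le_trans (ler_norm _).
rewrite /harmonic /= le_eqVlt; apply/orP; left; apply/eqP; field.
by rewrite gt_eqF.
Qed.

End SmoothConvex.

(** The tangent of x ln x at [m] lies below the graph, including at [x = 0], where it has the value
    [- m]. All entropy estimates reduce to it. *)
Lemma xlnx_tangent (x m : R) : 0 <= x -> 0 < m ->
  x * ln m + (x - m) <= x * ln x.
Proof.
move=> x0 m0; move: x0; rewrite le_eqVlt => /predU1P[<-|x0]; first by rewrite !mul0r; lra.
have : ln (m / x) <= m / x - 1.
  rewrite -{1}(subrK 1 (m / x)) addrC; apply: le_ln1Dx.
  by rewrite ltrBrDr addNr divr_gt0.
rewrite ln_div ?posrE // => /(ler_wpM2l (ltW x0)).
have -> : x * (m / x - 1) = m - x by field; rewrite gt_eqF.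
lra.
Qed.

Lemma xlnx_convex (a b t : R) : 0 <= a -> 0 <= b -> 0 <= t -> t <= 1 ->
  ((1 - t) * a + t * b) * ln ((1 - t) * a + t * b) <=
  (1 - t) * (a * ln a) + t * (b * ln b).
Proof.
move=> a0 b0 t0 t1; have t1' : 0 <= 1 - t by lra.
set m := (1 - t) * a + t * b.
have : 0 <= m by rewrite addr_ge0 // mulr_ge0.
rewrite le_eqVlt => /predU1P[m0|m0].
  rewrite -m0 mul0r.
  have h1 : (1 - t) * a = 0.
    by apply/eqP; rewrite eq_le mulr_ge0 // andbT {1}m0 lerDl mulr_ge0.
  have h2 : t * b = 0.
    by apply/eqP; rewrite eq_le mulr_ge0 // andbT {1}m0 lerDr mulr_ge0.
  by rewrite !mulrA h1 h2 !mul0r addr0.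
have h1 := ler_wpM2l t1' (xlnx_tangent a0 m0).
have h2 := ler_wpM2l t0 (xlnx_tangent b0 m0).
have -> : m * ln m = (1 - t) * (a * ln m + (a - m)) + t * (b * ln m + (b - m)).
  rewrite /m; ring.
lra.
Qed.

(* The right-hand side is twice a coordinate of the Jensen-Shannon
   divergence; the constant 100 has no significance. *)
Lemma xlnx_midpoint_gap (a b : R) : 0 <= a -> 0 <= b ->
  Num.max 0 (b - 100 * a) / 4 <=
  a * ln a + b * ln b - (a + b) * ln ((a + b) / 2).
Proof.
move=> a0 b0.
have [h|h] := leP (b - 100 * a) 0.
  rewrite mul0r subr_ge0.
  have := @xlnx_convex a b 2^-1 a0 b0; rewrite invr_ge0 ler0n => /(_ isT).
  rewrite (_ : 2^-1 <= 1 = true) => [/(_ isT)|]; last by apply/idP; lra.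
  have -> : (1 - 2^-1) * a + 2^-1 * b = (a + b) / 2 by field.
  lra.
have b1 : 0 < b by lra.
set m := (a + b) / 2; have m0 : 0 < m by rewrite /m; lra.
have m8 : 0 < m / 8 by lra.
have m2 : 0 < m * 2 by lra.
(* When [a] is far below [b], the mean [m] is about [b / 2]. Tangents at [m / 8] and [2 * m] then
   gain about [b * ln 2], at a cost of order [a] plus [(a + b) / 16]. *)
have ha := xlnx_tangent a0 m8; have hb := xlnx_tangent b0 m2.
rewrite ln_div ?posrE // in ha; rewrite lnM ?posrE // in hb.
have l2 : 2^-1 <= ln (2 : R).
  have : ln (2^-1 : R) <= - 2^-1.
    have -> : (2^-1 : R) = 1 + (- 2^-1) by lra.
    by apply: le_trans (le_ln1Dx _) _; lra.
  by rewrite lnV ?posrE //; lra.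
have l8 : ln (8 : R) <= 7.
  have -> : (8 : R) = 1 + 7 by lra.
  by apply: le_ln1Dx; lra.
have := ler_wpM2l b0 l2; have := ler_wpM2l a0 l8.
rewrite /m in ha hb *; lra.
Qed.

End RealLemmas.

(** * Orthonormal systems of bounded functions *)

Section BoundedL2.
Context (R : realType) (d : measure_display) (E : measurableType d)
  (Q : probability E R).
Implicit Types f g : E -> R.

Lemma mean_ae_eq f g : bdm f -> bdm g -> (\forall x \ae Q, f x = g x) ->
  mean Q f = mean Q g.
Proof.
move=> [mf _] [mg _] fg; rewrite /mean /Rintegral; congr fine.
apply: ae_eq_integral => //; [exact/measurable_EFinP|exact/measurable_EFinP|].
by apply: filterS fg => x /= -> _.
Qed.

Lemma ae_eq0_of_mean_sqr f : bdm f -> mean Q (fun x => f x ^+ 2) = 0 ->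
  \forall x \ae Q, f x = 0.
Proof.
move=> bf h; have bf2 := bdm_sqr bf.
have : (\int[Q]_x `|(f x ^+ 2)%:E| = 0)%E.
  under eq_integral => x _ do rewrite abse_EFin ger0_norm ?sqr_ge0 //.
  by rewrite mean_EFin // h.
move=> /ae_eq_integral_abs => /(_ measurableT) H.
have /H : measurable_fun setT (fun x => (f x ^+ 2)%:E).
  by apply/measurable_EFinP; case: bf2.
apply: filterS => x /= /(_ I) [] /eqP; by rewrite sqrf_eq0 => /eqP.
Qed.

Lemma mean_cauchy_schwarz f g : bdm f -> bdm g ->
  mean Q (fun x => f x * g x) <=
  Num.sqrt (mean Q (fun x => f x ^+ 2)) * Num.sqrt (mean Q (fun x => g x ^+ 2)).
Proof.
move=> bf bg; set a := mean Q (fun x => f x ^+ 2); set b := mean Q (fun x => g x ^+ 2).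
set c := mean Q _.
have a0 : 0 <= a by apply: mean_ge0 => x; apply: sqr_ge0.
have b0 : 0 <= b by apply: mean_ge0 => x; apply: sqr_ge0.
have quad (t : R) : 0 <= a - 2 * t * c + t ^+ 2 * b.
  have : 0 <= mean Q (fun x => (f x - t * g x) ^+ 2).
    by apply: mean_ge0 => x; apply: sqr_ge0.
  rewrite (@mean_ext _ _ _ _ _ (fun x =>
    f x ^+ 2 - (2 * t) * (f x * g x) + t ^+ 2 * g x ^+ 2)); last by move=> x; ring.
  have b1 := bdm_sqr bf; have b2 := bdmM bf bg; have b3 := bdm_sqr bg.
  rewrite meanD; [|exact/bdmB/bdmZ|exact: bdmZ].
  by rewrite meanB ?meanZ //; exact: bdmZ.
have h : c ^+ 2 <= a * b.
  move: b0; rewrite le_eqVlt => /predU1P[b0|b0].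
    have [->|c0] := eqVneq c 0; first by rewrite expr0n /= -b0 mulr0.
    (* With [b = 0] the form is affine in [t]; at this [t] it would equal -1. *)
    have := quad ((a + 1) / (2 * c)); rewrite -b0 mulr0 addr0.
    have -> : 2 * ((a + 1) / (2 * c)) * c = a + 1 by field.
    lra.
  have := quad (c / b).
  have -> : a - 2 * (c / b) * c + (c / b) ^+ 2 * b = a - c ^+ 2 / b.
    by field; rewrite gt_eqF.
  by rewrite subr_ge0 ler_pdivrMr.
rewrite -sqrtrM //; apply: le_trans (ler_norm _) _.
by rewrite -sqrtr_sqr ler_sqrt // mulr_ge0.
Qed.

Lemma mean_minkowski f g : bdm f -> bdm g ->
  Num.sqrt (mean Q (fun x => (f x + g x) ^+ 2)) <=
  Num.sqrt (mean Q (fun x => f x ^+ 2)) + Num.sqrt (mean Q (fun x => g x ^+ 2)).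
Proof.
move=> bf bg; have h := mean_cauchy_schwarz bf bg.
set a := mean Q (fun x => f x ^+ 2) in h *; set b := mean Q (fun x => g x ^+ 2) in h *.
have a0 : 0 <= a by apply: mean_ge0 => x; apply: sqr_ge0.
have b0 : 0 <= b by apply: mean_ge0 => x; apply: sqr_ge0.
rewrite -[leRHS]ger0_norm ?addr_ge0 ?sqrtr_ge0 // -sqrtr_sqr.
rewrite ler_wsqrtr // sqrrD !sqr_sqrtr //.
rewrite (@mean_ext _ _ _ _ _ (fun x =>
    f x ^+ 2 + 2 * (f x * g x) + g x ^+ 2)); last by move=> x; ring.
have b1 := bdm_sqr bf; have b2 := bdmM bf bg; have b3 := bdm_sqr bg.
rewrite meanD //; last by apply/bdmD/bdmZ.
rewrite meanD ?meanZ //; last exact: bdmZ.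
by rewrite -/a -/b -mulr_natl; lra.
Qed.

Lemma L2norm_integrable f : measurable_fun setT f ->
  Q.-integrable setT (EFin \o (fun x => f x ^+ 2)) ->
  L2norm Q f = (Num.sqrt (mean Q (fun x => f x ^+ 2)))%:E.
Proof.
move=> mf int2; rewrite /L2norm unlock /=.
have -> : (\int[Q]_x `|(EFin \o f) x| `^ 2 = (mean Q (fun x => f x ^+ 2))%:E)%E.
  rewrite /mean /Rintegral fineK; last first.
    exact: (integrable_fin_num _ int2).
  apply: eq_integral => x _ /=.
  by rewrite powR_mulrn // real_normK ?num_real.
rewrite /= powR12_sqrt //; apply: mean_ge0 => x; exact: sqr_ge0.
Qed.

Lemma L2norm_bdm f : bdm f ->
  L2norm Q f = (Num.sqrt (mean Q (fun x => f x ^+ 2)))%:E.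
Proof.
by move=> bf; apply: L2norm_integrable; [case: bf|apply/bdm_integrable/bdm_sqr].
Qed.

Lemma bdm_Lfun f : bdm f -> f \in Lfun Q 2%:E.
Proof.
move=> bf; rewrite inE; apply/andP; split; first by rewrite inE /=; case: bf.
rewrite inE /= /finite_norm -/(L2norm Q f) L2norm_bdm //.
by rewrite ltry.
Qed.

Lemma Linfnorm_ae f (M : R) : (Linfnorm Q f <= M%:E)%E ->
  \forall x \ae Q, `|f x| <= M.
Proof.
rewrite /Linfnorm unlock /=.
have -> : (0 < Q setT)%E by rewrite probability_setT lte01.
by move=> /ess_supP; apply: filterS => x /=; rewrite lee_fin.
Qed.

Definition coef (e : nat -> E -> R) f k : R := mean Q (fun x => f x * e k x).

Definition residual (e : nat -> E -> R) n f : E -> R :=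
  fun x => f x - \sum_(k < n) coef e f k * e k x.

Definition orthonormal (e : nat -> E -> R) n : Prop :=
  (forall k, (k < n)%N -> bdm (e k)) /\
  forall k l, (k < n)%N -> (l < n)%N ->
    mean Q (fun x => e k x * e l x) = (k == l)%:R.

Lemma bdm_lin (e : nat -> E -> R) n (c : nat -> R) :
  (forall k, (k < n)%N -> bdm (e k)) ->
  bdm (fun x => \sum_(k < n) c k * e k x).
Proof. by move=> be; apply: bdm_sum => k; apply/bdmZ/be. Qed.

Lemma mean_lin_mul (e : nat -> E -> R) n (c : nat -> R) g :
  (forall k, (k < n)%N -> bdm (e k)) -> bdm g ->
  mean Q (fun x => (\sum_(k < n) c k * e k x) * g x) =
  \sum_(k < n) c k * mean Q (fun x => e k x * g x).
Proof.
move=> be bg.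
rewrite (@mean_ext _ _ _ _ _ (fun x => \sum_(k < n) c k * (e k x * g x))).
  rewrite mean_sum; last by move=> k; apply/bdmZ/bdmM => //; apply: be.
  by apply: eq_bigr => k _; rewrite meanZ //; apply: bdmM => //; apply: be.
by move=> x; rewrite mulr_suml; apply: eq_bigr => k _; rewrite mulrA.
Qed.

Lemma residual_bdm e n f : orthonormal e n -> bdm f -> bdm (residual e n f).
Proof. by move=> [be _] bf; apply: bdmB => //; apply: bdm_lin. Qed.

Lemma residual_orth e n f l : orthonormal e n -> bdm f -> (l < n)%N ->
  mean Q (fun x => residual e n f x * e l x) = 0.
Proof.
move=> oe bf ln; have [be orth] := oe.
rewrite (@mean_ext _ _ _ _ _ (fun x => f x * e l x -
   (\sum_(k < n) coef e f k * e k x) * e l x)); last by move=> x; rewrite mulrBl.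
rewrite meanB; [|exact/bdmM/be|by apply/bdmM/be => //; apply: bdm_lin].
rewrite mean_lin_mul //; last exact: be.
rewrite (bigD1 (Ordinal ln)) //= orth // eqxx mulr1 big1 ?addr0 ?subrr //.
move=> k kl; rewrite orth // (_ : (k == l :> nat) = false) ?mulr0 //.
by apply/negbTE; apply: contra kl => /eqP kl; apply/eqP/val_inj.
Qed.

Lemma mean_residual_sqr e n f : orthonormal e n -> bdm f ->
  mean Q (fun x => residual e n f x ^+ 2) =
  mean Q (fun x => f x ^+ 2) - \sum_(k < n) coef e f k ^+ 2.
Proof.
move=> oe bf; have [be orth] := oe; have br := residual_bdm oe bf.
have E1 : mean Q (fun x => residual e n f x ^+ 2) =
    mean Q (fun x => residual e n f x * f x).
  rewrite (@mean_ext _ _ _ _ (fun x => residual e n f x ^+ 2) (fun x =>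
    residual e n f x * f x -
     (\sum_(k < n) coef e f k * e k x) * residual e n f x)); last first.
    by move=> x; rewrite expr2 {1}/residual mulrBl [f x * _]mulrC.
  rewrite meanB; [|exact: bdmM|by apply: bdmM => //; apply: bdm_lin].
  rewrite mean_lin_mul // big1 ?subr0 // => k _.
  rewrite (@mean_ext _ _ _ _ _ (fun x => residual e n f x * e k x)).
    by rewrite residual_orth ?mulr0.
  by move=> x; rewrite mulrC.
rewrite E1 (@mean_ext _ _ _ _ _ (fun x => f x ^+ 2 -
   (\sum_(k < n) coef e f k * e k x) * f x)); last first.
  by move=> x; rewrite /residual; ring.
rewrite meanB; [|exact: bdm_sqr|by apply: bdmM => //; apply: bdm_lin].
rewrite mean_lin_mul //; congr (_ - _); apply: eq_bigr => k _.
by rewrite expr2; congr (_ * _); apply: mean_ext => x; rewrite mulrC.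
Qed.

Lemma bessel e n f : orthonormal e n -> bdm f ->
  \sum_(k < n) coef e f k ^+ 2 <= mean Q (fun x => f x ^+ 2).
Proof.
move=> oe bf; rewrite -subr_ge0 -mean_residual_sqr //.
by apply: mean_ge0 => x; apply: sqr_ge0.
Qed.

Lemma mean_proj_sqr e n f : orthonormal e n -> bdm f ->
  mean Q (fun x => (\sum_(k < n) coef e f k * e k x) ^+ 2) =
  \sum_(k < n) coef e f k ^+ 2.
Proof.
move=> oe bf; have [be orth] := oe; have br := residual_bdm oe bf.
have bp : bdm (fun x => \sum_(k < n) coef e f k * e k x) by exact: bdm_lin.
rewrite (@mean_ext _ _ _ _ _ (fun x =>
    (\sum_(k < n) coef e f k * e k x) * f x -
    (\sum_(k < n) coef e f k * e k x) * residual e n f x)); last first.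
  by move=> x; rewrite -mulrBr /residual subKr expr2.
rewrite meanB; [|exact: bdmM|exact: bdmM].
rewrite !mean_lin_mul // [X in _ - X]big1 ?subr0 => [|k _].
  apply: eq_bigr => k _; rewrite expr2; congr (_ * _).
  by apply: mean_ext => x; rewrite mulrC.
rewrite (@mean_ext _ _ _ _ _ (fun x => residual e n f x * e k x)).
  by rewrite residual_orth ?mulr0.
by move=> x; rewrite mulrC.
Qed.

(** A function whose residual has norm 0 adds no new element, so dependent families are allowed and
    [n] may be smaller than [m]. The clause on [L] records that the [e k] are linear combinations of
    the [phi j] pointwise, not only almost everywhere. *)
Lemma gram_schmidt m (phi : nat -> E -> R) :
  (forall j, (j < m)%N -> bdm (phi j)) ->
  exists n e, [/\ (n <= m)%N, orthonormal e n,
    forall L : set (E -> R), L (fun=> 0) ->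
      (forall a f g, L f -> L g -> L (fun x => a * f x + g x)) ->
      (forall j, (j < m)%N -> L (phi j)) -> forall k, (k < n)%N -> L (e k) &
    forall j, (j < m)%N -> mean Q (fun x => residual e n (phi j) x ^+ 2) = 0].
Proof.
elim: m => [|m IH] bphi; first by exists 0%N, phi; split.
have [n [e [nm oe span res]]] := IH (fun j jm => bphi j (ltnW jm)).
have [be orth] := oe; have bm := bphi m (ltnSn m).
set r := residual e n (phi m); have br : bdm r by exact: residual_bdm.
set v := mean Q (fun x => r x ^+ 2).
have v0 : 0 <= v by apply: mean_ge0 => x; apply: sqr_ge0.
move: v0; rewrite le_eqVlt => /predU1P[v0|v0].
  exists n, e; split=> //; first exact: leqW.
    by move=> L L0 LD Lphi; apply: span => // j jm; apply/Lphi/ltnW.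
  move=> j; rewrite ltnS leq_eqVlt => /predU1P[->|]; first by rewrite -/r -/v.
  exact: res.
pose w x := (Num.sqrt v)^-1 * r x.
pose e' k := if (k < n)%N then e k else w.
have e'E k : (k < n)%N -> e' k = e k by move=> kn; rewrite /e' kn.
have e'n : e' n = w by rewrite /e' ltnn.
have sv0 : 0 < Num.sqrt v by rewrite sqrtr_gt0.
have bw : bdm w by exact: bdmZ.
have ww : mean Q (fun x => w x * w x) = 1.
  rewrite (@mean_ext _ _ _ _ _ (fun x => v^-1 * r x ^+ 2)).
    by rewrite meanZ ?mulVf ?gt_eqF //; apply: bdm_sqr.
  move=> x; rewrite /w mulrACA -invfM -!expr2 sqr_sqrtr // ltW //.
have we k : (k < n)%N -> mean Q (fun x => w x * e k x) = 0.
  move=> kn; rewrite (@mean_ext _ _ _ _ _ (fun x => (Num.sqrt v)^-1 * (r x * e k x))).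
    by rewrite meanZ ?residual_orth ?mulr0 //; apply: bdmM => //; apply: be.
  by move=> x; rewrite /w mulrA.
have oe' : orthonormal e' n.+1.
  split=> [k|k l]; rewrite !ltnS.
    rewrite leq_eqVlt => /predU1P[->|kn]; first by rewrite e'n.
    by rewrite e'E //; apply: be.
  rewrite leq_eqVlt => /predU1P[->|kn]; rewrite leq_eqVlt => /predU1P[->|ln].
  - by rewrite e'n eqxx.
  - by rewrite e'n e'E // we // gtn_eqF.
  - rewrite e'n e'E // ltn_eqF //= -[RHS](we _ kn).
    by apply: mean_ext => x; rewrite mulrC.
  - by rewrite !e'E // orth.
have res' f x : residual e' n.+1 f x = residual e n f x - coef e' f n * w x.
  rewrite /residual big_ord_recr /= opprD addrA e'n; congr (_ - _ - _).
  by apply: eq_bigr => k _; rewrite /coef e'E.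
exists n.+1, e'; split=> //.
- move=> L L0 LD Lphi k; rewrite ltnS leq_eqVlt => /predU1P[->|kn]; last first.
    by rewrite e'E //; apply: span => // j jm; apply/Lphi/ltnW.
  have Le l : (l < n)%N -> L (e l).
    by move=> ln; apply: span => // j jm; apply/Lphi/ltnW.
  have Lsum l : (l <= n)%N ->
      L (fun x => \sum_(k < l) (- coef e (phi m) k) * e k x).
    elim: l => [|l IHl] ln.
      by under eq_fun do rewrite big_ord0.
    under eq_fun do rewrite big_ord_recr /= addrC.
    by apply: (LD); [exact: Le|exact/IHl/ltnW].
  rewrite e'n (_ : w = fun x => (Num.sqrt v)^-1 * r x + 0).
    apply: (LD) => //; rewrite (_ : r = fun x => 1 * phi m x +
        \sum_(k < n) (- coef e (phi m) k) * e k x).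
      by apply: (LD); [exact: Lphi|exact: Lsum].
    apply/funext => x; rewrite mul1r /r /residual -sumrN; congr (_ + _).
    by apply: eq_bigr => i _; rewrite mulNr.
  by apply/funext => x; rewrite addr0.
- move=> j; rewrite ltnS leq_eqVlt => /predU1P[->|jm].
    have cE : coef e' (phi m) n = Num.sqrt v.
      rewrite /coef e'n.
      rewrite (@mean_ext _ _ _ _ _ (fun x => Num.sqrt v * (w x * w x) +
         (\sum_(k < n) coef e (phi m) k * e k x) * w x)).
        rewrite meanD; [|exact/bdmZ/bdmM|by apply: bdmM => //; apply: bdm_lin].
        rewrite meanZ ?ww ?mulr1; last exact: bdmM.
        rewrite mean_lin_mul // big1 ?addr0 // => k _.
        rewrite (@mean_ext _ _ _ _ _ (fun x => w x * e k x)) ?we ?mulr0 //.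
        by move=> x; rewrite mulrC.
      move=> x; rewrite [Num.sqrt v * _]mulrA (_ : Num.sqrt v * w x = r x).
        by rewrite -mulrDl /r /residual subrK.
      by rewrite /w mulrA mulfV ?mul1r // gt_eqF.
    rewrite (@mean_ext _ _ _ _ _ (fun=> 0)) ?mean_cst // => x.
    rewrite res' cE /w mulrA mulfV ?gt_eqF // mul1r -/r subrr.
    by rewrite expr0n.
  have rj := res j jm; have bj := bphi j (ltnW jm).
  have := mean_residual_sqr oe' bj; rewrite big_ord_recr /=.
  rewrite (eq_bigr (fun k : 'I_n => coef e (phi j) k ^+ 2)); last first.
    by move=> k _; rewrite /coef e'E.
  rewrite addrC opprD addrA [_ - _ - _]addrAC -mean_residual_sqr // rj add0r => h.
  have h1 : 0 <= mean Q (fun x => residual e' n.+1 (phi j) x ^+ 2).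
    by apply: mean_ge0 => x; apply: sqr_ge0.
  by apply/eqP; rewrite eq_le h1 andbT h oppr_le0 sqr_ge0.
Qed.

End BoundedL2.

(** * Localization and the deviation bound *)

Section PathArgument.
Variable R : realType.

(** [phi] has the form that [gap] takes along a segment starting at [lam]; the level comes from the
    intermediate value theorem. *)
Lemma exists_level (A B : R) (I : finType) (P : pred I) (a b : I -> R) (r : R) :
  let phi t := A * t ^+ 2 + B * \sum_(j | P j) Num.max 0 (t * a j - b j) in
  phi 0 <= r -> r <= phi 1 -> exists t, [/\ 0 <= t, t <= 1 & phi t = r].
Proof.
move=> phi h0 h1.
have cphi : continuous (phi : R -> R).
  move=> t; rewrite /phi.
  apply: cvgD.
    by apply: cvgM; [exact: cvg_cst|exact: exprn_continuous].
  apply: cvgM; first exact: cvg_cst.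
  elim: (index_enum I) => [|j s IH].
    by rewrite big_nil; under eq_fun do rewrite big_nil; exact: cvg_cst.
  rewrite big_cons; under eq_fun do rewrite big_cons.
  case: (P j) => //; apply: cvgD => //.
  rewrite maxr_absE; under eq_fun do rewrite maxr_absE.
  have lin : (fun x : R => x * a j - b j) @ t --> t * a j - b j.
    by apply: cvgB; [apply: cvgM; [exact: cvg_id|exact: cvg_cst]|exact: cvg_cst].
  apply: cvgM; last exact: cvg_cst.
  apply: cvgD; first by apply: cvgD => //; exact: cvg_cst.
  by apply: cvg_norm; apply: cvgB => //; exact: cvg_cst.
have [|||c] := @IVT R phi 0 1 r.
- exact: ler01.
- exact: continuous_subspaceT.
- by rewrite ge_min h0 le_max h1 orbT.
by rewrite in_itv /= => /andP[c0 c1] <-; exists c.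
Qed.

End PathArgument.

Section Simplex.
Variables (R : realType) (N : nat).
Implicit Types lam : 'rV[R]_N.

Lemma lin_combD (X : Type) (h : 'I_N -> X -> R) a b lam lam' x :
  lin_comb h (a *: lam + b *: lam') x =
  a * lin_comb h lam x + b * lin_comb h lam' x.
Proof.
rewrite /lin_comb !mulr_sumr -big_split /=; apply: eq_bigr => j _.
by rewrite !mxE; ring.
Qed.

Lemma simplex_conv lam lam' t : simplex lam -> simplex lam' ->
  0 <= t -> t <= 1 -> simplex ((1 - t) *: lam + t *: lam').
Proof.
move=> [l0 l1] [l0' l1'] t0 t1; split=> [j|].
  by rewrite !mxE addr_ge0 // mulr_ge0 // subr_ge0.
under eq_bigr do rewrite !mxE.
by rewrite big_split /= -!mulr_sumr l1 l1' !mulr1 subrK.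
Qed.

Lemma simplex_le1 lam j : simplex lam -> lam ord0 j <= 1.
Proof.
by move=> [l0 <-]; rewrite (bigD1 j) //= lerDl sumr_ge0.
Qed.

Lemma lin_comb_le1 (X : Type) (h : 'I_N -> X -> R) lam x :
  (forall j x, `|h j x| <= 1) -> simplex lam -> `|lin_comb h lam x| <= 1.
Proof.
move=> h1 [l0 l1]; rewrite /lin_comb -l1.
apply: le_trans (ler_norm_sum _ _ _) _; apply: ler_sum => j _.
by rewrite normrM (ger0_norm (l0 j)) ler_piMr.
Qed.

Lemma neg_entropy_conv lam lam' t : simplex lam -> simplex lam' ->
  0 <= t -> t <= 1 ->
  neg_entropy ((1 - t) *: lam + t *: lam') <=
  (1 - t) * neg_entropy lam + t * neg_entropy lam'.
Proof.
move=> [l0 _] [l0' _] t0 t1; rewrite /neg_entropy !mulr_sumr -big_split /=.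
by apply: ler_sum => j _; rewrite !mxE; apply: xlnx_convex.
Qed.

Lemma neg_entropy_midpoint lam lam' (J : {set 'I_N}) :
  simplex lam -> simplex lam' ->
  neg_entropy (2^-1 *: lam + 2^-1 *: lam') +
    8^-1 * \sum_(j | j \notin J) Num.max 0 (lam' ord0 j - 100 * lam ord0 j) <=
  2^-1 * neg_entropy lam + 2^-1 * neg_entropy lam'.
Proof.
move=> [l0 _] [l0' _]; rewrite /neg_entropy !mulr_sumr -big_split /=.
rewrite [X in _ + X <= _]big_mkcond /= -big_split /=.
apply: ler_sum => j _; rewrite !mxE.
have h := xlnx_midpoint_gap (l0 j) (l0' j).
have -> : 2^-1 * lam ord0 j + 2^-1 * lam' ord0 j =
   (lam ord0 j + lam' ord0 j) / 2 by field.
have m0 : 0 <= Num.max 0 (lam' ord0 j - 100 * lam ord0 j).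
  by rewrite le_max lexx.
by case: ifP => _; lra.
Qed.

End Simplex.

(** * Numerical constants and the closing of the deviation bound *)

Section Constants.
Variables (R : realType) (L tau0 : R).
Hypotheses (L0 : 0 < L) (tau0_gt0 : 0 < tau0).

(** [step_size] is the [s] of [concentration]: [6^-1] is imposed there, and the other bound reduces
    the variance term to [r / 8]. An eighth of [rate_const] dominates every coefficient in
    [rate_terms_le]. With [eps_const], the terms in [r / eps] add up to [1040 / 10 ^+ 4 * r], so
    everything fits into [r / 2]. *)
Definition step_size : R := Num.min 6^-1 (tau0 / (10 ^+ 3 * L)).
Definition rate_const : R :=
  8 * (10 ^+ 5 * L ^+ 2 / tau0 + 10 ^+ 5 * L + 2 * L / step_size).
Definition eps_const : R := 10 ^+ 4 * L.

Lemma step_size_gt0 : 0 < step_size.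
Proof.
rewrite /step_size lt_min invr_gt0 ltr0n /=.
by apply: divr_gt0 => //; apply: mulr_gt0 => //; apply: exprn_gt0.
Qed.

Lemma rate_const_gt0 : 0 < rate_const.
Proof.
have s0 := step_size_gt0; have c0 : 0 < 10 :> R by [].
apply: mulr_gt0 => //; apply: addr_gt0; first apply: addr_gt0.
- by apply: divr_gt0 => //; apply: mulr_gt0; apply: exprn_gt0.
- by apply: mulr_gt0 => //; apply: exprn_gt0.
- by apply: divr_gt0 => //; apply: mulr_gt0.
Qed.

Lemma rate_terms_le (t2 k ul mq sq q2 : R) : 0 <= t2 -> 0 <= k -> 0 <= ul ->
  0 <= mq -> 0 <= sq -> 0 <= q2 ->
  104 ^+ 2 * L ^+ 2 / tau0 * t2 + 52 * 101 * L * k + 26 * 24 * L * ul +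
    208 * L * mq + 208 * 101 * L * sq + 2 * L / step_size * q2 <=
  rate_const * (t2 + k + ul + mq + sq + q2) / 8.
Proof.
move=> t20 k0 ul0 mq0 sq0 q20.
have s0 := step_size_gt0; have L0' := ltW L0.
pose c : R := 10 ^+ 5.
have h1 : 104 ^+ 2 <= c by rewrite /c; lra.
have h2 : 208 * 101 <= c by rewrite /c; lra.
pose a1 := L ^+ 2 / tau0; pose a2 := 2 * L / step_size.
have a10 : 0 <= a1 by rewrite divr_ge0 ?(ltW tau0_gt0) // sqr_ge0.
have a20 : 0 <= a2 by rewrite divr_ge0 ?(ltW s0) // mulr_ge0.
have KE : rate_const / 8 = c * a1 + c * L + a2.
  by rewrite /rate_const -/c /a1 /a2; field; rewrite !gt_eqF.
have c0 : 0 <= c by apply: exprn_ge0.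
have ca1 : 0 <= c * a1 by rewrite mulr_ge0.
have cL : 0 <= c * L by rewrite mulr_ge0.
have k1 : 104 ^+ 2 * a1 <= rate_const / 8.
  by rewrite KE; apply: le_trans (ler_wpM2r a10 h1) _; rewrite -addrA lerDl addr_ge0.
have k2 : a2 <= rate_const / 8 by rewrite KE lerDr addr_ge0.
have k3 : 208 * 101 * L <= rate_const / 8.
  rewrite KE; apply: le_trans (ler_wpM2r L0' h2) _.
  by rewrite addrAC lerDr addr_ge0.
have k4 : 52 * 101 * L <= rate_const / 8.
  by apply: le_trans k3; apply: ler_wpM2r => //; lra.
have k5 : 26 * 24 * L <= rate_const / 8.
  by apply: le_trans k3; apply: ler_wpM2r => //; lra.
have k6 : 208 * L <= rate_const / 8.
  by apply: le_trans k3; apply: ler_wpM2r => //; lra.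
have k1' : 104 ^+ 2 * L ^+ 2 / tau0 <= rate_const / 8 by rewrite -mulrA.
have r1 := ler_wpM2r t20 k1'; have r2 := ler_wpM2r q20 k2.
have r3 := ler_wpM2r sq0 k3; have r4 := ler_wpM2r k0 k4.
have r5 := ler_wpM2r ul0 k5; have r6 := ler_wpM2r mq0 k6.
rewrite -/a2; clear -r1 r2 r3 r4 r5 r6.
set x1 := 104 ^+ 2 * _ / _ * _ in r1 *; set x2 := a2 * _ in r2 *.
set x3 := 208 * 101 * _ * _ in r3 *; set x4 := 52 * 101 * _ * _ in r4 *.
set x5 := 26 * 24 * _ * _ in r5 *; set x6 := 208 * L * mq in r6 *.
lra.
Qed.

(* [n], [d] are the sample size and the dimension, [l = ln N], [l2N = ln (2 * N)],
   [t ^+ 2 = d / n], [al ^+ 2 = l / n], [q ^+ 2 = A * l / n]; the left-hand side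
   is the bound of [uniform_deviation] at the level [rate_const * rate]. *)
Lemma deviation_le (n d l2N l t al q U m kappa sJ eps Delta rate : R) :
  0 < n -> 0 < l -> l2N <= 2 * l ->
  0 <= t -> n * t = Num.sqrt (n * d) -> 0 < al -> n * al ^+ 2 = l -> al <= q ->
  1 <= U -> 0 <= m -> 0 <= kappa -> 0 <= sJ -> 0 < eps ->
  eps_const * q <= eps -> eps_const * (kappa * t) <= eps ->
  rate = t ^+ 2 + q ^+ 2 + (sJ + m) * q + U * l / n + kappa * sJ * t ->
  Delta = 101 * sJ + 4 * (rate_const * rate) / eps ->
  2 * L / n * (13 * (2 * (Num.sqrt (2 * (rate_const * rate) / tau0) +
        kappa * Delta) * Num.sqrt (n * d) +
     (2 * (l2N / (2 * U + m / al)^-1 + 2 * n * (2 * U + m / al)^-1 * m ^+ 2) +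
      Num.min 2 Delta *
        (2 * l2N / (2 * U + al^-1)^-1 + 4 * n * (2 * U + al^-1)^-1))) +
     24 * step_size * n * (rate_const * rate / (2 * tau0)) +
     n * q ^+ 2 / step_size) <= rate_const * rate / 2.
Proof.
move=> n0 l0 hl2 t0 ht al0 hal alq U1 m0 ka0 sJ0 eps0 hq hkt rateE DeltaE.
have s0 := step_size_gt0; have K0 := rate_const_gt0.
set s := step_size in s0 *; set K := rate_const in K0 DeltaE *.
have q0 : 0 < q by apply: lt_le_trans alq.
have U0 : 0 < U by lra.
have D0 : 0 < eps_const by apply: mulr_gt0 => //; apply: exprn_gt0.
have Uln0 : 0 < U * l / n by rewrite divr_gt0 // mulr_gt0.
have p1 : 0 <= t ^+ 2 by exact: sqr_ge0.
have p2 : 0 <= q ^+ 2 by exact: sqr_ge0.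
have p3 : 0 <= sJ * q by rewrite mulr_ge0 // ltW.
have p4 : 0 <= m * q by rewrite mulr_ge0 // ltW.
have p5 : 0 <= kappa * sJ * t by rewrite mulr_ge0 // mulr_ge0.
have rate0 : 0 < rate by rewrite rateE; lra.
set r := K * rate in DeltaE *.
have r0 : 0 < r by rewrite mulr_gt0.
have Delta0 : 0 <= Delta.
  rewrite DeltaE; apply: addr_ge0; first exact: mulr_ge0.
  apply: divr_ge0; last exact: ltW.
  by apply: mulr_ge0 => //; exact: ltW.
have nal : n * al = l / al by rewrite -hal; field; rewrite gt_eqF.
(* Reciprocals of the tuning parameters of the two maximal inequalities. The values [al / m] and
   [al] balance the logarithmic and the variance term; the summand [2 * U] enforces the restriction
   by the uniform bound. *)
pose i1 := 2 * U + m / al; pose i2 := 2 * U + al^-1.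
have mal0 : 0 <= m / al by rewrite divr_ge0 // ltW.
have i10 : 0 < i1 by rewrite /i1; lra.
have ali0 : 0 < al^-1 by rewrite invr_gt0.
have i20 : 0 < i2 by rewrite /i2; lra.
have b1 : l2N * i1 <= 4 * (U * l) + 2 * (m * (n * al)).
  apply: le_trans (ler_wpM2r (ltW i10) hl2) _; rewrite nal /i1.
  have -> : 2 * l * (2 * U + m / al) = 4 * (U * l) + 2 * (m * (l / al)) by ring.
  by [].
have b2 : 2 * n * i1^-1 * m ^+ 2 <= 2 * (m * (n * al)).
  have h : i1^-1 * m <= al.
    rewrite mulrC ler_pdivrMr // /i1.
    have -> : al * (2 * U + m / al) = 2 * (al * U) + m by field; rewrite gt_eqF.
    by rewrite lerDr mulr_ge0 // mulr_ge0 // ltW.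
  have -> : 2 * n * i1^-1 * m ^+ 2 = 2 * n * m * (i1^-1 * m) by ring.
  have -> : 2 * (m * (n * al)) = 2 * n * m * al by ring.
  by apply: ler_wpM2l => //; rewrite mulr_ge0 // mulr_ge0 // ltW.
have b3 : 2 * l2N * i2 <= 8 * (U * l) + 4 * (n * al).
  have := ler_wpM2r (ltW i20) hl2; rewrite nal /i2.
  have -> : 2 * l * (2 * U + al^-1) = 4 * (U * l) + 2 * (l / al) by ring.
  lra.
have b4 : 4 * n * i2^-1 <= 4 * (n * al).
  rewrite -mulrA ler_pM2l // ler_pM2l // -[leRHS]invrK lef_pV2 ?posrE //.
  by rewrite /i2; lra.
have Ul0 : 0 < U * l by rewrite mulr_gt0.
have nal0 : 0 < n * al by rewrite mulr_gt0.
have b5 : Num.min 2 Delta * (2 * l2N * i2 + 4 * n * i2^-1) <=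
    16 * (U * l) + 8 * (Delta * (n * al)).
  have mn0 : 0 <= Num.min 2 Delta by rewrite le_min Delta0 ler0n.
  have mn2 : Num.min 2 Delta <= 2 by rewrite ge_min lexx.
  have mnD : Num.min 2 Delta <= Delta by rewrite ge_min lexx orbT.
  apply: (@le_trans _ _ (Num.min 2 Delta * (8 * (U * l) + 8 * (n * al)))).
    by apply: ler_wpM2l => //; lra.
  have := ler_wpM2r (ltW Ul0) mn2; have := ler_wpM2r (ltW nal0) mnD; lra.
(* The circular part of [Delta] is resolved here: after multiplication by [q] or [kappa * t], its
   summand [4 * r / eps] is a small multiple of [r / L]. *)
have qe : q / eps <= eps_const^-1.
  by rewrite ler_pdivrMr // ler_pdivlMl.
have kte : kappa * t / eps <= eps_const^-1.
  by rewrite ler_pdivrMr // ler_pdivlMl.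
have Dinv : L * (r * eps_const^-1) = r / 10 ^+ 4.
  rewrite /eps_const invfM mulrCA; congr (_ * _).
  by rewrite mulrCA mulfV ?mulr1 // gt_eqF.
have b6 : Delta * q <= 101 * (sJ * q) + 4 * (r * eps_const^-1).
  have := ler_wpM2l (ltW r0) qe; rewrite DeltaE; lra.
have b7 : kappa * Delta * t <= 101 * (kappa * sJ * t) + 4 * (r * eps_const^-1).
  have := ler_wpM2l (ltW r0) kte; rewrite DeltaE; lra.
set y := Num.sqrt (2 * r / tau0).
have y2 : y ^+ 2 = 2 * r / tau0.
  by rewrite sqr_sqrtr // divr_ge0 ?(ltW tau0_gt0) // mulr_ge0 // ltW.
(* Young's inequality: [y] is of order sqrt r, and the weights are such that only [r / 8] is
   spent. *)
have b8 : 52 * L * y * t <= r / 8 + 104 ^+ 2 * L ^+ 2 / tau0 * t ^+ 2.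
  have : 0 <= (tau0 / 16) * (y - 416 * L * t / tau0) ^+ 2.
    by rewrite mulr_ge0 ?sqr_ge0 // divr_ge0 // ltW.
  have -> : tau0 / 16 * (y - 416 * L * t / tau0) ^+ 2 =
    tau0 / 16 * y ^+ 2 - 52 * L * y * t + 104 ^+ 2 * L ^+ 2 / tau0 * t ^+ 2.
    by field; rewrite gt_eqF.
  rewrite y2.
  have -> : tau0 / 16 * (2 * r / tau0) = r / 8 by field; rewrite gt_eqF.
  lra.
have b9 : 24 * L * s * (r / tau0) <= r / 8.
  have h : s <= tau0 / (10 ^+ 3 * L) by rewrite /s /step_size ge_min lexx orbT.
  have rt0 : 0 <= 24 * L * (r / tau0).
    by apply: mulr_ge0; [apply: mulr_ge0 => //|apply: divr_ge0]; exact: ltW.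
  have := ler_wpM2l rt0 h.
  have -> : 24 * L * (r / tau0) * (tau0 / (10 ^+ 3 * L)) = 24 * (r / 10 ^+ 3).
    by field; rewrite !gt_eqF.
  lra.
have step : 2 * L / n * (13 * (2 * (y + kappa * Delta) * Num.sqrt (n * d) +
     (2 * (l2N / i1^-1 + 2 * n * i1^-1 * m ^+ 2) +
      Num.min 2 Delta * (2 * l2N / i2^-1 + 4 * n * i2^-1))) +
     24 * s * n * (r / (2 * tau0)) + n * q ^+ 2 / s) <=
  52 * L * y * t + 52 * L * (kappa * Delta * t) + 26 * 24 * L * (U * l / n) +
  208 * L * (m * al + Delta * al) + 24 * L * s * (r / tau0) + 2 * L / s * q ^+ 2.
  rewrite !invrK -ht.
  have c0 : 0 <= 2 * L / n by rewrite divr_ge0 ?(ltW n0) // mulr_ge0 // ltW.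
  apply: le_trans (ler_wpM2l c0 (_ : _ <= 13 * (2 * (y + kappa * Delta) * (n * t) +
     (24 * (U * l) + 8 * (m * (n * al)) + 8 * (Delta * (n * al)))) +
     24 * s * n * (r / (2 * tau0)) + n * q ^+ 2 / s)) _; first lra.
  rewrite le_eqVlt; apply/orP; left; apply/eqP; field.
  by rewrite !gt_eqF.
apply: le_trans step _.
have m1 := ler_wpM2l m0 alq; have m2 := ler_wpM2l Delta0 alq.
have e1 : 52 * L * (kappa * Delta * t) <=
    52 * 101 * L * (kappa * sJ * t) + 208 * (r / 10 ^+ 4).
  by rewrite -Dinv; have := ler_wpM2l (ltW L0) b7; lra.
have e2 : 208 * L * (m * al + Delta * al) <=
    208 * L * (m * q) + 208 * 101 * L * (sJ * q) + 208 * 4 * (r / 10 ^+ 4).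
  rewrite -Dinv.
  have := ler_wpM2l (ltW L0) b6; have := ler_wpM2l (ltW L0) m1.
  have := ler_wpM2l (ltW L0) m2; lra.
have fin := rate_terms_le p1 p5 (ltW Uln0) p4 p3 p2.
rewrite (_ : _ + _ = rate) in fin; last by rewrite rateE; ring.
rewrite -/K -/r -/s in fin.
clear -b8 b9 e1 e2 fin r0; lra.
Qed.

End Constants.

(** * Excess risk, localization and the general deviation bound *)

Section LossSetting.
Context (R : realType) (dS dT : measure_display) (S : measurableType dS)
  (T : measurableType dT) (P : probability (S * T)%type R).
Variables (ell : T -> R -> R) (hell : is_loss ell) (L K0 tau0 : R).
Hypothesis L0 : 0 < L.
Hypothesis ell2L : forall y u, `|derive1n 2 (ell y) u| <= L.
Hypothesis ell_lip : forall y u v, `|u| <= 1 -> `|v| <= 1 ->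
  `|ell y u - ell y v| <= L * `|u - v|.
Hypothesis ell1L : forall y u, `|u| <= 1 -> `|derive1 (ell y) u| <= L.
Hypothesis ellK0 : forall y u, `|u| <= 1 -> `|ell y u| <= K0.
Hypothesis tau0_gt0 : 0 < tau0.
Hypothesis ell_tau : forall y w, `|w| <= 1 -> 2 * tau0 <= derive1n 2 (ell y) w.

Variables (N : nat) (h : 'I_N -> S -> R).
Hypothesis mh : forall j, measurable_fun setT (h j).
Hypothesis h1 : forall j x, `|h j x| <= 1.

Let bh j : bdm (h j). Proof. by split; [|exists 1]. Qed.

Lemma bdm_fst (f : S -> R) : bdm f -> bdm (fun z : S * T => f z.1).
Proof.
move=> [mf [M fM]]; split; last by exists M.
exact: (measurableT_comp mf measurable_fst).
Qed.

Lemma mean_marginal1 (f : S -> R) : bdm f -> mean (marginal1 P) f = mean P (fun z => f z.1).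
Proof.
move=> bf; have bf1 : bdm (fun z : S * T => f z.1) by exact: bdm_fst.
rewrite /mean /Rintegral; congr fine.
rewrite integral_distribution //; first by apply/measurable_EFinP; case: bf.
exact: (bdm_integrable P bf1).
Qed.

Lemma bdm_lin_comb c : bdm (lin_comb h c).
Proof. by apply: bdm_sum => j; apply: bdmZ. Qed.

Lemma measurable_loss_comp (f : S -> R) : measurable_fun setT f ->
  measurable_fun setT (fun z : S * T => ell z.2 (f z.1)).
Proof.
move=> mf.
have mpair : measurable_fun setT
    (fun z : S * T => (z.2, f z.1 : measurableTypeR R)).
  apply: measurable_fun_pair; first exact: measurable_snd.
  exact: (measurableT_comp mf measurable_fst).
exact: (measurableT_comp (loss_measurable hell) mpair).
Qed.

Lemma bdm_loss (f : S -> R) : measurable_fun setT f -> (forall x, `|f x| <= 1) ->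
  bdm (fun z : S * T => ell z.2 (f z.1)).
Proof.
by move=> mf f1; split; [exact: measurable_loss_comp|exists K0 => z; apply: ellK0].
Qed.

Lemma bdm_dloss (f : S -> R) : measurable_fun setT f -> (forall x, `|f x| <= 1) ->
  bdm (fun z : S * T => derive1 (ell z.2) (f z.1)).
Proof.
move=> mf f1; split; last by exists L => z; apply: ell1L.
apply: (@measurable_fun_cvg _ _ _ setT (fun k (z : S * T) =>
  k.+1%:R * (ell z.2 (f z.1 + k.+1%:R^-1) - ell z.2 (f z.1)))).
  move=> k; apply: measurable_funM; first exact: measurable_cst.
  apply: measurable_funB; last exact: measurable_loss_comp.
  apply: (@measurable_loss_comp (fun x => f x + k.+1%:R^-1)).
  by apply: measurable_funD => //; exact: measurable_cst.
move=> z _; apply: cvg_difference_quotient; last exact: ell2L.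
  exact: loss_derivable.
exact: loss_derivable2.
Qed.

Definition Risk lam : R := mean P (fun z => ell z.2 (lin_comb h lam z.1)).

Lemma mlin c : measurable_fun setT (lin_comb h c).
Proof. by case: (bdm_lin_comb c). Qed.

Lemma riskE lam : simplex lam -> risk P ell (lin_comb h lam) = (Risk lam)%:E.
Proof.
move=> sl; apply: mean_EFin; apply: bdm_loss; first exact: mlin.
by move=> x; apply: lin_comb_le1.
Qed.

Lemma pen_riskE eps lam : simplex lam ->
  pen_risk P ell h eps lam = (Risk lam + eps * neg_entropy lam)%:E.
Proof. by move=> sl; rewrite /pen_risk riskE // -EFinD. Qed.

Definition sqdist lam lam' : R :=
  mean P (fun z => (lin_comb h lam' z.1 - lin_comb h lam z.1) ^+ 2).

Lemma sqdist_ge0 lam lam' : 0 <= sqdist lam lam'.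
Proof. by apply: mean_ge0 => z; apply: sqr_ge0. Qed.

Lemma bdm_diff lam lam' :
  bdm (fun z : S * T => lin_comb h lam' z.1 - lin_comb h lam z.1).
Proof. by apply: bdmB; apply: bdm_fst; apply: bdm_lin_comb. Qed.

(* A lower bound for the excess of the penalized risk of [lam'] when [lam] is
   its minimizer, obtained by comparing [lam] with the midpoint. *)
Definition gap (J : {set 'I_N}) (eps : R) (lam lam' : 'rV[R]_N) : R :=
  tau0 / 2 * sqdist lam lam' + eps / 4 *
    \sum_(j | j \notin J) Num.max 0 (lam' ord0 j - 100 * lam ord0 j).

(** Curvature [2 * tau0] yields [tau0 / 4] at the midpoint and the entropy yields [eps / 8];
    comparing with the minimum at the midpoint and doubling gives the coefficients of [gap]. *)
Lemma gap_le J eps lam lam' : 0 <= eps ->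
  is_argmin (@simplex R N) (pen_risk P ell h eps) lam -> simplex lam' ->
  gap J eps lam lam' <= (Risk lam' + eps * neg_entropy lam') -
                        (Risk lam + eps * neg_entropy lam).
Proof.
move=> eps0 [sl minl] sl'.
pose mid := 2^-1 *: lam + 2^-1 *: lam'.
have smid : simplex mid.
  rewrite /mid (_ : 2^-1 *: lam = (1 - 2^-1) *: lam); last first.
    by congr (_ *: _); field.
  by apply: simplex_conv => //; lra.
have := minl _ smid; rewrite !pen_riskE // lee_fin => hm.
have he := neg_entropy_midpoint J sl sl'; rewrite -/mid in he.
have hr : Risk mid + tau0 / 4 * sqdist lam lam' <= (Risk lam + Risk lam') / 2.
  have b1 : bdm (fun z : S * T => ell z.2 (lin_comb h lam z.1)).
    by apply: bdm_loss => [|x]; [exact: mlin|exact: lin_comb_le1].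
  have b2 : bdm (fun z : S * T => ell z.2 (lin_comb h lam' z.1)).
    by apply: bdm_loss => [|x]; [exact: mlin|exact: lin_comb_le1].
  have b3 : bdm (fun z : S * T => ell z.2 (lin_comb h mid z.1)).
    by apply: bdm_loss => [|x]; [exact: mlin|exact: lin_comb_le1].
  have b4 := bdm_sqr (bdm_diff lam lam').
  have -> : Risk mid + tau0 / 4 * sqdist lam lam' = mean P (fun z =>
      ell z.2 (lin_comb h mid z.1) +
      tau0 / 4 * (lin_comb h lam' z.1 - lin_comb h lam z.1) ^+ 2).
    by rewrite meanD ?meanZ //; exact: bdmZ.
  have -> : (Risk lam + Risk lam') / 2 = mean P (fun z => 2^-1 *
      (ell z.2 (lin_comb h lam z.1) + ell z.2 (lin_comb h lam' z.1))).
    by rewrite meanZ ?meanD 1?mulrC //; exact: bdmD.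
  apply: mean_le; [by apply/bdmD/bdmZ|exact/bdmZ/bdmD|].
  move=> z.
  have u1 : `|lin_comb h lam z.1| <= 1 by exact: lin_comb_le1.
  have v1 : `|lin_comb h lam' z.1| <= 1 by exact: lin_comb_le1.
  have := strong_midpoint (@loss_derivable _ _ _ _ hell z.2)
    (@loss_derivable2 _ _ _ _ hell z.2)
    (ell_tau z.2) u1 v1.
  rewrite /mid lin_combD.
  set u := lin_comb h lam z.1; set v := lin_comb h lam' z.1.
  have -> : 2^-1 * u + 2^-1 * v = (u + v) / 2 by field.
  have -> : (v - u) ^+ 2 = (u - v) ^+ 2 by ring.
  by lra.
have := ler_wpM2l eps0 he; rewrite /gap.
set s := \sum_(_ | _) _; lra.
Qed.

Section OneSample.
Variables (n : nat) (z : 'I_n -> S * T).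

Lemma emp_risk_conv lam lam' t : simplex lam -> simplex lam' ->
  0 <= t -> t <= 1 ->
  emp_risk z ell (lin_comb h ((1 - t) *: lam + t *: lam')) <=
  (1 - t) * emp_risk z ell (lin_comb h lam) +
  t * emp_risk z ell (lin_comb h lam').
Proof.
move=> sl sl' t0 t1; rewrite /emp_risk.
rewrite mulrCA [t * (_ * _)]mulrCA -mulrDr; apply: ler_wpM2l.
  by rewrite invr_ge0.
rewrite !mulr_sumr -big_split /=; apply: ler_sum => i _.
rewrite lin_combD.
have t01 : 0 <= 1 - t <= 1 by apply/andP; split; lra.
have := @loss_convex _ _ _ _ hell (z i).2 (Itv01 (proj1 (andP t01)) (proj2 (andP t01))).
move=> /(_ (lin_comb h lam (z i).1) (lin_comb h lam' (z i).1)).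
rewrite !inE => /(_ I I); rewrite !convRE /=.
rewrite /unstable.onem (_ : 1 - (1 - t) = t); last by ring.
set a := lin_comb h lam (z i).1; set b := lin_comb h lam' (z i).1.
have -> // : conv (Itv01 (proj1 (andP t01)) (proj2 (andP t01)))
  (a : convex_lmodType R^o) b = (1 - t) * a + t * b.
transitivity ((1 - t) * a + (1 - (1 - t)) * b) => //; ring.
Qed.

(* If [gap] exceeded [r] at [lamhat], it would equal [r] at some point of the
   segment from [lam] to [lamhat], where the empirical penalized risk is by
   convexity at most its value at [lam]. *)
Lemma gap_localize J eps lam lamhat r : 0 <= eps ->
  is_argmin (@simplex R N) (pen_risk P ell h eps) lam ->
  is_argmin (@simplex R N) (pen_emp_risk z ell h eps) lamhat ->
  0 < r ->
  (forall lam', simplex lam' -> gap J eps lam lam' <= r ->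
    (Risk lam' - Risk lam) -
    (emp_risk z ell (lin_comb h lam') - emp_risk z ell (lin_comb h lam)) < r) ->
  gap J eps lam lamhat <= r.
Proof.
move=> eps0 argl [sh minh] r0 H; have [sl _] := argl.
rewrite leNgt; apply/negP => hr.
pose path t := (1 - t) *: lam + t *: lamhat : 'rV[R]_N.
pose a j := lamhat ord0 j - lam ord0 j.
(* A point of the path minus [100 * lam] is [t * a - 99 * lam] in each coordinate. *)
pose b j := 99 * lam ord0 j.
have gapE t : gap J eps lam (path t) =
    (tau0 / 2 * sqdist lam lamhat) * t ^+ 2 +
    eps / 4 * \sum_(j | j \notin J) Num.max 0 (t * a j - b j).
  rewrite /gap; congr (_ + _ * _); last first.
    by apply: eq_bigr => j _; congr Num.max; rewrite !mxE /a /b; ring.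
  have -> : tau0 / 2 * sqdist lam lamhat * t ^+ 2 =
      tau0 / 2 * (t ^+ 2 * sqdist lam lamhat) by ring.
  congr (_ * _); rewrite /sqdist -meanZ; last first.
    exact/bdm_sqr/bdm_diff.
  by apply: mean_ext => w; rewrite lin_combD; ring.
have [||t [t0 t1 gt]] := @exists_level R (tau0 / 2 * sqdist lam lamhat) (eps / 4)
    'I_N (fun j => j \notin J) a b r.
- rewrite expr0n /= mulr0 add0r big1 ?mulr0 ?(ltW r0) // => j _.
  have [l0 _] := sl.
  by apply/max_idPl; rewrite mul0r sub0r oppr_le0 /b mulr_ge0.
- rewrite -gapE /path subrr scale0r add0r scale1r; exact: ltW.
rewrite -gapE in gt.
have sp : simplex (path t) by exact: simplex_conv.
have := H _ sp; rewrite gt => /(_ (lexx _)).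
have := gap_le J eps0 argl sp; rewrite gt.
have := minh _ sl; rewrite /pen_emp_risk lee_fin.
have hE := neg_entropy_conv sl sh t0 t1; rewrite -/(path t) in hE.
have hM := emp_risk_conv sl sh t0 t1; rewrite -/(path t) in hM.
have := ler_wpM2l eps0 hE.
move: hM.
set e1 := emp_risk _ _ _; set e2 := emp_risk _ _ _; set e3 := emp_risk _ _ _.
set n1 := neg_entropy (path t); set n2 := neg_entropy lam.
set n3 := neg_entropy lamhat.
move=> hM hE' hmin hg hlt.
have := ler_wpM2l t0 hmin; lra.
Qed.

End OneSample.

Implicit Types lam : 'rV[R]_N.

(** The net lies in [D] itself, so its points keep the constraint on [gap] with the same [r]; [lam]
    represents the empty cells. *)
Lemma simplex_net (D : set 'rV[R]_N) lam eta : D `<=` @simplex R N -> D lam ->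
  0 < eta ->
  exists (V : finType) (net : V -> 'rV[R]_N), (forall v, D (net v)) /\
    forall x, D x -> exists v, forall j, `|x ord0 j - net v ord0 j| <= eta.
Proof.
move=> Ds Dl eta0.
pose G (j : 'I_N) (x : {x | D x}) : R := sval x ord0 j.
have G1 j x : `|G j x| <= 1.
  have sx := Ds _ (svalP x); have [x0 _] := sx.
  by rewrite ger0_norm; [exact: simplex_le1|exact: x0].
pose cl := cell 1 eta (Num.truncn (2 * 1 / eta)) G.
have /choice[rep Hrep] : forall v, exists x, (exists y, cl y = v) -> cl x = v.
  move=> v; have [[y yv]|no] := pselect (exists y, cl y = v).
    by exists y.
  by exists (exist _ lam Dl) => /no.
exists {ffun 'I_N -> 'I_(Num.truncn (2 * 1 / eta)).+1}, (fun v => sval (rep v)).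
split=> [v|x Dx]; first exact: svalP.
exists (cl (exist _ x Dx)) => j.
apply: (cell_osc eta0 G1 (x := exist _ x Dx)).
by apply/esym/Hrep; exists (exist _ x Dx).
Qed.

Lemma sqdist_of_gap J eps lam lam' r : 0 <= eps -> gap J eps lam lam' <= r ->
  sqdist lam lam' <= 2 * r / tau0.
Proof.
move=> eps0 hr; rewrite ler_pdivlMr //.
have : 0 <= eps / 4 *
    \sum_(j | j \notin J) Num.max 0 (lam' ord0 j - 100 * lam ord0 j).
  by rewrite mulr_ge0 ?divr_ge0 //; apply: sumr_ge0 => j _; rewrite le_max lexx.
by move: hr; rewrite /gap; lra.
Qed.

Lemma offsupport_of_gap (J : {set 'I_N}) eps lam lam' r :
  simplex lam -> simplex lam' -> 0 < eps -> gap J eps lam lam' <= r ->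
  \sum_(j | j \notin J) `|lam' ord0 j - lam ord0 j| <=
  101 * \sum_(j | j \notin J) lam ord0 j + 4 * r / eps.
Proof.
move=> [l0 _] [l0' _] eps0 hr.
set X := \sum_(j | j \notin J) Num.max 0 (lam' ord0 j - 100 * lam ord0 j).
have hX : X <= 4 * r / eps.
  rewrite ler_pdivlMr //.
  have : 0 <= tau0 / 2 * sqdist lam lam'.
    by rewrite mulr_ge0 ?sqdist_ge0 // divr_ge0 // ltW.
  by move: hr; rewrite /gap -/X; lra.
apply: (@le_trans _ _ (101 * \sum_(j | j \notin J) lam ord0 j + X)); last by lra.
rewrite mulr_sumr -big_split /=; apply: ler_sum => j _.
have := l0 j; have := l0' j.
have : 0 <= Num.max 0 (lam' ord0 j - 100 * lam ord0 j) by rewrite le_max lexx.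
have : lam' ord0 j - 100 * lam ord0 j <=
   Num.max 0 (lam' ord0 j - 100 * lam ord0 j) by rewrite le_max lexx orbT.
by case: (ger0P (lam' ord0 j - lam ord0 j)) => _; lra.
Qed.

Lemma simplex_l1_dist lam lam' (J : pred 'I_N) : simplex lam -> simplex lam' ->
  \sum_(j | J j) `|lam' ord0 j - lam ord0 j| <= 2.
Proof.
move=> [l0 l1] [l0' l1'].
apply: (@le_trans _ _ (\sum_j (lam' ord0 j + lam ord0 j))).
  rewrite big_mkcond /=; apply: ler_sum => j _.
  have := l0 j; have := l0' j.
  by case: (J j) => //; [case: (ger0P (lam' ord0 j - lam ord0 j)) => _|]; lra.
by rewrite big_split /= l1 l1'.
Qed.

Lemma lin_combB (X : Type) (f : 'I_N -> X -> R) lam lam' x :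
  lin_comb f lam' x - lin_comb f lam x =
  \sum_j (lam' ord0 j - lam ord0 j) * f j x.
Proof. by rewrite /lin_comb -sumrB; apply: eq_bigr => j _; rewrite mulrBl. Qed.

Lemma risk_diff_le lam lam' (g : S -> R) : simplex lam -> simplex lam' ->
  bdm g ->
  (forall j, mean P (fun z =>
     (derive1 (ell z.2) (lin_comb h lam z.1) - g z.1) * h j z.1) = 0) ->
  `|Risk lam' - Risk lam| <=
  Num.sqrt (mean P (fun z => g z.1 ^+ 2)) * Num.sqrt (sqdist lam lam') +
  L * sqdist lam lam'.
Proof.
move=> sl sl' bg orth.
have u1 lam0 x : simplex lam0 -> `|lin_comb h lam0 x| <= 1.
  by move=> sl0; apply: lin_comb_le1.
have bl lam0 : simplex lam0 ->
    bdm (fun z : S * T => ell z.2 (lin_comb h lam0 z.1)).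
  by move=> sl0; apply: bdm_loss => [|x]; [exact: mlin|exact: u1].
pose f (z : S * T) := lin_comb h lam' z.1 - lin_comb h lam z.1.
pose psi (z : S * T) := derive1 (ell z.2) (lin_comb h lam z.1).
have bf : bdm f by exact: bdm_diff.
have bpsi : bdm psi by apply: bdm_dloss => [|x]; [exact: mlin|exact: u1].
have bg1 : bdm (fun z : S * T => g z.1) by exact: bdm_fst.
have taylor : `|(Risk lam' - Risk lam) - mean P (fun z => psi z * f z)| <=
    L * sqdist lam lam'.
  have bD : bdm (fun z : S * T =>
      ell z.2 (lin_comb h lam' z.1) - ell z.2 (lin_comb h lam z.1) - psi z * f z).
    by apply: bdmB; [apply: bdmB; apply: bl|exact: bdmM].
  have -> : (Risk lam' - Risk lam) - mean P (fun z => psi z * f z) =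
      mean P (fun z => ell z.2 (lin_comb h lam' z.1) -
        ell z.2 (lin_comb h lam z.1) - psi z * f z).
    rewrite meanB; [|by apply: bdmB; apply: bl|exact: bdmM].
    by rewrite meanB //; apply: bl.
  have bL : bdm (fun z : S * T => L * f z ^+ 2) by exact/bdmZ/bdm_sqr.
  have pt z : `|ell z.2 (lin_comb h lam' z.1) - ell z.2 (lin_comb h lam z.1) -
      psi z * f z| <= L * f z ^+ 2.
    by apply: taylor1 => // u; [exact: loss_derivable|exact: loss_derivable2].
  rewrite /sqdist -meanZ; last exact: bdm_sqr.
  rewrite ler_norml; apply/andP; split.
    rewrite -mulN1r -meanZ //; apply: mean_le => //; first exact: bdmZ.
    by move=> z; have := pt z; rewrite ler_norml mulN1r => /andP[].
  by apply: mean_le => // z; have := pt z; rewrite ler_norml => /andP[].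
(* [f] is a combination of the [h j], so [psi] may be replaced by its projection. *)
have lin : mean P (fun z => psi z * f z) = mean P (fun z => g z.1 * f z).
  apply/eqP; rewrite -subr_eq0 -meanB; [|exact: bdmM|exact: bdmM].
  rewrite (@mean_ext _ _ _ _ _ (fun z => \sum_j (lam' ord0 j - lam ord0 j) *
      ((psi z - g z.1) * h j z.1))); last first.
    move=> z; rewrite -mulrBl /f lin_combB mulr_sumr; apply: eq_bigr => j _.
    by rewrite mulrCA.
  have bj j : bdm (fun z : S * T => (psi z - g z.1) * h j z.1).
    by apply: bdmM; [exact: bdmB|exact: bdm_fst].
  rewrite mean_sum; last by move=> j; exact: bdmZ.
  by rewrite big1 // => j _; rewrite meanZ // orth mulr0.
have cs1 := mean_cauchy_schwarz P bg1 bf.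
have cs2 := mean_cauchy_schwarz P (bdmN bg1) bf.
move: cs2; rewrite (@mean_ext _ _ _ _ _ (fun z => -1 * (g z.1 * f z))); last first.
  by move=> z; rewrite mulN1r mulNr.
rewrite (meanZ _ _ (bdmM bg1 bf)).
rewrite [X in Num.sqrt X * _](@mean_ext _ _ _ _ _ (fun z => g z.1 ^+ 2)); last first.
  by move=> z; rewrite sqrrN.
rewrite -/(sqdist lam lam') in cs1 * => cs2.
move: taylor; rewrite lin !ler_norml => /andP[t1 t2].
by apply/andP; split; lra.
Qed.

(** A projection is constructed by Gram-Schmidt so that [xget] does not return its default.
    Whichever projection it picks is a pointwise combination of the [h j], hence bounded. *)
Lemma g_fun_spec lam : simplex lam -> bdm (g_fun P ell h lam) /\
  forall j, mean P (fun z => (derive1 (ell z.2) (lin_comb h lam z.1) -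
    g_fun P ell h lam z.1) * h j z.1) = 0.
Proof.
move=> sl.
pose psi (z : S * T) := derive1 (ell z.2) (lin_comb h lam z.1).
have bpsi : bdm psi.
  by apply: bdm_dloss => [|x]; [exact: mlin|exact: lin_comb_le1].
pose phi k : S * T -> R := if insub k is Some j then fun z => h j z.1 else fun=> 0.
have phiE (j : 'I_N) : phi j = fun z => h j z.1 by rewrite /phi valK.
have bphi k : (k < N)%N -> bdm (phi k).
  by move=> kN; rewrite (phiE (Ordinal kN)); apply: bdm_fst.
have [n [e [_ oe span res]]] := gram_schmidt P bphi.
have [be _] := oe.
have spanD a f g : dict_span h f -> dict_span (T := T) h g ->
    dict_span h (fun x => a * f x + g x).
  move=> [c _ <-] [c' _ <-]; exists (a *: c + 1 *: c') => //.
  by apply/funext => z /=; rewrite lin_combD mul1r.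
have span0 : dict_span (T := T) h (fun=> 0).
  exists 0 => //; apply/funext => z /=; rewrite /lin_comb big1 // => j _.
  by rewrite mxE mul0r.
have spane k : (k < n)%N -> dict_span h (e k).
  apply: span => // j jN; rewrite (phiE (Ordinal jN)).
  exists (delta_mx ord0 (Ordinal jN)) => //; apply/funext => z /=.
  rewrite /lin_comb (bigD1 (Ordinal jN)) //= mxE !eqxx mul1r big1 ?addr0 //.
  by move=> i /negPf ij; rewrite mxE ij andbF mul0r.
have projP : dict_span h (fun z => \sum_(k < n) coef P e psi k * e k z).
  elim: (n) spane => [|l IH] spane.
    by under eq_fun do rewrite big_ord0.
  under eq_fun do rewrite big_ord_recr /= addrC.
  by apply: spanD; [exact: spane|apply: IH => k kl; exact/spane/ltnW].
have [c _ cE] := projP.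
have ex : exists g : S -> R, is_orth_proj P (dict_span h) psi (g \o fst).
  exists (lin_comb h c); rewrite cE; split; first exact: projP.
  have brs : bdm (residual P e n psi) by exact: residual_bdm.
  have orthj j : mean P (fun z => residual P e n psi z * h j z.1) = 0.
    have bhj : bdm (fun z : S * T => h j z.1) by exact: bdm_fst.
    have r0 : \forall z \ae P, residual P e n (fun z => h j z.1) z = 0.
      apply: ae_eq0_of_mean_sqr; first exact: residual_bdm.
      by rewrite -phiE; apply: res.
    have -> : mean P (fun z => residual P e n psi z * h j z.1) =
       mean P (fun z => (\sum_(k < n) coef P e (fun z => h j z.1) k * e k z) *
         residual P e n psi z).
      apply: mean_ae_eq; [exact: bdmM|by apply: bdmM => //; apply: bdm_lin|].
      apply: filterS r0 => z; rewrite {1}/residual => /eqP.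
      by rewrite subr_eq0 => /eqP ->; rewrite mulrC.
    rewrite mean_lin_mul // big1 // => k _.
    rewrite (@mean_ext _ _ _ _ _ (fun z => residual P e n psi z * e k z)).
      by rewrite residual_orth ?mulr0.
    by move=> z; rewrite mulrC.
  move=> _ [c' _ <-]; rewrite /inner -/(mean P _).
  rewrite (@mean_ext _ _ _ _ _ (fun z => \sum_j c' ord0 j *
      (residual P e n psi z * h j z.1))); last first.
    move=> z; rewrite /= /lin_comb mulr_sumr; apply: eq_bigr => j _.
    by rewrite mulrCA.
  have bj j : bdm (fun z => residual P e n psi z * h j z.1).
    by apply: bdmM => //; apply: bdm_fst.
  rewrite mean_sum; last by move=> j; exact: bdmZ.
  by rewrite big1 // => j _; rewrite meanZ // orthj mulr0.
have [[c0 _ c0E] orth] := xgetPex (cst 0) ex.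
rewrite -/(g_fun P ell h lam) in c0E orth.
(* Some [y] in [T] is needed to turn an identity between functions of [(x, y)] into one between
   functions of [x]. *)
have [[_ y] _] := probability_nonempty P.
have gE : g_fun P ell h lam = lin_comb h c0.
  by apply/funext => x; have := congr1 (fun f => f (x, y)) c0E.
split; first by rewrite gE; exact: bdm_lin_comb.
move=> j; rewrite -[RHS](orth (fun z => h j z.1)) //.
exists (delta_mx ord0 j) => //; apply/funext => z /=.
rewrite /lin_comb (bigD1 j) //= mxE !eqxx mul1r big1 ?addr0 //.
by move=> i /negPf ij; rewrite mxE ij andbF mul0r.
Qed.

Section Deviation.
Context (dO : measure_display) (Omega : measurableType dO)
  (Pr : probability Omega R).
Variables (n : nat) (Z : 'I_n -> {RV Pr >-> (S * T)%type}).
Hypothesis iidZ : iid_sample P Z.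
Hypothesis n0 : (0 < n)%N.
(** Common interface of the two statements: [A_ j] holds the coefficients of [h j] that are split
    off and [q j] is the residual. By [Adec], the split-off part of a combination is controlled by
    its L2 norm, up to [kappa] times its l1 mass outside J. *)
Variables (j0 : 'I_N) (J : {set 'I_N}) (d : nat) (e_ : 'I_d -> S -> R)
  (A_ : 'I_N -> 'I_d -> R) (U m kappa : R).
Let q j x := h j x - \sum_k A_ j k * e_ k x.
Hypothesis be : forall k, bdm (e_ k).
Hypothesis he : forall k, mean P (fun z => e_ k z.1 ^+ 2) <= 1.
Hypothesis U1 : 1 <= U.
Hypothesis m0 : 0 <= m.
Hypothesis kappa0 : 0 <= kappa.
Hypothesis qU : forall j x, `|q j x| <= U.
Hypothesis qJ : forall j, j \in J -> mean P (fun z => q j z.1 ^+ 2) <= m ^+ 2.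
Hypothesis qJc : forall j, j \notin J -> mean P (fun z => q j z.1 ^+ 2) <= 1.
Hypothesis Adec : forall b : 'I_N -> R,
  \sum_k (\sum_j b j * A_ j k) ^+ 2 <=
  (Num.sqrt (mean P (fun z => (\sum_j b j * h j z.1) ^+ 2)) +
   kappa * \sum_(j | j \notin J) `|b j|) ^+ 2.

Let emp w lam := emp_risk (fun i => Z i w) ell (lin_comb h lam).

Let bq j : bdm (q j).
Proof. by apply: bdmB => //; apply: bdm_sum => k; apply: bdmZ. Qed.

(** Dividing loss differences by [2 * L] makes them bounded by 1 and contractions of [F], with
    second moment at most a quarter of the squared distance. Of [slack], one half is the [kap] of
    [empirical_process_le] and one quarter each pays for the net in the risk and in the empirical
    risk. *)
Lemma uniform_deviation lam eps r u s s1 s2 slack Delta :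
  simplex lam -> 0 < eps -> 0 < r ->
  Delta = 101 * \sum_(j | j \notin J) lam ord0 j + 4 * r / eps ->
  0 < s1 -> s1 * U <= 2^-1 -> 0 < s2 -> s2 * U <= 2^-1 ->
  0 < s -> s <= 6^-1 -> 0 < slack ->
  exists F : set Omega, [/\ measurable F,
    ((1 - expR (- u))%:E <= Pr F)%E &
    forall w, F w -> forall lam', simplex lam' -> gap J eps lam lam' <= r ->
    (Risk lam' - Risk lam) - (emp w lam' - emp w lam) <=
    2 * L / n%:R *
     (13 * (2 * (Num.sqrt (2 * r / tau0) + kappa * Delta) *
              Num.sqrt (n%:R * d%:R) +
        (2 * (ln (2 * N%:R) / s1 + 2 * n%:R * s1 * m ^+ 2) +
         Num.min 2 Delta * (2 * ln (2 * N%:R) / s2 + 4 * n%:R * s2))) +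
      24 * s * n%:R * (r / (2 * tau0)) + u / s) + slack].
Proof.
move=> sl eps0 r0 DeltaE s10 s1U s20 s2U s0 s6 sk0.
have N0 : 0 < N%:R :> R by rewrite ltr0n; case: N j0 => [[]|].
have nR : 0 < n%:R :> R by rewrite ltr0n.
have L2 : 0 < 2 * L by rewrite mulr_gt0.
pose eta := slack / (4 * L * N%:R).
have eta0 : 0 < eta by rewrite divr_gt0 // mulr_gt0 // mulr_gt0.
pose D := [set lam' | simplex lam' /\ gap J eps lam lam' <= r].
have gap0 : gap J eps lam lam <= r.
  rewrite /gap /sqdist (@mean_ext _ _ _ _ _ (fun=> 0)); last first.
    by move=> z; rewrite subrr expr0n.
  rewrite mean_cst mulr0 add0r big1 ?mulr0 ?(ltW r0) // => j _.
  have [l0 _] := sl.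
  by apply/max_idPl; have := l0 j; lra.
have [V [net [Dnet Hnet]]] := @simplex_net D lam eta (fun x Dx => Dx.1)
  (conj sl gap0) eta0.
have [v0 _] := Hnet _ (conj sl gap0).
have snet v : simplex (net v) := (Dnet v).1.
have gnet v : gap J eps lam (net v) <= r := (Dnet v).2.
pose b v j := net v ord0 j - lam ord0 j.
pose g v (z : S * T) := (2 * L)^-1 *
  (ell z.2 (lin_comb h (net v) z.1) - ell z.2 (lin_comb h lam z.1)).
pose F v (z : S * T) := lin_comb h (net v) z.1 - lin_comb h lam z.1.
have u1 lam' x : simplex lam' -> `|lin_comb h lam' x| <= 1.
  by move=> sl'; apply: lin_comb_le1.
have bl lam' : simplex lam' -> bdm (fun z : S * T => ell z.2 (lin_comb h lam' z.1)).
  by move=> sl'; apply: bdm_loss => [|x]; [exact: mlin|exact: u1].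
have bg v : bdm (g v) by apply: bdmZ; apply: bdmB; apply: bl.
have gF1 v z : `|g v z| <= 2^-1 * `|F v z|.
  rewrite /g normrM gtr0_norm ?invr_gt0 // invfM -mulrA.
  by rewrite ler_wpM2l ?invr_ge0 // ler_pdivrMl // ell_lip // u1.
have F2 v z : `|F v z| <= 2.
  apply: le_trans (ler_normB _ _) _.
  by have := u1 _ z.1 (snet v); have := u1 _ z.1 sl; lra.
(* Both bounds on the l1 distance outside J are kept: 2 will multiply the term in [U], [Delta] the
   term in sqrt (ln N / n). *)
pose Delta' := Num.min 2 Delta.
(* Masking lets both residual families be indexed by all of ['I_N]. *)
pose msk (B : bool) (x : R) := if B then x else 0.
have [||||||||||||||||Ev [mEv PEv HEv]] := @empirical_process_le R _ _ _ _ Pr P n Z iidZ V v0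
  N j0 d g F (fun k z => e_ k z.1)
  (fun j z => msk (j \in J) (q j z.1)) (fun j z => msk (j \notin J) (q j z.1))
  (fun v k => \sum_j b v j * A_ j k)
  (fun v j => msk (j \in J) (b v j)) (fun v j => msk (j \notin J) (b v j))
  (Num.sqrt (2 * r / tau0) + kappa * Delta) 2 Delta' U (m ^+ 2)
  (r / (2 * tau0)) s1 s2 s u (n%:R * slack / (4 * L))
  bg _ _ _ _ _ _ _ _ _ _ _ he _ _ _ _ s10 s1U s20 s2U s0 s6 _.
- by move=> k; apply: bdm_fst; apply: be.
- move=> j; rewrite /msk; case: (j \in J) => /=;
    first [by apply: bdm_fst; apply: bq|exact: bdm_cst].
- move=> j; rewrite /msk; case: (j \in J) => /=;
    first [by apply: bdm_fst; apply: bq|exact: bdm_cst].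
- by move=> v z; have := gF1 v z; have := F2 v z; lra.
- move=> z v v'.
  have -> : g v z - g v' z = (2 * L)^-1 * (ell z.2 (lin_comb h (net v) z.1) -
      ell z.2 (lin_comb h (net v') z.1)) by rewrite /g; ring.
  have -> : F v z - F v' z = lin_comb h (net v) z.1 - lin_comb h (net v') z.1.
    by rewrite /F; ring.
  rewrite normrM gtr0_norm ?invr_gt0 // ler_pdivrMl //.
  apply: le_trans (ell_lip _ (u1 _ _ (snet v)) (u1 _ _ (snet v'))) _.
  have X0 := normr_ge0 (lin_comb h (net v) z.1 - lin_comb h (net v') z.1).
  by apply: ler_wpM2r => //; have := L0; lra.
- move=> v; apply: (@le_trans _ _ (4^-1 * sqdist lam (net v))).
    rewrite /sqdist -meanZ; last exact/bdm_sqr/bdm_diff.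
    apply: mean_le; [exact: bdm_sqr|exact/bdmZ/bdm_sqr/bdm_diff|].
    move=> z; rewrite -/(F v z) -(real_normK (num_real (g v z))).
    rewrite -(real_normK (num_real (F v z))).
    have -> : 4^-1 * `|F v z| ^+ 2 = (2^-1 * `|F v z|) ^+ 2 by field.
    by rewrite ler_sqr ?nnegrE // mulr_ge0 ?invr_ge0.
  have := sqdist_of_gap (ltW eps0) (gnet v).
  have -> : r / (2 * tau0) = 4^-1 * (2 * r / tau0) by field; rewrite gt_eqF.
  by move=> ?; rewrite ler_wpM2l // invr_ge0.
- move=> v z; rewrite /F lin_combB -/(b v).
  rewrite -big_split /=.
  under [X in _ = X + _]eq_bigr => k _ do rewrite mulr_suml.
  rewrite exchange_big /= -big_split /=; apply: eq_bigr => j _.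
  rewrite (eq_bigr (fun k => b v j * (A_ j k * e_ k z.1))); last first.
    by move=> k _; rewrite mulrA.
  rewrite -mulr_sumr /msk /q /b; case: (j \in J) => /=; ring.
- rewrite addr_ge0 ?sqrtr_ge0 // mulr_ge0 // DeltaE addr_ge0 //.
    by rewrite mulr_ge0 // sumr_ge0 // => j _; case: sl.
  by rewrite divr_ge0 ?(ltW eps0) // mulr_ge0 // ltW.
- move=> v; apply: le_trans (Adec (b v)) _.
  have h1' : mean P (fun z => (\sum_j b v j * h j z.1) ^+ 2) <= 2 * r / tau0.
    apply: le_trans (sqdist_of_gap (ltW eps0) (gnet v)).
    rewrite le_eqVlt; apply/orP; left; apply/eqP; apply: mean_ext => z.
    by rewrite lin_combB.
  have h2' := offsupport_of_gap sl (snet v) eps0 (gnet v).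
  have x0 : 0 <= Num.sqrt (mean P (fun z => (\sum_j b v j * h j z.1) ^+ 2)) +
      kappa * \sum_(j | j \notin J) `|b v j|.
    by rewrite addr_ge0 ?sqrtr_ge0 // mulr_ge0 // sumr_ge0.
  have xy : Num.sqrt (mean P (fun z => (\sum_j b v j * h j z.1) ^+ 2)) +
      kappa * \sum_(j | j \notin J) `|b v j| <=
      Num.sqrt (2 * r / tau0) + kappa * Delta.
    by apply: lerD; [exact: ler_wsqrtr|rewrite DeltaE; exact: ler_wpM2l].
  by rewrite ler_sqr ?nnegrE // (le_trans x0).
- move=> v; rewrite (eq_bigr (fun j => if j \in J then `|b v j| else 0)).
    by rewrite -big_mkcond; exact: simplex_l1_dist.
  by move=> j _; rewrite /msk; case: ifP => _ //; rewrite normr0.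
- move=> v; rewrite (eq_bigr (fun j => if j \notin J then `|b v j| else 0)).
    rewrite -big_mkcond le_min; apply/andP; split; first exact: simplex_l1_dist.
    by rewrite DeltaE; apply: offsupport_of_gap.
  by move=> j _; rewrite /msk; case: ifP => _ //; rewrite normr0.
- move=> j z; rewrite /msk; case: (j \in J) => //=;
    by rewrite ?normr0 (le_trans ler01 U1).
- move=> j z; rewrite /msk; case: (j \in J) => //=;
    by rewrite ?normr0 (le_trans ler01 U1).
- move=> j; rewrite /msk; case: (boolP (j \in J)) => jJ /=; first exact: qJ.
  by rewrite expr0n mean_cst sqr_ge0.
- move=> j; rewrite /msk; case: (boolP (j \in J)) => jJ /=; last exact: qJc.
  by rewrite expr0n mean_cst.
- by rewrite divr_gt0 // mulr_gt0.
exists Ev; split=> // w Fw lam' sl' gl'.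
have [v Hv] := Hnet _ (conj sl' gl').
have close y x : `|ell y (lin_comb h lam' x) - ell y (lin_comb h (net v) x)| <=
    slack / 4.
  apply: le_trans (ell_lip _ (u1 _ _ sl') (u1 _ _ (snet v))) _.
  rewrite lin_combB.
  have : `|\sum_j (lam' ord0 j - net v ord0 j) * h j x| <= \sum_(j < N) eta.
    apply: le_trans (ler_norm_sum _ _ _) _; apply: ler_sum => j _.
    by rewrite normrM; apply: le_trans (Hv j); rewrite ler_piMr.
  rewrite sumr_const card_ord => /(ler_wpM2l (ltW L0)) => hh; apply: le_trans hh _.
  rewrite -(mulr_natr eta) /eta le_eqVlt; apply/orP; left; apply/eqP; field.
  by rewrite !gt_eqF.
have cR : `|Risk lam' - Risk (net v)| <= slack / 4.
  by apply: mean_dist_le => [||z]; [exact: bl|exact: bl|exact: close].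
have cE : `|emp w lam' - emp w (net v)| <= slack / 4.
  rewrite /emp /emp_risk -mulrBr normrM gtr0_norm ?invr_gt0 //.
  rewrite ler_pdivrMl // -sumrB; apply: le_trans (ler_norm_sum _ _ _) _.
  apply: (@le_trans _ _ (\sum_(i < n) slack / 4)).
    by apply: ler_sum => i _; apply: close.
  by rewrite sumr_const card_ord mulr_natl.
have main := HEv w Fw v.
have mg : mean P (g v) = (2 * L)^-1 * (Risk (net v) - Risk lam).
  by rewrite meanZ ?meanB //; [exact: bl|exact: bl|apply: bdmB; apply: bl].
have sumE : \sum_i (mean P (g v) - g v (Z i w)) = (2 * L)^-1 * n%:R *
    ((Risk (net v) - Risk lam) - (emp w (net v) - emp w lam)).
  rewrite sumrB sumr_const card_ord mg /g -mulr_sumr sumrB /emp /emp_risk.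
  rewrite -(mulr_natr (_ * (_ - _))); field; by rewrite !gt_eqF.
rewrite sumE in main.
move: cR cE; rewrite !ler_norml => /andP[c1 c2] /andP[c3 c4].
set X := 13 * _ + _ + _ in main *.
have main2 : Risk (net v) - Risk lam - (emp w (net v) - emp w lam) <=
    2 * L / n%:R * X + slack / 2.
  have k0 : 0 < (2 * L)^-1 * n%:R by rewrite mulr_gt0 ?invr_gt0.
  rewrite -(ler_pM2l k0); apply: le_trans main _.
  rewrite le_eqVlt; apply/orP; left; apply/eqP; field.
  by rewrite !gt_eqF.
lra.
Qed.

(** Common form of [B1] and [B2] with sums for maxima; in both uses it is at most 4 times the
    maximum. *)
Definition rate (A : R) lam : R :=
  let l := ln N%:R in
  let sJ := \sum_(j | j \notin J) lam ord0 j in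
  d%:R / n%:R + A * l / n%:R + (sJ + m) * Num.sqrt (A * l / n%:R) +
  U * l / n%:R + kappa * sJ * Num.sqrt (d%:R / n%:R).

Lemma rate_ge0 A lam : 0 <= A -> simplex lam -> 0 <= rate A lam.
Proof.
move=> A0 [l0 _].
have N1 : 1 <= N%:R :> R by rewrite ler1n; case: N j0 => [[]|].
have l_ge0 : 0 <= ln N%:R :> R by exact: ln_ge0.
have sJ0 : 0 <= \sum_(j | j \notin J) lam ord0 j by apply: sumr_ge0.
have U0 : 0 <= U by apply: le_trans U1.
by rewrite /rate; do ![apply: addr_ge0|apply: mulr_ge0|apply: divr_ge0|
  rewrite invr_ge0|exact: sqrtr_ge0|done].
Qed.

Lemma sqdist_le_rate A eps lam : (1 < N)%N -> 1 <= A ->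
  is_argmin (@simplex R N) (pen_risk P ell h eps) lam ->
  eps_const L * Num.sqrt (A * ln N%:R / n%:R) <= eps ->
  eps_const L * (kappa * Num.sqrt (d%:R / n%:R)) <= eps ->
  exists F : set Omega, [/\ measurable F,
    ((1 - N%:R `^ (- A))%:E <= Pr F)%E &
    forall w, F w -> forall lamhat,
      is_argmin (@simplex R N) (pen_emp_risk (fun i => Z i w) ell h eps) lamhat ->
      sqdist lam lamhat <= 2 * (rate_const L tau0 * rate A lam) / tau0].
Proof.
move=> N1 A1 argl; have [sl _] := argl; have [l0 _] := sl.
set l := ln N%:R; set rq := Num.sqrt (A * l / n%:R).
set t := Num.sqrt (d%:R / n%:R) => hq hkt.
have nR : 0 < n%:R :> R by rewrite ltr0n.
have NR : 0 < N%:R :> R by rewrite ltr0n ltnW.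
have lpos : 0 < l by rewrite ln_gt0 // ltr1n.
have A0 : 0 < A by apply: lt_le_trans A1.
have ql0 : 0 < A * l / n%:R by rewrite divr_gt0 // mulr_gt0.
have rq0 : 0 < rq by rewrite sqrtr_gt0.
have eps0 : 0 < eps.
  apply: lt_le_trans hq; apply: mulr_gt0 => //.
  by apply: mulr_gt0 => //; apply: exprn_gt0.
set sJ := \sum_(j | j \notin J) lam ord0 j.
have sJ0 : 0 <= sJ by apply: sumr_ge0 => j _; apply: l0.
pose al := Num.sqrt (l / n%:R).
have ln0 : 0 < l / n%:R by rewrite divr_gt0.
have al0 : 0 < al by rewrite sqrtr_gt0.
have alq : al <= rq.
  by rewrite ler_wsqrtr // -mulrA ler_peMl // ltW.
have nal : n%:R * al ^+ 2 = l.
  by rewrite sqr_sqrtr ?(ltW ln0) // mulrCA mulfV ?mulr1 // gt_eqF.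
have l2N : ln (2 * N%:R) <= 2 * l.
  have h2 : ln 2 <= l by rewrite /l ler_ln ?posrE // ler_nat.
  by rewrite lnM ?posrE // -/l; lra.
have nt : n%:R * t = Num.sqrt (n%:R * d%:R).
  rewrite -[n%:R in LHS]ger0_norm // -sqrtr_sqr -sqrtrM ?sqr_ge0 //.
  by congr Num.sqrt; field; rewrite gt_eqF.
have t0 : 0 <= t by exact: sqrtr_ge0.
set rt := rate A lam.
have rtE : rt = t ^+ 2 + rq ^+ 2 + (sJ + m) * rq + U * l / n%:R + kappa * sJ * t.
  have t2 : t ^+ 2 = d%:R / n%:R by rewrite sqr_sqrtr // divr_ge0.
  have q2 : rq ^+ 2 = A * l / n%:R by rewrite sqr_sqrtr // ltW.
  by rewrite t2 q2.
have rt0 : 0 < rt.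
  rewrite rtE.
  have p1 : 0 <= t ^+ 2 := sqr_ge0 t.
  have p2 : 0 < rq ^+ 2 := exprn_gt0 2 rq0.
  have p3 : 0 <= (sJ + m) * rq by rewrite mulr_ge0 ?addr_ge0 // ltW.
  have p4 : 0 <= U * l / n%:R.
    by rewrite divr_ge0 // mulr_ge0 ?(ltW lpos) // (le_trans ler01).
  have p5 : 0 <= kappa * sJ * t by rewrite mulr_ge0 // mulr_ge0.
  by lra.
have rc0 : 0 < rate_const L tau0 by exact: rate_const_gt0.
set r := rate_const L tau0 * rt; have r0 : 0 < r by rewrite mulr_gt0.
have s0 : 0 < step_size L tau0 by exact: step_size_gt0.
have s6 : step_size L tau0 <= 6^-1 by rewrite /step_size ge_min lexx.
have U0 : 0 < U by apply: lt_le_trans U1.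
have ali0 : 0 < al^-1 by rewrite invr_gt0.
have sU x : 0 <= x -> 0 < (2 * U + x)^-1 /\ (2 * U + x)^-1 * U <= 2^-1.
  move=> x0; have p : 0 < 2 * U + x by rewrite ltr_wpDr // mulr_gt0.
  split; first by rewrite invr_gt0.
  by rewrite [leLHS]mulrC ler_pdivrMr //; lra.
have [s10 s1U] := sU (m / al) (divr_ge0 m0 (ltW al0)).
have [s20 s2U] := sU al^-1 (ltW ali0).
(* With [u = A * ln N] the failure probability is [N ^ (- A)]. The slack [r / 4] plus the [r / 2] of
   [deviation_le] stays strictly below [r], as [gap_localize] demands. *)
have [F [mF PF HF]] := @uniform_deviation lam eps r (A * l) (step_size L tau0)
  (2 * U + m / al)^-1 (2 * U + al^-1)^-1 (r / 4) _ sl eps0 r0 erefl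
  s10 s1U s20 s2U s0 s6 (divr_gt0 r0 (ltr0n _ 4)).
exists F; split=> //.
  by rewrite /powR gt_eqF // mulNr.
move=> w Fw lamhat argh.
apply: (sqdist_of_gap (J := J) (ltW eps0)).
apply: (gap_localize (ltW eps0) argl argh r0) => lam' sl' gl'.
apply: le_lt_trans (HF w Fw lam' sl' gl') _.
have dev := deviation_le L0 tau0_gt0 nR lpos l2N t0 nt al0 nal alq U1 m0 kappa0
  sJ0 eps0 hq hkt rtE erefl.
rewrite -/r in dev *.
have -> : A * l = n%:R * rq ^+ 2.
  by rewrite sqr_sqrtr ?(ltW ql0) // mulrCA mulfV ?mulr1 // gt_eqF.
apply: le_lt_trans (lerD dev (lexx _)) _; lra.
Qed.

(** Each summand is at most half of the corresponding term of the maximum, so their sum is at most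
    the maximum. *)
Lemma risk_bound_ge (c G V x : R) (B : \bar R) : 0 < c -> 0 <= G -> 0 <= V ->
  (0 <= B)%E -> x <= G * Num.sqrt V + L * V -> (V%:E <= c%:E * B)%E ->
  (x%:E <= risk_bound (2 * c * (L + 2)) G%:E B)%E.
Proof.
move=> c0 G0 V0 B0 hx; set C := 2 * c * (L + 2).
have C0 : 0 < C by rewrite mulr_gt0 ?mulr_gt0 // addr_gt0.
case: B B0 => [b| |] //= b0; last first.
  have Cy : (C%:E * +oo = +oo)%E by rewrite gt0_muley ?lte_fin.
  by rewrite /risk_bound Cy le_max leey.
rewrite lee_fin in b0; rewrite -EFinM lee_fin => Vb.
rewrite /risk_bound /= -!EFinM -EFin_max lee_fin.
have hLV : L * V <= C * b / 2.
  have : L * V <= L * (c * b) by rewrite ler_pM2l.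
  have : 0 <= c * b by rewrite mulr_ge0 // ltW.
  by rewrite /C; lra.
have hGV : G * Num.sqrt V <= Num.sqrt C * G * Num.sqrt b / 2.
  have -> : Num.sqrt C * G * Num.sqrt b / 2 = G * (Num.sqrt C * Num.sqrt b / 2).
    by ring.
  apply: ler_wpM2l => //; rewrite -sqrtrM ?(ltW C0) //.
  have -> : Num.sqrt (C * b) / 2 = Num.sqrt (C * b * 2^-1 ^+ 2).
    have Cb0 : 0 <= C * b by rewrite mulr_ge0 // ltW.
    by rewrite [RHS](sqrtrM _ Cb0) sqrtr_sqr ger0_norm ?invr_ge0.
  apply: ler_wsqrtr; apply: le_trans Vb _.
  have : 0 <= L * (c * b) by rewrite mulr_ge0 ?(ltW L0) // mulr_ge0 // ltW.
  by rewrite /C; lra.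
rewrite le_max; have [hm|hm] := leP (C * b) (Num.sqrt C * G * Num.sqrt b).
  by apply/orP; right; lra.
by apply/orP; left; lra.
Qed.

(** In the constant, 8 is the 2 of [sqdist_le_rate] times the 4 that compares [rate] with [B]. *)
Lemma excess_risk_bound A eps lam (lamhat : Omega -> 'rV[R]_N) (B : \bar R) :
  (1 < N)%N -> 1 <= A ->
  is_argmin (@simplex R N) (pen_risk P ell h eps) lam ->
  eps_const L * Num.sqrt (A * ln N%:R / n%:R) <= eps ->
  eps_const L * (kappa * Num.sqrt (d%:R / n%:R)) <= eps ->
  (forall w, is_argmin (@simplex R N)
     (pen_emp_risk (fun i => Z i w) ell h eps) (lamhat w)) ->
  (0 <= B)%E -> ((rate A lam)%:E <= 4%:E * B)%E ->
  with_prob_ge Pr (1 - N%:R `^ (- A))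
    [set w | (`|risk P ell (lin_comb h (lamhat w)) - risk P ell (lin_comb h lam)|
      <= risk_bound (2 * (8 * rate_const L tau0 / tau0) * (L + 2))
           (L2norm (marginal1 P) (g_fun P ell h lam)) B)%E].
Proof.
move=> N1 A1 argl heps1 heps2 argh B0 hB; have [sl _] := argl.
have [F [mF PF HF]] := sqdist_le_rate N1 A1 argl heps1 heps2.
exists F; split=> // w Fw /=; have [sh _] := argh w.
rewrite !riskE // -EFinB /=.
have [bg orthg] := g_fun_spec sl.
rewrite L2norm_bdm // mean_marginal1; last exact: bdm_sqr.
have rc0 : 0 < rate_const L tau0 by exact: rate_const_gt0.
apply: (@risk_bound_ge _ _ (sqdist lam (lamhat w))) => //.
- by rewrite divr_gt0 // mulr_gt0.
- exact: sqdist_ge0.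
- exact: risk_diff_le.
have V1 := HF w Fw _ (argh w).
apply: (@le_trans _ _ (2 * rate_const L tau0 / tau0 * rate A lam)%:E).
  by rewrite lee_fin; apply: le_trans V1 _; lra.
have -> : 8 * rate_const L tau0 / tau0 = 2 * rate_const L tau0 / tau0 * 4 by ring.
rewrite (EFinM _ (rate A lam)) (EFinM _ 4) -muleA; apply: lee_pmul => //.
- by rewrite lee_fin divr_ge0 ?(ltW tau0_gt0) // mulr_ge0 // ltW.
- rewrite lee_fin; apply: rate_ge0 => //; exact: le_trans A1.
Qed.

End Deviation.
End LossSetting.

(** * Splitting the dictionary along an orthonormal system *)

Section Decomposition.
Context (R : realType) (dS dT : measure_display) (S : measurableType dS)
  (T : measurableType dT) (P : probability (S * T)%type R).
Variables (N : nat) (h : 'I_N -> S -> R).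
Hypothesis mh : forall j, measurable_fun setT (h j).
Hypothesis h1 : forall j x, `|h j x| <= 1.
Local Notation Q := (marginal1 P).

Let bh j : bdm (h j). Proof. by split; [|exists 1]. Qed.

Lemma mean_sqr_le1 (f : S -> R) : bdm f -> (forall x, `|f x| <= 1) ->
  mean Q (fun x => f x ^+ 2) <= 1.
Proof.
move=> bf f1; rewrite -[leRHS](mean_cst Q 1); apply: mean_le.
- exact: bdm_sqr.
- exact: bdm_cst.
by move=> x; rewrite -(real_normK (num_real _)) expr_le1.
Qed.

(* Functions of the orthonormal system are set to zero on a null set, so that
   the almost sure bound on the residuals holds everywhere. *)
Lemma exists_decomposition (J M : {set 'I_N}) (n : nat) (e : nat -> S -> R)
    (U m kappa : R) :
  orthonormal Q e n -> J \subset M -> 1 <= U ->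
  (forall j, j \in M -> \forall x \ae Q, `|residual Q e n (h j) x| <= U) ->
  (forall j, j \in J ->
     mean Q (fun x => residual Q e n (h j) x ^+ 2) <= m ^+ 2) ->
  (forall b : 'I_N -> R, \sum_(j | j \notin M) `|b j| <=
     kappa * \sum_(j | j \notin J) `|b j|) ->
  exists (e_ : 'I_n -> S -> R) (A_ : 'I_N -> 'I_n -> R),
    let q j x := h j x - \sum_k A_ j k * e_ k x in
    [/\ forall k, bdm (e_ k),
        forall k, mean P (fun z => e_ k z.1 ^+ 2) <= 1,
        forall j x, `|q j x| <= U,
        (forall j, j \in J -> mean P (fun z => q j z.1 ^+ 2) <= m ^+ 2) /\
        (forall j, j \notin J -> mean P (fun z => q j z.1 ^+ 2) <= 1) &
        forall b : 'I_N -> R, \sum_k (\sum_j b j * A_ j k) ^+ 2 <=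
          (Num.sqrt (mean P (fun z => (\sum_j b j * h j z.1) ^+ 2)) +
           kappa * \sum_(j | j \notin J) `|b j|) ^+ 2].
Proof.
move=> oe JM U1 resU resJ hM; have [be orth] := oe.
have : \forall x \ae Q, forall j, j \in M -> `|residual Q e n (h j) x| <= U.
  apply: filter_forall => j; case: (boolP (j \in M)) => jM.
    by apply: filterS (resU j jM).
  by apply: aeW => x.
move=> [Nn [mN QN subN]].
have offN x : ~ Nn x -> forall j, j \in M -> `|residual Q e n (h j) x| <= U.
  by move=> xN; apply: contrapT => H; apply/xN/subN.
have mNc : measurable (~` Nn) by exact: measurableC.
pose e_ (k : 'I_n) x := e k x * \1_(~` Nn) x.
(* Functions outside [M] are their own residuals. *)
pose A_ (j : 'I_N) (k : 'I_n) := if j \in M then coef Q e (h j) k else 0.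
exists e_, A_ => q.
have be_ k : bdm (e_ k) by apply: bdmM; [apply: be|exact: bdm_indic].
have e_E x k : ~ Nn x -> e_ k x = e k x.
  by move=> xN; rewrite /e_ indicE mem_set ?mulr1.
have e_0 x k : Nn x -> e_ k x = 0.
  by move=> xN; rewrite /e_ indicE memNset ?mulr0 //; apply.
have aeN : \forall x \ae Q, ~ Nn x by exists Nn; split=> // x /contrapT.
have qN x j : Nn x -> q j x = h j x.
  by move=> xN; rewrite /q big1 ?subr0 // => k _; rewrite e_0 ?mulr0.
have qM x j : ~ Nn x -> j \in M -> q j x = residual Q e n (h j) x.
  move=> xN jM; rewrite /q /residual; congr (_ - _); apply: eq_bigr => k _.
  by rewrite e_E // /A_ jM.
have qMc x j : j \notin M -> q j x = h j x.
  move=> /negPf jM; rewrite /q big1 ?subr0 // => k _.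
  by rewrite /A_ jM mul0r.
have bq j : bdm (q j) by apply: bdmB => //; apply: bdm_sum => k; apply: bdmZ.
have br j : bdm (residual Q e n (h j)) by exact: residual_bdm.
have qres j : j \in M -> mean Q (fun x => q j x ^+ 2) =
    mean Q (fun x => residual Q e n (h j) x ^+ 2).
  move=> jM; apply: mean_ae_eq; [exact: bdm_sqr|exact: bdm_sqr|].
  by apply: filterS aeN => x xN; rewrite qM.
have qP j : mean P (fun z => q j z.1 ^+ 2) = mean Q (fun x => q j x ^+ 2).
  by rewrite mean_marginal1 //; exact: bdm_sqr.
split=> //.
- move=> k; rewrite -(mean_marginal1 P (bdm_sqr (be_ k))).
  rewrite (@mean_ae_eq _ _ _ _ _ (fun x => e k x * e k x)).
  + by rewrite orth // eqxx.
  + exact/bdm_sqr.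
  + by apply: bdmM; apply: be.
  + by apply: filterS aeN => x xN; rewrite e_E // expr2.
- move=> j x; have [xN|xN] := pselect (Nn x).
    by rewrite qN // (le_trans (h1 j x)).
  case: (boolP (j \in M)) => jM; first by rewrite qM // offN.
  by rewrite qMc // (le_trans (h1 j x)).
- split=> j jJ; rewrite qP.
    by rewrite (qres _ (fintype.subsetP JM _ jJ)); exact: resJ.
  case: (boolP (j \in M)) => jM; last first.
    rewrite (@mean_ext _ _ _ _ _ (fun x => h j x ^+ 2)); first exact: mean_sqr_le1.
    by move=> x; rewrite qMc.
  rewrite qres // mean_residual_sqr //.
  apply: le_trans (mean_sqr_le1 (bh j) (h1 j)).
  by rewrite gerBl; apply: sumr_ge0 => k _; apply: sqr_ge0.
move=> b; pose f x := \sum_j b j * h j x.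
pose fM x := \sum_(j | j \in M) b j * h j x.
pose fMc x := \sum_(j | j \notin M) b j * h j x.
have bf : bdm f by apply: bdm_sum => j; apply: bdmZ.
have bfM : bdm fM by apply: bdm_sum => j; apply: bdmZ.
have bfMc : bdm fMc by apply: bdm_sum => j; apply: bdmZ.
have cE k : \sum_j b j * A_ j k = coef Q e fM k.
  have bek : bdm (e k) by exact: be.
  rewrite /coef (@mean_ext _ _ _ _ _ (fun x => \sum_(j | j \in M)
      b j * (h j x * e k x))); last first.
    by move=> x; rewrite mulr_suml; apply: eq_bigr => j _; rewrite mulrA.
  rewrite mean_sum; last by move=> j; apply: bdmZ; apply: bdmM.
  rewrite [RHS]big_mkcond; apply: eq_bigr => j _; rewrite /A_.
  case: ifP => _; last by rewrite mulr0.
  by rewrite meanZ //; apply: bdmM.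
under eq_bigr => k _ do rewrite cE.
(* Only [fM] has coefficients. Its norm is at most that of [f] plus that of [fMc], and the latter is
   at most the l1 mass outside [M] because the [h j] are bounded by 1. *)
apply: le_trans (bessel oe bfM) _.
have mf0 g : 0 <= mean Q (fun x => g x ^+ 2).
  by apply: mean_ge0 => x; apply: sqr_ge0.
rewrite -[leLHS]sqr_sqrtr //.
rewrite -(mean_marginal1 P (bdm_sqr bf)).
have mink := mean_minkowski Q bf (bdmN bfMc).
have eM : mean Q (fun x => (f x - fMc x) ^+ 2) = mean Q (fun x => fM x ^+ 2).
  apply: mean_ext => x; congr (_ ^+ 2); rewrite /f (bigID (fun j => j \in M)) /=.
  by rewrite addrK.
rewrite eM in mink.
have eMc : Num.sqrt (mean Q (fun x => (- fMc x) ^+ 2)) <=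
    kappa * \sum_(j | j \notin J) `|b j|.
  apply: le_trans (hM b); set s := \sum_(j | _) _.
  have s0 : 0 <= s by exact: sumr_ge0.
  rewrite -[leRHS]ger0_norm // -sqrtr_sqr; apply: ler_wsqrtr.
  rewrite -[leRHS](mean_cst Q (s ^+ 2)); apply: mean_le.
  - exact/bdm_sqr/bdmN.
  - exact: bdm_cst.
  move=> x; rewrite sqrrN -(real_normK (num_real (fMc x))) ler_sqr ?nnegrE //.
  apply: le_trans (ler_norm_sum _ _ _) _; apply: ler_sum => j _.
  by rewrite normrM ler_piMr.
have le1 := le_trans mink (lerD (lexx _) eMc).
by rewrite ler_sqr ?nnegrE ?sqrtr_ge0 // (le_trans _ le1) // sqrtr_ge0.
Qed.

End Decomposition.

(** * Subspaces of L2 with finite U(L) *)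

Section Subspaces.
Context (R : realType) (d : measure_display) (E : measurableType d)
  (Q : probability E R) (L : set (E -> R)).
Hypothesis subL : L2_subspace Q L.
Implicit Types f g : E -> R.

Lemma L_measurable f : L f -> measurable_fun setT f.
Proof. by move=> /(subspace_Lfun subL)/sub_Lfun_mfun; rewrite inE. Qed.

Lemma L_sqr_integrable f : L f -> Q.-integrable setT (EFin \o (fun x => f x ^+ 2)).
Proof. by move=> /(subspace_Lfun subL)/Lfun2_integrable_sqr. Qed.

Lemma L_lin_comb k (e : nat -> E -> R) (c : nat -> R) :
  (forall i, (i < k)%N -> L (e i)) -> L (fun x => \sum_(i < k) c i * e i x).
Proof.
elim: k => [|k IH] Le.
  under eq_fun do rewrite big_ord0; exact: (subspace0 subL).
under eq_fun do rewrite big_ord_recr /= addrC.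
apply: (subspace_lin subL); first exact: Le.
by apply: IH => i ik; apply/Le/ltnW.
Qed.

Lemma ae_eq0_of_L2norm0 f : measurable_fun setT f ->
  Q.-integrable setT (EFin \o (fun x => f x ^+ 2)) ->
  mean Q (fun x => f x ^+ 2) = 0 -> \forall x \ae Q, f x = 0.
Proof.
move=> mf int2 f0.
have : (\int[Q]_x `|(f x ^+ 2)%:E| = 0)%E.
  under eq_integral => x _ do rewrite abse_EFin ger0_norm ?sqr_ge0 //.
  rewrite -[LHS](@fineK _ _ (integrable_fin_num _ int2)) //.
  by rewrite -/(Rintegral Q setT (fun x => f x ^+ 2)) -/(mean Q _) f0.
move=> /ae_eq_integral_abs => /(_ measurableT) H.
have /H : measurable_fun setT (fun x => (f x ^+ 2)%:E).
  by apply/measurable_EFinP; apply: measurable_funX.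
apply: filterS => x /= /(_ I) [] /eqP; by rewrite sqrf_eq0 => /eqP.
Qed.

Variable u : R.
Hypothesis Uu : U_of Q L = u%:E.

Lemma U_ge1 : 1 <= u.
Proof.
rewrite -lee_fin -Uu /U_of -[leLHS]add0e leeD2r //.
by rewrite le_max lexx.
Qed.

Lemma L_ae_bounded f : L f ->
  \forall x \ae Q, `|f x| <= (u - 1) * Num.sqrt (mean Q (fun x => f x ^+ 2)).
Proof.
move=> Lf; set v := mean Q (fun x => f x ^+ 2).
have v0 : 0 <= v by apply: mean_ge0 => x; apply: sqr_ge0.
have mf := L_measurable Lf; have int2 := L_sqr_integrable Lf.
move: v0; rewrite le_eqVlt => /predU1P[v0|v0].
  apply: filterS (ae_eq0_of_L2norm0 mf int2 (esym v0)) => x ->.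
  by rewrite -v0 sqrtr0 mulr0 normr0.
have sv0 : 0 < Num.sqrt v by rewrite sqrtr_gt0.
pose g x := (Num.sqrt v)^-1 * f x + 0.
have Lg : L g by apply: (subspace_lin subL) => //; exact: (subspace0 subL).
have norm_g : L2norm Q g = 1%E.
  rewrite L2norm_integrable; [|exact: L_measurable|exact: L_sqr_integrable].
  have -> : mean Q (fun x => g x ^+ 2) = v^-1 * v.
    rewrite /v /mean -RintegralZl //; apply: eq_Rintegral => x _.
    by rewrite /g addr0 exprMn exprVn sqr_sqrtr // ltW.
  by rewrite mulVf ?gt_eqF // sqrtr1.
have : (Linfnorm Q g <= (u - 1)%:E)%E.
  rewrite EFinB -Uu /U_of addeK //.
  rewrite le_max; apply/orP; right; apply: ereal_sup_ubound.
  by exists g.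
move=> /Linfnorm_ae; apply: filterS => x.
rewrite /g addr0 normrM gtr0_norm ?invr_gt0 // ler_pdivrMl // => hx.
by rewrite mulrC.
Qed.

(** Finiteness of U(L) bounds [f] off a null set; setting it to 0 there stays in [L], which is
    closed under almost everywhere equality. *)
Lemma L_bdm_rep f : L f -> exists g, [/\ bdm g, L g & \forall x \ae Q, f x = g x].
Proof.
move=> Lf; have [Nn [mN QN subN]] := L_ae_bounded Lf.
set M := (u - 1) * _ in subN.
pose g x := f x * \1_(~` Nn) x.
have mf := L_measurable Lf.
have mg : measurable_fun setT g.
  by apply: measurable_funM => //; apply: measurable_indic; apply: measurableC.
have M0 : 0 <= M.
  by rewrite mulr_ge0 ?sqrtr_ge0 // subr_ge0 U_ge1.
have bg : bdm g.
  split=> //; exists M => x; rewrite /g indicE.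
  have [xN|xN] := pselect (Nn x); first by rewrite memNset ?mulr0 ?normr0.
  by rewrite mem_set // mulr1; apply: contrapT => H; apply/xN/subN.
have fg : \forall x \ae Q, f x = g x.
  exists Nn; split=> // x /= H; apply: contrapT => xN; apply: H.
  by rewrite /g indicE mem_set // mulr1.
exists g; split=> //; apply: (subspace_ae subL Lf); first exact: bdm_Lfun.
by apply: filterS fg => x.
Qed.

(** Gram-Schmidt is run on bounded representatives of a basis. Orthogonality to these extends to all
    of [L], whose elements are their combinations almost everywhere. *)
Lemma exists_onb k : has_L2_dim Q L k ->
  exists n e, [/\ (n <= k)%N, orthonormal Q e n,
    forall i, (i < n)%N -> L (e i) &
    forall f g, bdm f -> L g ->
      mean Q (fun x => residual Q e n f x * g x) = 0].
Proof.
move=> [e0 [Le0 _ spanL]].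
have /choice[e1 He1] : forall i, exists g, [/\ bdm g, L g & \forall x \ae Q, e0 i x = g x].
  by move=> i; apply: L_bdm_rep; apply: Le0.
pose phi i : E -> R := if insub i is Some j then e1 j else fun=> 0.
have phiE (j : 'I_k) : phi j = e1 j by rewrite /phi valK.
have bphi i : (i < k)%N -> bdm (phi i).
  by move=> ik; rewrite (phiE (Ordinal ik)); case: (He1 (Ordinal ik)).
have [n [e [nk oe span res]]] := gram_schmidt Q bphi.
have Le i : (i < n)%N -> L (e i).
  apply: span => [|a f g Lf Lg|j jk]; first exact: (subspace0 subL).
    exact: (subspace_lin subL).
  by rewrite (phiE (Ordinal jk)); case: (He1 (Ordinal jk)).
exists n, e; split=> // f g bf Lg.
have [be _] := oe.
have br : bdm (residual Q e n f) by exact: residual_bdm.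
have orth_e1 j : mean Q (fun x => residual Q e n f x * e1 j x) = 0.
  have [b1 _ _] := He1 j.
  have r0 : \forall x \ae Q, residual Q e n (e1 j) x = 0.
    apply: ae_eq0_of_mean_sqr; first exact: residual_bdm.
    by rewrite -phiE; apply: res.
  have -> : mean Q (fun x => residual Q e n f x * e1 j x) =
     mean Q (fun x => (\sum_(i < n) coef Q e (e1 j) i * e i x) * residual Q e n f x).
    apply: mean_ae_eq; [exact: bdmM|by apply: bdmM => //; apply: bdm_lin|].
    apply: filterS r0 => x; rewrite {1}/residual => /eqP.
    by rewrite subr_eq0 => /eqP ->; rewrite mulrC.
  rewrite mean_lin_mul // big1 // => i _.
  rewrite (@mean_ext _ _ _ _ _ (fun x => residual Q e n f x * e i x)).
    by rewrite residual_orth ?mulr0.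
  by move=> x; rewrite mulrC.
have [c gc] := spanL _ Lg.
have ae1 : \forall x \ae Q, g x = \sum_j c ord0 j * e1 j x.
  have : \forall x \ae Q, forall j, e0 j x = e1 j x.
    by apply: filter_forall => j; case: (He1 j).
  apply: filterS2 gc => x gx H; rewrite (gx I) /lin_comb.
  by apply: eq_bigr => j _; rewrite H.
have be1 : bdm (fun x => \sum_j c ord0 j * e1 j x).
  by apply: bdm_sum => j; apply: bdmZ; case: (He1 j).
have -> : mean Q (fun x => residual Q e n f x * g x) =
    mean Q (fun x => residual Q e n f x * \sum_j c ord0 j * e1 j x).
  rewrite /mean /Rintegral; congr fine; apply: ae_eq_integral => //.
  - apply/measurable_EFinP; apply: measurable_funM; first by case: br.
    exact: L_measurable.
  - by apply/measurable_EFinP; case: (bdmM br be1).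
  - by apply: filterS ae1 => x -> _.
rewrite (@mean_ext _ _ _ _ _ (fun x => \sum_j c ord0 j *
    (residual Q e n f x * e1 j x))).
  rewrite mean_sum; last by move=> j; apply: bdmZ; apply: bdmM => //; case: (He1 j).
  rewrite big1 // => j _; rewrite meanZ ?orth_e1 ?mulr0 //.
  by apply: bdmM => //; case: (He1 j).
by move=> x; rewrite mulr_sumr; apply: eq_bigr => j _; rewrite mulrCA.
Qed.

(** The residual [r] is itself a projection onto the orthogonal complement, so [xget] finds one.
    Whichever [p] it returns satisfies <p, r> = <f, r> = <r, r>, and <p, r> is at most half the sum
    of the squared norms. *)
Lemma residual_le_orth_proj n e f : orthonormal Q e n ->
  (forall i, (i < n)%N -> L (e i)) ->
  (forall f g, bdm f -> L g -> mean Q (fun x => residual Q e n f x * g x) = 0) ->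
  bdm f ->
  ((Num.sqrt (mean Q (fun x => residual Q e n f x ^+ 2)))%:E <=
   L2norm Q (orth_proj Q (orth_compl Q L) f))%E.
Proof.
move=> oe Le orth bf; have [be _] := oe; set r := residual Q e n f.
have br : bdm r by exact: residual_bdm.
have Lp : L (fun x => \sum_(i < n) coef Q e f i * e i x) by exact: L_lin_comb.
have bp : bdm (fun x => \sum_(i < n) coef Q e f i * e i x) by exact: bdm_lin.
have fr x : f x - r x = \sum_(i < n) coef Q e f i * e i x.
  by rewrite /r /residual subKr.
have rperp : orth_compl Q L r.
  by split; [exact: bdm_Lfun|move=> g Lg; exact: orth].
have ex : exists p, is_orth_proj Q (orth_compl Q L) f p.
  exists r; split=> // g [_ gperp]; rewrite -[RHS](gperp _ Lp) /inner.
  by apply: eq_Rintegral => x _; rewrite fr mulrC.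
have [[pL pperp] porth] := xgetPex (cst 0) ex.
rewrite -/(orth_proj Q (orth_compl Q L) f) in pL pperp porth.
set p := orth_proj _ _ _ in pL pperp porth *.
have mp : measurable_fun setT p.
  by have := sub_Lfun_mfun pL; rewrite inE.
have ip2 := Lfun2_integrable_sqr pL.
have ipr : Q.-integrable setT (EFin \o (fun x => p x * r x)).
  exact: (proj1 (Lfun1_integrable _ _) (Lfun2_mul_Lfun1 pL (bdm_Lfun Q br))).
have h1 : mean Q (fun x => f x * r x) = mean Q (fun x => p x * r x).
  have := porth _ rperp; rewrite /inner => h0.
  apply/eqP; rewrite -subr_eq0 /mean -RintegralB //; last first.
    exact/bdm_integrable/bdmM.
  by apply/eqP; rewrite -[RHS]h0; apply: eq_Rintegral => x _; rewrite mulrBl.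
have h2 : mean Q (fun x => r x ^+ 2) = mean Q (fun x => f x * r x).
  apply/esym/eqP; rewrite -subr_eq0 -meanB; [|exact: bdmM|exact: bdm_sqr].
  apply/eqP; rewrite -[RHS](orth _ _ bf Lp); apply: mean_ext => x.
  by rewrite -fr -/r; ring.
have h3 : mean Q (fun x => p x * r x) <=
    2^-1 * mean Q (fun x => p x ^+ 2) + 2^-1 * mean Q (fun x => r x ^+ 2).
  have i1 := bdm_integrable Q (bdmZ 2^-1 (bdm_sqr br)).
  have i2 : Q.-integrable setT (EFin \o (fun x => 2^-1 * p x ^+ 2)).
    exact: (integrableZl measurableT _ ip2).
  rewrite -(meanZ _ _ (bdm_sqr br)) /mean -RintegralZl // -RintegralD //.
  apply: le_Rintegral => //.
    exact: (integrableD measurableT i2 i1).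
  by move=> x _; have := sqr_ge0 (p x - r x); nra.
rewrite L2norm_integrable // lee_fin; apply: ler_wsqrtr.
lra.
Qed.

End Subspaces.

Section LossConstants.
Context (R : realType) (dT : measure_display) (T : measurableType dT)
  (ell : T -> R -> R) (hell : is_loss ell).

Lemma loss_constants : exists L K0 : R, [/\ 0 < L,
  forall y u, `|derive1n 2 (ell y) u| <= L,
  forall y u v, `|u| <= 1 -> `|v| <= 1 -> `|ell y u - ell y v| <= L * `|u - v|,
  forall y u, `|u| <= 1 -> `|derive1 (ell y) u| <= L &
  forall y u, `|u| <= 1 -> `|ell y u| <= K0].
Proof.
have [K2 h2] := loss_d2_bounded hell.
have [K0 h0] := loss_at0_bounded hell.
have [K1 h1] := loss_d1_at0_bounded hell.
pose L := `|K1| + `|K2| + 1.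
have d1 y u : derivable (ell y) u 1 by exact: loss_derivable.
have d2 y u : derivable (derive1 (ell y)) u 1 by exact: loss_derivable2.
have h2' y u : `|derive1n 2 (ell y) u| <= `|K2|.
  by apply: le_trans (h2 y u) _; exact: ler_norm.
have h1' y : `|derive1 (ell y) 0| <= `|K1| + 1.
  by apply: le_trans (h1 y) _; have := ler_norm K1; lra.
have LE : L = `|K1| + 1 + `|K2| by rewrite /L; ring.
have lip y u v : `|u| <= 1 -> `|v| <= 1 -> `|ell y u - ell y v| <= L * `|u - v|.
  by move=> u1 v1; rewrite LE; apply: (lip_on_unit (d1 y) (d2 y) (h2' y)).
have L0 : 0 < L.
  by rewrite /L; have := normr_ge0 K1; have := normr_ge0 K2; lra.
exists L, (K0 + L); split=> //.
- move=> y u; apply: le_trans (h2' y u) _.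
  by rewrite /L; have := normr_ge0 K1; lra.
- move=> y u u1; have := derive1_lip (d2 y) (h2' y) 0 u; rewrite subr0 => h.
  have h3 : `|K2| * `|u| <= `|K2| by rewrite ler_piMr.
  rewrite -(subrK (derive1 (ell y) 0) (derive1 (ell y) u)).
  apply: le_trans (ler_normD _ _) _; have := h1' y; rewrite LE; lra.
- move=> y u u1; rewrite ger0_norm; last exact: loss_ge0.
  have n0 : `|0 : R| <= 1 by rewrite normr0 ler01.
  have := lip y u 0 u1 n0; rewrite subr0 => h.
  have h3 : L * `|u| <= L by rewrite ler_piMr // ltW.
  have := ler_norm (ell y u - ell y 0); have := h0 y; lra.
Qed.

Let d2set (r : R) y := [set derive1n 2 (ell y) u | u in [set u : R | `|u| <= r]].

(** [inf] is a greatest lower bound only for nonempty sets bounded below; the bound on the second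
    derivative supplies [- K] for both infima in [tau]. *)
Let lb_d2set (K r : R) : (forall y u, `|derive1n 2 (ell y) u| <= K) ->
  forall y, lbound (d2set r y) (- K).
Proof.
by move=> hK y _ [u _ <-]; have := hK y u; rewrite ler_norml => /andP[].
Qed.

Let inf_d2set_ge (K r : R) : 0 <= r ->
  (forall y u, `|derive1n 2 (ell y) u| <= K) ->
  lbound [set inf (d2set r y) | y in setT] (- K).
Proof.
move=> r0 hK _ [y _ <-]; apply: lb_le_inf; last exact: lb_d2set.
by exists (derive1n 2 (ell y) 0); exists 0 => //=; rewrite normr0.
Qed.

Lemma tau_le_d2 y w : `|w| <= 1 -> 2 * tau ell 1 <= derive1n 2 (ell y) w.
Proof.
move=> w1; have [K hK] := loss_d2_bounded hell.
rewrite /tau mulrA divff // mul1r.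
apply: (@le_trans _ _ (inf (d2set 1 y))).
  apply: ge_inf; first by exists (- K); exact: inf_d2set_ge.
  by exists y.
by apply: ge_inf; [exists (- K); exact: lb_d2set|exists w].
Qed.

Lemma tau_antitone (y0 : T) (r : R) : 1 <= r -> tau ell r <= tau ell 1.
Proof.
move=> r1; have [K hK] := loss_d2_bounded hell.
rewrite /tau; apply: ler_wpM2l; first by rewrite invr_ge0.
apply: lb_le_inf; first by exists (inf (d2set 1 y0)); exists y0.
move=> _ [y _ <-]; apply: (@le_trans _ _ (inf (d2set r y))).
  apply: ge_inf; last by exists y.
  by exists (- K); apply: inf_d2set_ge => //; apply: le_trans r1.
apply: lb_le_inf.
  by exists (derive1n 2 (ell y) 0); exists 0 => //=; rewrite normr0 ler01.
move=> _ [u /= u1 <-]; apply: ge_inf; first by exists (- K); exact: lb_d2set.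
by exists u => //=; apply: le_trans r1.
Qed.

End LossConstants.

(** The case [N = 1]: the required probability is 0 and the empty subevent suffices. *)
Lemma with_prob_ge_trivial (R : realType) (dO : measure_display)
    (Omega : measurableType dO) (Pr : probability Omega R) (A : R)
    (E : set Omega) : with_prob_ge Pr (1 - 1%:R `^ (- A)) E.
Proof.
by exists set0; split=> //; rewrite measure0 powR1 subrr.
Qed.

Theorem theorem3 (R : realType) (dT : measure_display) (T : measurableType dT)
    (ell : T -> R -> R) (hell : is_loss ell) (gamma : R) (hgamma : 0 < gamma) :
  exists D C : R, 0 < D /\ 0 < C /\
  forall (dS dO : measure_display) (S : measurableType dS)
    (Omega : measurableType dO) (Pr : probability Omega R)
    (P : probability (S * T)%type R)
    (M : R) (fstar : S -> R)
    (n N : nat) (Z : 'I_n -> {RV Pr >-> (S * T)%type}) (h : 'I_N -> S -> R),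
  is_target P ell M fstar ->
  0 < tau ell (Num.max M 1) ->
  (0 < n)%N -> (0 < N)%N ->
  (ln n%:R) `^ gamma <= N%:R :> R ->
  iid_sample P Z ->
  (forall j, measurable_fun setT (h j)) ->
  (forall j x, `|h j x| <= 1) ->
  (* (1) *)
  (forall (J : {set 'I_N}) (A eps : R) (lam : 'rV[R]_N)
      (lamhat : Omega -> 'rV[R]_N),
    1 <= A ->
    D * Num.sqrt ((#|J|%:R + A * ln N%:R) / n%:R) <= eps ->
    is_argmin (@simplex R N) (pen_risk P ell h eps) lam ->
    (forall w, is_argmin (@simplex R N)
       (pen_emp_risk (fun i => Z i w) ell h eps) (lamhat w)) ->
    with_prob_ge Pr (1 - N%:R `^ (- A))
      [set w | (`|risk P ell (lin_comb h (lamhat w))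
                  - risk P ell (lin_comb h lam)|
                <= risk_bound C (L2norm (marginal1 P) (g_fun P ell h lam))
                     (B1 n J A lam)%:E)%E])
  /\
  (* (2) *)
  (forall (A eps : R) (J : {set 'I_N}) (L : set (S -> R)) (d : nat)
      (lam : 'rV[R]_N) (lamhat : Omega -> 'rV[R]_N),
    1 <= A ->
    D * Num.sqrt (A * ln N%:R / n%:R) <= eps ->
    L2_subspace (marginal1 P) L ->
    has_L2_dim (marginal1 P) L d ->
    is_argmin (@simplex R N) (pen_risk P ell h eps) lam ->
    (forall w, is_argmin (@simplex R N)
       (pen_emp_risk (fun i => Z i w) ell h eps) (lamhat w)) ->
    with_prob_ge Pr (1 - N%:R `^ (- A))
      [set w | (`|risk P ell (lin_comb h (lamhat w))
                  - risk P ell (lin_comb h lam)|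
                <= risk_bound C (L2norm (marginal1 P) (g_fun P ell h lam))
                     (B2 (marginal1 P) n h J L d A lam))%E]).
Proof.
(* The constants are built from [tau ell 1], since all [f_lam] take values in [-1, 1]; this keeps
   them free of [M]. If it is not positive, neither is [tau ell (Num.max M 1)], and no admissible
   setting exists. *)
have [tau1|ntau] := ltP 0 (tau ell 1); last first.
  exists 1, 1; split=> //; split=> // dS dO S Omega Pr P M fstar n N Z h _ tauM.
  have [[_ y] _] := probability_nonempty P.
  have M1 : 1 <= Num.max M 1 by rewrite le_max lexx orbT.
  have := lt_le_trans tauM (tau_antitone hell y M1).
  by rewrite ltNge ntau.
have [L [K0 [L0 ell2 lip ell1 ellK]]] := loss_constants hell.
have tauB := tau_le_d2 hell.
have rc0 : 0 < rate_const L (tau ell 1) by exact: rate_const_gt0.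
exists (eps_const L), (2 * (8 * rate_const L (tau ell 1) / tau ell 1) * (L + 2)).
have D0 : 0 < eps_const L by apply: mulr_gt0 => //; apply: exprn_gt0.
have C0 : 0 < 2 * (8 * rate_const L (tau ell 1) / tau ell 1) * (L + 2).
  apply: mulr_gt0; last by rewrite addr_gt0.
  by apply: mulr_gt0 => //; apply: divr_gt0 => //; apply: mulr_gt0.
do 2![split=> //].
move=> dS dO S Omega Pr P M fstar n N Z h _ _ n0 N0 _ iidZ mh h1.
have [N1|N1] := leqP N 1.
  have N_eq1 : N = 1%N by apply/eqP; rewrite eqn_leq N1 N0.
  by split=> *; rewrite [in N%:R]N_eq1; exact: with_prob_ge_trivial.
pose j0 : 'I_N := Ordinal N0.
have bh j : bdm (h j) by split=> //; exists 1.
have nR : 0 < n%:R :> R by rewrite ltr0n.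
have l0 : 0 < ln N%:R :> R by rewrite ln_gt0 // ltr1n.
split.
  move=> J A eps lam lamhat A1 heps argl argh.
  (* Orthonormalizing these gives a system of at most [#|J|] functions, for which the residuals with
     j in J vanish almost everywhere. *)
  pose phi k := h (nth j0 (enum J) k).
  have [n1 [e [n1J oe _ res]]] := @gram_schmidt _ _ _ (marginal1 P) #|J| phi
    (fun k _ => bh (nth j0 (enum J) k)).
  have res0 j : j \in J -> mean (marginal1 P)
      (fun x => residual (marginal1 P) e n1 (h j) x ^+ 2) = 0.
    move=> jJ; have := res (index j (enum J)).
    by rewrite cardE index_mem mem_enum /phi nth_index ?mem_enum // => /(_ jJ).
  have resU j : j \in J -> \forall x \ae marginal1 P,
      `|residual (marginal1 P) e n1 (h j) x| <= 1.
    move=> jJ; have br := residual_bdm oe (bh j).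
    apply: filterS (ae_eq0_of_mean_sqr br (res0 j jJ)) => x ->.
    by rewrite normr0 ler01.
  have resJ j : j \in J -> mean (marginal1 P)
      (fun x => residual (marginal1 P) e n1 (h j) x ^+ 2) <= 0 ^+ 2.
    by move=> jJ; rewrite res0 // sqr_ge0.
  have offJ (b : 'I_N -> R) : \sum_(j | j \notin J) `|b j| <=
      1 * \sum_(j | j \notin J) `|b j| by rewrite mul1r.
  have [e_ [A_ [be he qU [qJ qJc] Adec]]] := exists_decomposition mh h1
    oe (fintype.subxx J) (lexx 1) resU resJ offJ.
  have sl := argl.1; have [lam0 _] := sl.
  set sJ := \sum_(j < N | j \notin J) lam ord0 j.
  have sJ0 : 0 <= sJ by apply: sumr_ge0.
  pose r := (#|J|%:R + A * ln N%:R) / n%:R.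
  have A0 : 0 <= A by apply: le_trans A1.
  have al0 : 0 <= A * ln N%:R by rewrite mulr_ge0 // ltW.
  have n1r : n1%:R / n%:R <= r.
    rewrite /r ler_pM2r ?invr_gt0 // -[leLHS]addr0 lerD // ler_nat //.
  have alr : A * ln N%:R / n%:R <= r.
    by rewrite /r ler_pM2r ?invr_gt0 // lerDr.
  have lr : 1 * ln N%:R / n%:R <= r.
    apply: le_trans alr; rewrite ler_pM2r ?invr_gt0 //.
    by rewrite ler_pM2r.
  have r0 : 0 <= r by rewrite divr_ge0 ?addr_ge0.
  have B10 : 0 <= B1 n J A lam by rewrite /B1 le_max r0.
  (* Here [U = 1], [m = 0] and [kappa = 1]: functions outside J are not projected. *)
  apply: (excess_risk_bound hell L0 ell2 lip ell1 ellK tau1 tauB mh h1 iidZ n0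
    j0 be he (lexx 1) (lexx 0) ler01 qU qJ qJc Adec N1 A1 argl _ _ argh).
  - by apply: le_trans heps; rewrite ler_pM2l // ler_wsqrtr.
  - by rewrite mul1r; apply: le_trans heps; rewrite ler_pM2l // ler_wsqrtr.
  - by rewrite lee_fin.
  rewrite -EFinM lee_fin /rate -/sJ addr0 mul1r.
  have p1 := ler_wpM2l sJ0 (ler_wsqrtr alr).
  have p2 := ler_wpM2l sJ0 (ler_wsqrtr n1r).
  have q1 : r <= B1 n J A lam by rewrite /B1 le_max lexx.
  have q2 : sJ * Num.sqrt r <= B1 n J A lam by rewrite /B1 le_max lexx orbT.
  have n1al : n1%:R / n%:R + A * ln N%:R / n%:R <= r.
    by rewrite -mulrDl ler_pM2r ?invr_gt0 // lerD2r ler_nat.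
  rewrite mul1r in lr; lra.
move=> A eps J Ls d lam lamhat A1 heps subL dimL argl argh.
have A0 : 0 <= A by apply: le_trans A1.
have lnn0 : 0 < ln N%:R / n%:R :> R by rewrite divr_gt0.
have U_lb : (1 <= U_of (marginal1 P) Ls)%E.
  by rewrite /U_of -[leLHS]add0e leeD2r // le_max lexx.
(* If U(L) is infinite then so is [B2], because [ln N / n] is positive, and the bound holds
   everywhere. *)
case UE : (U_of (marginal1 P) Ls) U_lb => [u| |] // _; last first.
  exists setT; split=> //; last first.
    rewrite probability_setT lee_fin lerBlDr lerDl; exact: powR_ge0.
  move=> w _ /=; rewrite /risk_bound /B2 UE gt0_mulye ?lte_fin //.
  by rewrite !maxey gt0_muley ?lte_fin // maxye leey.
have [n1 [e [n1d oe Le orth]]] := exists_onb subL UE dimL.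
have u1 : 1 <= u := U_ge1 UE.
pose res j := residual (marginal1 P) e n1 (h j).
have bres j : bdm (res j) by exact: residual_bdm.
pose m := \big[Num.max/0]_(j in J)
  Num.sqrt (mean (marginal1 P) (fun x => res j x ^+ 2)).
have m_ge j : j \in J ->
    Num.sqrt (mean (marginal1 P) (fun x => res j x ^+ 2)) <= m.
  by move=> jJ; exact: (le_bigmax_cond 0 _ jJ).
have m0 : 0 <= m by exact: bigmax_ge_id.
have [be _] := oe.
(* The projection of [h j] has norm at most 1, hence is bounded by [u - 1]; the 1 added in U(L) pays
   for [h j] itself. *)
have resU j : j \in [set: 'I_N]%SET -> \forall x \ae marginal1 P, `|res j x| <= u.
  move=> _.
  have := L_ae_bounded subL UE (L_lin_comb subL (coef (marginal1 P) e (h j)) Le).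
  apply: filterS => x hx; rewrite /res /residual.
  apply: le_trans (ler_normB _ _) _.
  have s1 : Num.sqrt (mean (marginal1 P) (fun x =>
      (\sum_(k < n1) coef (marginal1 P) e (h j) k * e k x) ^+ 2)) <= 1.
    rewrite mean_proj_sqr // -[leRHS]sqrtr1; apply: ler_wsqrtr.
    by apply: le_trans (bessel oe (bh j)) _; apply: mean_sqr_le1.
  have u0 : 0 <= u - 1 by rewrite subr_ge0.
  have := le_trans hx (ler_wpM2l u0 s1); have := h1 j x; lra.
have resJ j : j \in J -> mean (marginal1 P) (fun x => res j x ^+ 2) <= m ^+ 2.
  move=> jJ; have mr0 : 0 <= mean (marginal1 P) (fun x => res j x ^+ 2).
    by apply: mean_ge0 => x; exact: sqr_ge0.
  by rewrite -[leLHS]sqr_sqrtr // ler_sqr ?nnegrE ?sqrtr_ge0 // m_ge.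
have offJ (b : 'I_N -> R) : \sum_(j | j \notin [set: 'I_N]%SET) `|b j| <=
    0 * \sum_(j | j \notin J) `|b j|.
  by rewrite mul0r big_pred0 // => j; rewrite finset.in_setT.
(* Every [h j] is projected, so [kappa = 0] and the condition on [eps] involving the dimension
   disappears. *)
have [e_ [A_ [be_ he qU [qJ qJc] Adec]]] := exists_decomposition mh h1
  oe (finset.subsetT J) u1 resU resJ offJ.
have sl := argl.1; have [lam0 _] := sl.
set sJ := \sum_(j < N | j \notin J) lam ord0 j.
have sJ0 : 0 <= sJ by apply: sumr_ge0.
set q := Num.sqrt (A * ln N%:R / n%:R) in heps.
have q0 : 0 <= q by exact: sqrtr_ge0.
pose b := Num.max ((d%:R + A * ln N%:R) / n%:R)
  (Num.max (Num.max sJ m * q) (u * (ln N%:R / n%:R))).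
have b0 : 0 <= b.
  by rewrite /b le_max divr_ge0 // addr_ge0 // mulr_ge0 // ltW.
have m_le : (m%:E <= \big[maxe/0]_(j in J)
    L2norm (marginal1 P) (orth_proj (marginal1 P) (orth_compl (marginal1 P) Ls) (h j)))%E.
  apply: (big_ind2 (fun (x : R) (y : \bar R) => (x%:E <= y)%E)) => //.
    by move=> x1 y1 x2 y2 xy1 xy2; rewrite EFin_max; exact: le_max2.
  by move=> j _; exact: residual_le_orth_proj.
have b_le : (b%:E <= B2 (marginal1 P) n h J Ls d A lam)%E.
  rewrite /b /B2 UE !EFin_max; apply: le_max2 => //; apply: le_max2 => //.
  rewrite EFinM EFin_max; apply: lee_wpmul2r; first by rewrite lee_fin.
  by apply: le_max2.
apply: (excess_risk_bound hell L0 ell2 lip ell1 ellK tau1 tauB mh h1 iidZ n0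
  j0 be_ he u1 m0 (lexx 0) qU qJ qJc Adec N1 A1 argl heps _ argh).
- rewrite mul0r mulr0; apply: le_trans heps; apply: mulr_ge0 => //; exact: ltW.
- by apply: le_trans b_le; rewrite lee_fin.
apply: (@le_trans _ _ (4%:E * b%:E)%E); last by apply: lee_wpmul2l.
rewrite -EFinM lee_fin /rate -/sJ -/q !mul0r addr0.
have c1 : (d%:R + A * ln N%:R) / n%:R <= b by rewrite /b le_max lexx.
have c2 : sJ * q <= b.
  by rewrite /b !le_max; apply/orP; right; apply/orP; left;
    apply: ler_wpM2r => //; rewrite le_max lexx.
have c3 : m * q <= b.
  by rewrite /b !le_max; apply/orP; right; apply/orP; left;
    apply: ler_wpM2r => //; rewrite le_max lexx orbT.
have c4 : u * (ln N%:R / n%:R) <= b by rewrite /b !le_max lexx !orbT.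
have n1al : n1%:R / n%:R + A * ln N%:R / n%:R <= (d%:R + A * ln N%:R) / n%:R.
  by rewrite -mulrDl ler_pM2r ?invr_gt0 // lerD2r ler_nat.
rewrite mulrA in c4; rewrite mulrDl; lra.
Qed.
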